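(* Let $(X_{i,j})_{i,j\geq 1}$ be an infinite array of i.i.d. nonnegative real random variables with mean $\mathbb{E}(X_{1,1})=1$ and finite positive variance $0<\sigma^2<\infty$. For each $n\geq 1$, let $M$ be the $n\times n$ random Markov matrix obtained by normalizing the rows of $(X_{i,j})_{1\leq i,j\leq n}$, i.e. $M_{i,j}=X_{i,j}/(X_{i,1}+\cdots+X_{i,n})$ (with $M_{i,j}=\delta_{i,j}$ for all $j$ if $X_{i,1}+\cdots+X_{i,n}=0$). Then almost surely, the probability measures $\nu_{\sqrt{n}M}=\frac1n\sum_{k=1}^n\delta_{s_k(\sqrt{n}M)}$ converge weakly, as $n\to\infty$, to the quartercircular law $\mathcal{Q}_\sigma$.
   Context: For an $n\times n$ complex matrix $A$, $s_1(A)\geq\cdots\geq s_n(A)$ denote its singular values, i.e. the eigenvalues of $\sqrt{AA^*}$ in nonincreasing order, where $A^*$ is the conjugate transpose. Define $\nu_A:=\frac1n\sum_{k=1}^n\delta_{s_k(A)}$. Weak convergence is with respect to bounded continuous functions. The quartercircular law $\mathcal{Q}_\sigma$ is the probability measure on $[0,2\sigma]$ with Lebesgue density $x\mapsto\frac{1}{\pi\sigma^2}\sqrt{4\sigma^2-x^2}\,\mathbf{1}_{[0,2\sigma]}(x)$. All random matrices are built from the same infinite array, on a common probability space. *)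

(* Defs.v *)
From HB Require Import structures.
From mathcomp Require Import all_boot all_order all_algebra.
From mathcomp Require Import finmap complex.
From mathcomp Require Import all_classical all_reals all_analysis measurable_realfun.

Set Implicit Arguments.
Unset Strict Implicit.
Unset Printing Implicit Defensive.

Import Order.TTheory GRing.Theory Num.Theory.
Import numFieldNormedType.Exports.

Local Open Scope classical_set_scope.
Local Open Scope ring_scope.
Local Open Scope sesquilinear_scope.
Local Open Scope complex_scope.

Section singular_values.
Context {R : realType}.
Local Notation C := R[i].

Definition psdmx n (B : 'M[C]_n) :=
  B \is hermsymmx /\ forall u : 'rV[C]_n, 0 <= (u *m B *m u ^t*) 0 0.

Lemma psdmx_mulmx_tr n (A : 'M[C]_n) : psdmx (A *m A ^t*).
Proof.
split.
  by apply/is_hermitianmxP; rewrite expr0 scale1r trmx_mul map_mxM trmxCK.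
move=> u; rewrite mulmxA -mulmxA -map_mxM -trmx_mul mxE sumr_ge0// => k _.
by rewrite !mxE mul_conjC_ge0.
Qed.

(* Functional calculus on the spectral decomposition B = U^* diag(d) U; for B
   positive semidefinite this is the positive semidefinite square root of B
   (lemmas sqrtmx_psd and sqr_sqrtmx below). *)
Definition sqrtmx n (B : 'M[C]_n) : 'M[C]_n :=
  (spectralmx B) ^t* *m diag_mx (map_mx sqrtC (spectral_diag B))
    *m spectralmx B.

Lemma spectral_diag_psd n (B : 'M[C]_n) : psdmx B ->
  forall i, 0 <= spectral_diag B 0 i.
Proof.
move=> [/hermitian_normalmx /orthomx_spectralP BE Bpsd] i.
have /unitarymxP UU := spectral_unitarymx B.
have := Bpsd (row i (spectralmx B)).
rewrite {2}BE invmx_unitary ?spectral_unitarymx// rowE.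
rewrite trmx_mul map_mxM !mulmxA -(mulmxA (delta_mx 0 i)) UU mulmx1.
rewrite -!mulmxA (mulmxA (spectralmx B)) UU mul1mx -rowE.
rewrite trmx_delta map_delta_mx -colE !mxE eqxx mulr1n //.
Qed.

Lemma sqrtmx_psd n (B : 'M[C]_n) : psdmx B -> psdmx (sqrtmx B).
Proof.
move=> Bpsd.
have d_ge0 i : 0 <= sqrtC (spectral_diag B 0 i).
  by rewrite sqrtC_ge0 spectral_diag_psd.
split.
  apply/is_hermitianmxP; rewrite expr0 scale1r /sqrtmx !trmx_mul !map_mxM.
  rewrite trmxCK mulmxA tr_diag_mx map_diag_mx; congr (_ *m diag_mx _ *m _).
  by apply/rowP => i; rewrite !mxE; apply/esym/CrealP; rewrite ger0_real.
move=> u; rewrite /sqrtmx.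
set v := u *m (spectralmx B) ^t*.
have -> : u *m ((spectralmx B) ^t* *m diag_mx (map_mx sqrtC (spectral_diag B))
    *m spectralmx B) *m u ^t* =
    v *m diag_mx (map_mx sqrtC (spectral_diag B)) *m v ^t*.
  by rewrite /v trmx_mul map_mxM trmxCK !mulmxA.
rewrite mxE sumr_ge0// => k _.
rewrite mul_mx_diag !mxE mulrAC mulr_ge0 ?mul_conjC_ge0//.
Qed.

Lemma sqr_sqrtmx n (B : 'M[C]_n) : psdmx B -> sqrtmx B *m sqrtmx B = B.
Proof.
move=> [/hermitian_normalmx /orthomx_spectralP BE _].
have /unitarymxP UU := spectral_unitarymx B.
rewrite [RHS]BE invmx_unitary ?spectral_unitarymx// /sqrtmx.
rewrite -!mulmxA (mulmxA (spectralmx B)) UU mul1mx (mulmxA (diag_mx _)).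
rewrite mulmx_diag; congr (_ *m (diag_mx _ *m _)).
by apply/rowP => i; rewrite !mxE -expr2 sqrtCK.
Qed.

(* The eigenvalues, repeated according to algebraic multiplicity. *)
Definition eigenvalues n (B : 'M[C]_n) : seq C :=
  sval (closed_field_poly_normal (char_poly B)).

Lemma char_poly_eigenvalues n (B : 'M[C]_n) :
  char_poly B = \prod_(z <- eigenvalues B) ('X - z%:P).
Proof.
rewrite /eigenvalues; case: closed_field_poly_normal => r /= {1}->.
by rewrite (monicP (char_poly_monic B)) scale1r.
Qed.

Lemma size_eigenvalues n (B : 'M[C]_n) : size (eigenvalues B) = n.
Proof.
have := size_char_poly B.
by rewrite char_poly_eigenvalues size_prod_XsubC => -[].
Qed.

Lemma psd_eigenvalues n (B : 'M[C]_n) z : psdmx B ->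
  z \in eigenvalues B -> 0 <= z.
Proof.
move=> [_ Bpsd] zB.
have : eigenvalue B z.
  by rewrite eigenvalue_root_char char_poly_eigenvalues root_prod_XsubC.
case/eigenvalueP => v vB v_neq0.
have := Bpsd v; rewrite vB -scalemxAl mxE.
suff v_gt0 : 0 < (v *m v ^t*) 0 0 by rewrite pmulr_lge0.
rewrite mxE lt_def sumr_ge0 ?andbT; last first.
  by move=> k _; rewrite !mxE mul_conjC_ge0.
apply: contra v_neq0; rewrite psumr_eq0; last first.
  by move=> k _; rewrite !mxE mul_conjC_ge0.
move=> /allP v0; apply/eqP/rowP => k; apply/eqP.
have := v0 k (mem_index_enum _).
by rewrite !mxE mul_conjC_eq0.
Qed.

(* The eigenvalues here are nonnegative reals (psd_eigenvalues), so that taking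
   real parts only changes their type. *)
Definition singular_values n (A : 'M[C]_n) : seq R :=
  sort >=%R [seq complex.Re z | z <- eigenvalues (sqrtmx (A *m A ^t*))].

Lemma size_singular_values n (A : 'M[C]_n) : size (singular_values A) = n.
Proof. by rewrite size_sort size_map size_eigenvalues. Qed.

Lemma char_poly_singular_values n (A : 'M[C]_n) :
  char_poly (sqrtmx (A *m A ^t*)) =
    \prod_(s <- singular_values A) ('X - (s%:C)%:P).
Proof.
rewrite char_poly_eigenvalues.
rewrite [RHS](perm_big _ (permEl (perm_sort _ _))) big_map.
rewrite big_seq [RHS]big_seq; apply: eq_bigr => z zA.
congr ('X - _%:P); apply/esym/RRe_real/ger0_real.
by apply: psd_eigenvalues zA; exact/sqrtmx_psd/psdmx_mulmx_tr.
Qed.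

(* s_{k+1}(A): indices start at 0 *)
Definition singular_value n (A : 'M[C]_n) (k : nat) : R :=
  nth 0 (singular_values A) k.

Definition sv_measure n (A : 'M[C]_n) : {measure set R -> \bar R} :=
  mscale (n%:R^-1)%:nng (msum (fun k => \d_(singular_value A k)) n).

End singular_values.

Section quartercircular.
Context {R : realType} (sigma : R).
Local Notation mu := (@lebesgue_measure R).

Definition quartercircular_pdf (x : R) : R :=
  (pi * sigma ^+ 2)^-1 * Num.sqrt (4 * sigma ^+ 2 - x ^+ 2)
    * \1_(`[0, 2 * sigma]) x.

Lemma quartercircular_pdf_ge0 x : 0 <= quartercircular_pdf x.
Proof.
rewrite /quartercircular_pdf !mulr_ge0 ?sqrtr_ge0 ?ler0n// invr_ge0.
by rewrite mulr_ge0 ?pi_ge0 ?sqr_ge0.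
Qed.

Lemma measurable_quartercircular_pdf : measurable_fun setT quartercircular_pdf.
Proof.
apply: measurable_funM; last exact: measurable_indic.
apply: measurable_funM; first exact: measurable_cst.
apply: measurableT_comp.
  by apply: continuous_measurable_fun; exact: sqrt_continuous.
by apply: measurable_funB; [exact: measurable_cst | exact: measurable_funX].
Qed.

Definition quartercircular (V : set R) : \bar R :=
  (\int[mu]_(x in V) (quartercircular_pdf x)%:E)%E.

Let quartercircular0 : quartercircular set0 = 0%E.
Proof. exact: integral_set0. Qed.

Let quartercircular_ge0 V : (0 <= quartercircular V)%E.
Proof.
by apply: integral_ge0 => x _; rewrite lee_fin quartercircular_pdf_ge0.
Qed.

Let quartercircular_sigma_additive : semi_sigma_additive quartercircular.
Proof.
move=> /= F mF tF mUF; rewrite /quartercircular; apply: cvg_toP.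
  apply: ereal_nondecreasing_is_cvgn => m n mn.
  apply: lee_sum_nneg_natr => // k _ _.
  by apply: integral_ge0 => x _; rewrite lee_fin quartercircular_pdf_ge0.
rewrite ge0_integral_bigcup//=.
- apply: measurable_funTS; apply: measurableT_comp => //.
  exact: measurable_quartercircular_pdf.
- by move=> x _; rewrite lee_fin quartercircular_pdf_ge0.
Qed.

HB.instance Definition _ := isMeasure.Build _ _ _ quartercircular
  quartercircular0 quartercircular_ge0 quartercircular_sigma_additive.

End quartercircular.

Definition weakly_converges {R : realType}
    (mu_ : nat -> {measure set R -> \bar R}) (mu : {measure set R -> \bar R}) :=
  forall f : R -> R, continuous f -> bounded_fun f ->
    ((\int[mu_ n]_x (f x)%:E)%E @[n --> \oo] --> (\int[mu]_x (f x)%:E)%E).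

Section iid.
Context {d : measure_display} {T : measurableType d} {R : realType}.
Context (P : probability T R) {I : choiceType} (X : I -> {RV P >-> R}).

Definition mutually_independent :=
  forall (J : {fset I}) (B : I -> set R), (forall i, measurable (B i)) ->
    P (\bigcap_(i in [set` J]) (X i @^-1` B i)) =
    (\prod_(i <- J) P (X i @^-1` B i))%E.

(* Only measurable sets are compared: [distribution P (X i)] is total on sets,
   with unspecified values outside the sigma-algebra. *)
Definition identically_distributed :=
  forall (i j : I) (B : set R), measurable B ->
    distribution P (X i) B = distribution P (X j) B.

Definition iid := mutually_independent /\ identically_distributed.

End iid.

Definition markov_mx {R : realType} {T : Type} (X : nat -> nat -> T -> R)
    (n : nat) (w : T) : 'M[R]_n :=
  \matrix_(i, j) let S := \sum_(k < n) X i k w in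
    if S == 0 then (i == j)%:R else X i j w / S.

(* Main.v *)
(** The proof compares Stieltjes transforms at negative points. For a real
    matrix A put S(t, A) = tr (A^T A + t)^-1 / n with t > 0; for t rational and
    A = sqrt(n) M it suffices to show S(t, A) -> m(t) almost surely, where m(t)
    is the integral of 1 / (x^2 + t) against the quartercircular law. Indeed
    differentiating 1 / (x^2 + t) in t gives its powers, hence the polynomials
    in 1 / (x^2 + 1), to which Weierstrass' theorem applies.

    m(t) is the unique nonnegative root of t m + phi (sigma^2 m) = 1 with
    phi x = x / (1 + x). The Sherman-Morrison formula gives, for any A with
    rows r_i, the identity t S = 1 - n^-1 sum_i phi (r_i G_i r_i^T), with
    G_i the resolvent without the row r_i. For A with centred bounded
    independent entries over sqrt n, the quadratic form r_i G_i r_i^T is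
    close to sigma^2 tr G_i / n in L^2, and since x |-> t x + phi (sigma^2
    x) expands distances by a factor t at least, S is close to m(t) in
    expectation. Truncation and centering of the entries and the
    normalisation of the rows are perturbations of small rank or small
    Frobenius norm.

    Changing a row moves S by at most 1 / (n t), so a fourth moment inequality
    for functions with bounded differences makes the probability of a deviation
    O(n^-2), and Borel-Cantelli applies. All expectations are finite sums: the
    entries are first rounded down to a finite grid that depends on n, which
    changes S little outside an event of probability O(n^-2). *)

Require Import Defs.
From HB Require Import structures.
From mathcomp Require Import all_boot all_order all_algebra.
From mathcomp Require Import finmap complex.
From mathcomp Require Import all_classical all_reals all_analysis measurable_realfun.
From mathcomp Require Import ring lra zify.

Set Implicit Arguments.
Unset Strict Implicit.
Unset Printing Implicit Defensive.

Import Order.TTheory GRing.Theory Num.Theory.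
Import numFieldNormedType.Exports.

Local Open Scope classical_set_scope.
Local Open Scope ring_scope.

(** * Expectation and concentration on finite product spaces *)

(** Only a second moment is assumed, so entries are cut at a level [L] taken from the tail of their
    law, and the resulting powers of [L] are paid for by [n]. The grid in turn depends on [n]. Hence
    the estimates are uniform over the finite laws subject to [approx_law], and the constants are
    chosen in the order [eta], [L], [n], grid.

    A variance bound would give only [n (1 / (n t))^2 = O(1 / n)], which is not summable; the fourth
    moment gives [n^2 (1 / (n t))^4]. The coordinates of the product space must be the rows: they
    stay independent under normalisation, whereas the entries within a normalised row do not.

    Negative points keep all matrices real and all resolvents positive, and make the fixed-point
    equation monotone. With finite sums, conditioning on the other rows is a partial sum, and the
    exceptional event is a preimage under a finite-valued map, hence measurable. *)

Section finite_expectation.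
Context {R : realFieldType}.

Definition Ew (V : finType) (p : V -> R) (F : V -> R) : R := \sum_v p v * F v.

Definition isdist (V : finType) (p : V -> R) :=
  (forall v, 0 <= p v) /\ \sum_v p v = 1.

Section generic.
Context (V : finType) (p : V -> R).
Implicit Types F G : V -> R.

Lemma eq_Ew F G : F =1 G -> Ew p F = Ew p G.
Proof. by move=> FG; apply: eq_bigr => v _; rewrite FG. Qed.

Lemma EwD F G : Ew p (fun v => F v + G v) = Ew p F + Ew p G.
Proof. by rewrite -big_split; apply: eq_bigr => v _; rewrite mulrDr. Qed.

Lemma EwZ c F : Ew p (fun v => c * F v) = c * Ew p F.
Proof. by rewrite mulr_sumr; apply: eq_bigr => v _; rewrite mulrCA. Qed.

Lemma EwZr c F : Ew p (fun v => F v * c) = Ew p F * c.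
Proof. by rewrite mulr_suml; apply: eq_bigr => v _; rewrite mulrA. Qed.

Lemma EwN F : Ew p (fun v => - F v) = - Ew p F.
Proof. by rewrite -mulN1r -EwZ; apply: eq_Ew => v; rewrite mulN1r. Qed.

Lemma EwB F G : Ew p (fun v => F v - G v) = Ew p F - Ew p G.
Proof. by rewrite EwD EwN. Qed.

Lemma Ew_sum (I : Type) (r : seq I) (P : pred I) (F : I -> V -> R) :
  Ew p (fun v => \sum_(i <- r | P i) F i v) = \sum_(i <- r | P i) Ew p (F i).
Proof. by rewrite /Ew exchange_big; apply: eq_bigr => v _; rewrite mulr_sumr. Qed.

Context (pd : isdist p).
Let p_ge0 v : 0 <= p v := pd.1 v.

Lemma Ew_cst c : Ew p (fun=> c) = c.
Proof. by rewrite /Ew -mulr_suml pd.2 mul1r. Qed.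

Lemma ler_Ew F G : (forall v, F v <= G v) -> Ew p F <= Ew p G.
Proof. by move=> FG; apply: ler_sum => v _; rewrite ler_wpM2l. Qed.

Lemma Ew_ge0 F : (forall v, 0 <= F v) -> 0 <= Ew p F.
Proof. by move=> F0; apply: sumr_ge0 => v _; rewrite mulr_ge0. Qed.

Lemma Ew_le F c : (forall v, F v <= c) -> Ew p F <= c.
Proof. by move=> Fc; rewrite -[leRHS]Ew_cst; exact: ler_Ew. Qed.

Lemma Ew_norm F : `|Ew p F| <= Ew p (fun v => `|F v|).
Proof.
rewrite ler_norml lerNl -EwN; apply/andP; split; apply: ler_Ew => v;
  by rewrite ?ler_norm // -normrN ler_norm.
Qed.

Lemma Ew_var F c :
  Ew p (fun v => (F v - c) ^+ 2) =
  Ew p (fun v => F v ^+ 2) - c *+ 2 * Ew p F + c ^+ 2.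
Proof.
rewrite -[c ^+ 2 in RHS]Ew_cst -EwZ -EwB -EwD.
by apply: eq_Ew => v; rewrite sqrrB -mulrnAr mulrC.
Qed.

Lemma Ew_sqr F : Ew p F ^+ 2 <= Ew p (fun v => F v ^+ 2).
Proof.
have : 0 <= Ew p (fun v => (F v - Ew p F) ^+ 2).
  by apply: Ew_ge0 => v; exact: sqr_ge0.
by rewrite Ew_var; nra.
Qed.

End generic.

Section product.
Context (I V : finType).
Implicit Types (p : V -> R) (F : {ffun I -> V} -> R) (w : {ffun I -> V}).

Definition fprod p w := \prod_i p (w i).

Definition upd w i x : {ffun I -> V} := [ffun j => if j == i then x else w j].

Lemma updE w i x j : upd w i x j = if j == i then x else w j.
Proof. by rewrite ffunE. Qed.

Lemma upd_eq w i x : upd w i x i = x.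
Proof. by rewrite updE eqxx. Qed.

Lemma upd_upd w i x y : upd (upd w i x) i y = upd w i y.
Proof. by apply/ffunP => j; rewrite !updE; case: eqP. Qed.

Lemma upd_id w i : upd w i (w i) = w.
Proof. by apply/ffunP => j; rewrite updE; case: eqP => // ->. Qed.

Lemma updC w i j x y : i != j -> upd (upd w i x) j y = upd (upd w j y) i x.
Proof.
move=> ij; apply/ffunP => k; rewrite !updE.
by case: (eqVneq k j) => // ->; rewrite eq_sym (negbTE ij).
Qed.

Lemma isdist_fprod p : isdist p -> isdist (fprod p).
Proof.
move=> [p0 p1]; split; first by move=> w; exact: prodr_ge0.
rewrite -(bigA_distr_bigA (fun (_ : I) v => p v)) /=.
by rewrite big1 // => i _; rewrite p1.
Qed.

(** The conditional expectation of [F] given the coordinates other than [i], kept as a function of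
    all of [w]. *)
Definition avg p i F w := Ew p (fun x => F (upd w i x)).

(** Exchanging the coordinate [w i] with an independent copy [x] is an involution that preserves the
    weight [fprod p w * p x]. *)
Lemma Ew_avg p i F : isdist p -> Ew (fprod p) (avg p i F) = Ew (fprod p) F.
Proof.
move=> pd; rewrite /Ew /avg /Ew.
under eq_bigr do rewrite mulr_sumr.
rewrite pair_big /=.
transitivity (\sum_(z : {ffun I -> V} * V) fprod p z.1 * p z.2 * F z.1).
  pose h (z : {ffun I -> V} * V) := (upd z.1 i z.2, z.1 i).
  have hK : involutive h.
    by case=> w x; rewrite /h /= upd_upd upd_eq upd_id.
  rewrite [RHS](reindex_inj (inv_inj hK)) /=.
  apply: eq_bigr => -[w x] _ /=; rewrite mulrA; congr (_ * _).
  rewrite /fprod (bigD1 i) //= [in RHS](bigD1 i) //= upd_eq.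
  under [in RHS]eq_bigr => j ji do rewrite updE (negbTE ji).
  by ring.
rewrite -(pair_big predT predT (fun w x => fprod p w * p x * F w)) /=.
apply: eq_bigr => w _; rewrite -mulr_suml -mulr_sumr.
by rewrite pd.2 mulr1.
Qed.

Lemma Ew_coord p i (f : V -> R) : isdist p ->
  Ew (fprod p) (fun w => f (w i)) = Ew p f.
Proof.
move=> pd; rewrite -(Ew_avg i _ pd) /avg.
under eq_Ew do under eq_Ew do rewrite upd_eq.
by rewrite Ew_cst //; exact: isdist_fprod.
Qed.

Lemma Ew_coord2 p i j (f g : V -> R) : isdist p -> i != j ->
  Ew (fprod p) (fun w => f (w i) * g (w j)) = Ew p f * Ew p g.
Proof.
move=> pd ij; rewrite -(Ew_avg i _ pd) /avg.
under eq_Ew do under eq_Ew do rewrite upd_eq updE eq_sym (negbTE ij).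
under eq_Ew do rewrite EwZr.
by rewrite EwZ Ew_coord.
Qed.

Lemma Ew_lin_sqr p (z : V -> R) (b : I -> R) : isdist p -> Ew p z = 0 ->
  Ew (fprod p) (fun w => (\sum_i b i * z (w i)) ^+ 2) =
  (\sum_i b i ^+ 2) * Ew p (fun x => z x ^+ 2).
Proof.
move=> pd z0.
under eq_Ew do rewrite expr2 mulr_suml.
rewrite Ew_sum mulr_suml; apply: eq_bigr => i _.
under eq_Ew do rewrite mulr_sumr.
rewrite Ew_sum (bigD1 i) //= [X in _ + X]big1 ?addr0.
  under eq_Ew do rewrite mulrACA -!expr2.
  by rewrite EwZ (Ew_coord _ (fun x => z x ^+ 2)).
move=> j ji.
under eq_Ew do rewrite mulrACA.
by rewrite EwZ Ew_coord2 ?z0 ?mul0r ?mulr0 // eq_sym.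
Qed.

Lemma avg_comm p i j F w : isdist p -> avg p i (avg p j F) w = avg p j (avg p i F) w.
Proof.
move=> pd; have [->//|ij] := eqVneq i j.
rewrite /avg /Ew.
under eq_bigr do rewrite mulr_sumr.
rewrite exchange_big /=; apply: eq_bigr => y _; rewrite mulr_sumr.
by apply: eq_bigr => x _; rewrite updC // mulrCA.
Qed.

(** As [s] grows from [[::]] to [enum I], these functions interpolate between [F] and its mean
    ([avgs_enum]); the moment bounds below are inductions along this path. *)
Definition avgs p (s : seq I) F := foldr (avg p) F s.

Lemma avg_absorb p i G w x : isdist p -> avg p i G (upd w i x) = avg p i G w.
Proof. by move=> pd; apply: eq_Ew => y; rewrite upd_upd. Qed.

Lemma avg_cst p i F w x j : isdist p -> (forall w x, F (upd w j x) = F w) ->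
  avg p i F (upd w j x) = avg p i F w.
Proof.
move=> pd Fj; have [->|ij] := eqVneq j i; first by rewrite avg_absorb.
by apply: eq_Ew => y; rewrite updC // Fj.
Qed.

Lemma avgs_cst p s F w x j : isdist p -> j \in s ->
  avgs p s F (upd w j x) = avgs p s F w.
Proof.
move=> pd; elim: s w x => //= i s IH w x; rewrite inE => /orP[/eqP ->|js].
  by rewrite avg_absorb.
by apply: avg_cst => // {}w {}x; exact: IH.
Qed.

Lemma Ew_avgs p s F : isdist p -> Ew (fprod p) (avgs p s F) = Ew (fprod p) F.
Proof. by move=> pd; elim: s => //= i s IH; rewrite Ew_avg. Qed.

Lemma upd_cst F : (forall w i x, F (upd w i x) = F w) -> forall w w', F w = F w'.
Proof.
move=> Fc w w'.
pose m (s : seq I) : {ffun I -> V} := [ffun j => if j \in s then w' j else w j].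
have Fm s : F (m s) = F w.
  elim: s => [|i s IH].
    by congr F; apply/ffunP => j; rewrite ffunE.
  rewrite -IH -(Fc (m s) i (w' i)); congr F; apply/ffunP => j.
  by rewrite updE !ffunE inE; case: eqP => // ->.
rewrite -(Fm (enum I)); congr F; apply/ffunP => j.
by rewrite ffunE mem_enum.
Qed.

Lemma avgs_enum p F w : isdist p -> avgs p (enum I) F w = Ew (fprod p) F.
Proof.
move=> pd; rewrite -(Ew_avgs (enum I) F pd).
rewrite -[LHS](Ew_cst (isdist_fprod pd)); apply: eq_Ew => w'.
by apply: upd_cst => ? ? ?; rewrite avgs_cst // mem_enum.
Qed.

(** For [G = avgs p s F], Pythagoras splits the variance of [G] into that of [avg p i G] and the
    second moment of [G - avg p i G]. The latter function is [avgs p s (F - avg p i F)], and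
    averaging lowers second moments by Jensen. *)
Lemma Efron_Stein p F : isdist p ->
  Ew (fprod p) (fun w => (F w - Ew (fprod p) F) ^+ 2) <=
  \sum_i Ew (fprod p) (fun w => (F w - avg p i F w) ^+ 2).
Proof.
move=> pd; have fpd := isdist_fprod pd.
set mu := Ew _ F.
have step s : Ew (fprod p) (fun w => (F w - mu) ^+ 2) <=
   Ew (fprod p) (fun w => (avgs p s F w - mu) ^+ 2) +
   \sum_(i <- s) Ew (fprod p) (fun w => (F w - avg p i F w) ^+ 2).
  elim: s => [|i s IH] /=; first by rewrite big_nil addr0.
  rewrite big_cons addrA; apply: (le_trans IH); rewrite lerD2r.
  set G := avgs p s F.
  have GE w : avgs p s (avg p i F) w = avg p i G w.
    rewrite /G; elim: s {IH G} w => //= j s IH w.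
    by rewrite avg_comm //; apply: eq_Ew => x; rewrite IH.
  have -> : Ew (fprod p) (fun w => (G w - mu) ^+ 2) =
    Ew (fprod p) (fun w => (avg p i G w - mu) ^+ 2) +
    Ew (fprod p) (fun w => (G w - avg p i G w) ^+ 2).
    rewrite -EwD -[LHS](Ew_avg i _ pd) -[RHS](Ew_avg i _ pd); apply: eq_Ew => w.
    rewrite /avg -/(avg p i G w).
    under [RHS]eq_Ew do rewrite -/(avg p i G _) (avg_absorb _ _ _ _ pd).
    by rewrite EwD Ew_cst // !Ew_var // -/(avg p i G w); ring.
  rewrite lerD2l.
  pose H w := F w - avg p i F w.
  have HE s' w : avgs p s' H w = avgs p s' F w - avgs p s' (avg p i F) w.
    elim: s' w => //= j s' IH' w.
    by rewrite /avg -EwB; apply: eq_Ew => x; rewrite IH'.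
  under eq_Ew do rewrite -GE -HE.
  change (Ew (fprod p) (fun w => avgs p s H w ^+ 2) <=
          Ew (fprod p) (fun w => H w ^+ 2)).
  elim: s {IH G GE HE} => //= j s IH.
  apply: le_trans IH; rewrite -[leRHS](Ew_avg j _ pd).
  by apply: ler_Ew => // w; exact: Ew_sqr.
have := step (enum I).
under [X in _ <= X + _]eq_Ew do rewrite avgs_enum // subrr expr0n.
by rewrite Ew_cst // add0r big_enum.
Qed.

Lemma avg_diff p F c : isdist p ->
  (forall w i x, `|F (upd w i x) - F w| <= c) ->
  forall w i, `|F w - avg p i F w| <= c.
Proof.
move=> pd Fc w i.
rewrite -[X in `|X - _|](Ew_cst pd) -EwB (le_trans (Ew_norm pd _))//.
by apply: Ew_le => // x; rewrite distrC.
Qed.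

(* Write F = g + D with g = avg p i F; averaging over the i-th coordinate kills
   D, and |D| <= c, so the fourth moment grows by 6 g^2 c^2 + ... per step. *)
Lemma bounded_diff_moment4 p F c : isdist p ->
  (forall w i x, `|F (upd w i x) - F w| <= c) ->
  Ew (fprod p) (fun w => (F w - Ew (fprod p) F) ^+ 4) <=
  11%:R * #|I|%:R ^+ 2 * c ^+ 4.
Proof.
move=> pd Fc; have fpd := isdist_fprod pd.
set mu := Ew _ F.
have avgsc s w i x : `|avgs p s F (upd w i x) - avgs p s F w| <= c.
  elim: s w i x => //= j s IH w i x.
  have [->|ij] := eqVneq i j.
    rewrite avg_absorb // subrr normr0.
    exact: le_trans (normr_ge0 _) (Fc w j x).
  rewrite /avg -EwB (le_trans (Ew_norm pd _))//.
  by apply: Ew_le => // y; rewrite updC.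
pose g s := avgs p s F.
have bnd s w i : `|g s w - avg p i (g s) w| <= c.
  by apply: avg_diff => // *; exact: avgsc.
have c2 s w i : (g s w - avg p i (g s) w) ^+ 2 <= c ^+ 2.
  rewrite -[leLHS]real_normK ?num_real // ler_pXn2r// ?nnegrE//.
  exact: le_trans (normr_ge0 _) (bnd s w i).
have step2 i s : Ew (fprod p) (fun w => (g s w - mu) ^+ 2) <=
    Ew (fprod p) (fun w => (g (i :: s) w - mu) ^+ 2) + c ^+ 2.
  rewrite -[leLHS](Ew_avg i _ pd) -[c ^+ 2](Ew_cst fpd) -EwD.
  apply: ler_Ew => // w; rewrite -/(g s) /= -/(avg p i (g s) w).
  set a := avg p i (g s) w.
  have aE : Ew p (fun x => g s (upd w i x)) = a by [].
  have -> : avg p i (fun w => (g s w - mu) ^+ 2) w =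
     (a - mu) ^+ 2 + Ew p (fun x => (g s (upd w i x) - a) ^+ 2).
    by rewrite /avg !Ew_var // aE; ring.
  rewrite lerD2l; apply: Ew_le => // x.
  by have := c2 s (upd w i x) i; rewrite avg_absorb.
have step4 i s : Ew (fprod p) (fun w => (g s w - mu) ^+ 4) <=
    Ew (fprod p) (fun w => (g (i :: s) w - mu) ^+ 4) +
    8%:R * c ^+ 2 * Ew (fprod p) (fun w => (g (i :: s) w - mu) ^+ 2) + 3%:R * c ^+ 4.
  rewrite -[leLHS](Ew_avg i _ pd) -[X in _ + X](Ew_cst fpd) -EwZ -!EwD.
  apply: ler_Ew => // w.
  set a := avg p i (g s) w.
  have -> : (g (i :: s) w) = a by [].
  have aE : Ew p (fun x => g s (upd w i x) - a) = 0.
    by rewrite EwB Ew_cst // subrr.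
  apply: (@le_trans _ _ (Ew p (fun x => (a - mu) ^+ 4 + 4%:R * (a - mu) ^+ 3 *
     (g s (upd w i x) - a) + (8%:R * c ^+ 2 * (a - mu) ^+ 2 + 3%:R * c ^+ 4)))).
    apply: ler_Ew => // x.
    have := c2 s (upd w i x) i; rewrite avg_absorb // -/a.
    set u := a - mu; set D := g s (upd w i x) - a => Dc.
    have -> : g s (upd w i x) - mu = u + D by rewrite /u /D; ring.
    (* The term linear in [D] averages to zero. The cubic one is absorbed by
       [4 u D^3 <= 2 u^2 D^2 + 2 D^4], which turns the coefficients 6 and 1 into 8 and 3. *)
    have E1 : (u + D) ^+ 4 <= u ^+ 4 + 4%:R * u ^+ 3 * D
       + (8%:R * D ^+ 2 * u ^+ 2 + 3%:R * D ^+ 4).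
      rewrite -subr_ge0.
      suff -> : u ^+ 4 + 4%:R * u ^+ 3 * D
       + (8%:R * D ^+ 2 * u ^+ 2 + 3%:R * D ^+ 4) - (u + D) ^+ 4
         = 2%:R * (D * (u - D)) ^+ 2 by rewrite mulr_ge0 // sqr_ge0.
      by ring.
    apply: (le_trans E1); rewrite lerD2l.
    have D4 : D ^+ 4 <= c ^+ 4.
      by rewrite -[4%N]/(2 * 2)%N !exprM ler_pXn2r // nnegrE sqr_ge0.
    apply: lerD; last by rewrite ler_pM2l.
    by rewrite ler_wpM2r ?sqr_ge0 // ler_pM2l.
  by rewrite !EwD EwZ aE mulr0 addr0 !Ew_cst // addrA.
have gE w : g (enum I) w = mu by rewrite /g avgs_enum.
have key s : Ew (fprod p) (fun w => (g s w - mu) ^+ 2) <= #|I|%:R * c ^+ 2.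
  rewrite cardE.
  suff H : forall s', Ew (fprod p) (fun w => (g s w - mu) ^+ 2) <=
    Ew (fprod p) (fun w => (avgs p s' (g s) w - mu) ^+ 2) + (size s')%:R * c ^+ 2.
    have := H (enum I).
    under [X in _ <= X + _]eq_Ew do rewrite avgs_enum // Ew_avgs // subrr expr0n.
    by rewrite Ew_cst // add0r.
  elim=> [|i s' IH]; first by rewrite /= mul0r addr0.
  apply: (le_trans IH); rewrite [(size (i :: s'))]/= -natr1 mulrDl mul1r.
  rewrite [_ + c ^+ 2]addrC addrA lerD2r.
  have := step2 i (s' ++ s).
  by rewrite /g /= /avgs foldr_cat.
have fin s : Ew (fprod p) (fun w => (F w - mu) ^+ 4) <=
   Ew (fprod p) (fun w => (g s w - mu) ^+ 4) +
   (size s)%:R * (8%:R * #|I|%:R + 3%:R) * c ^+ 4.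
  elim: s => [|i s IH]; first by rewrite /= !mul0r addr0.
  apply: (le_trans IH); rewrite [(size (i :: s))]/= -natr1.
  move: (key (i :: s)) (step4 i s).
  set E2 := Ew _ (fun w => (g (i :: s) w - mu) ^+ 2).
  set E4 := Ew _ (fun w => (g (i :: s) w - mu) ^+ 4).
  set N := #|I|%:R; set k := (size s)%:R => h2 h4.
  have h3 : 8%:R * c ^+ 2 * E2 <= 8%:R * c ^+ 2 * (N * c ^+ 2).
    by rewrite ler_wpM2l // mulr_ge0 // sqr_ge0.
  rewrite -/(g s) -/(g (i :: s)) -/E4.
  have e : c ^+ 4 = c ^+ 2 * c ^+ 2 by ring.
  by move: h4; rewrite e; lra.
have := fin (enum I).
under [X in _ <= X + _]eq_Ew do rewrite -/(g _) gE subrr expr0n.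
rewrite Ew_cst // add0r -cardE => /le_trans; apply.
rewrite ler_wpM2r//; first by rewrite -[4%N]/(2 * 2)%N exprM sqr_ge0.
(* The steps add up to [N (8 N + 3) c^4] with [N] the number of coordinates, at most [11 N^2 c^4]
   since [N] is [0] or at least [1]. *)
case: #|I| => [|n]; first by rewrite !mul0r expr0n mulr0.
have n1 : 1 <= n.+1%:R :> R by rewrite ler1n.
by nra.
Qed.

End product.
End finite_expectation.

(** * Resolvents of positive semidefinite matrices *)

Section resolvent.
Context {R : rcfType}.

Definition dotv n (x y : 'rV[R]_n) : R := (x *m y^T) 0 0.

Lemma dotvE n (x y : 'rV[R]_n) : dotv x y = \sum_i x 0 i * y 0 i.
Proof. by rewrite /dotv mxE; apply: eq_bigr => i _; rewrite mxE. Qed.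

Lemma mulmxv_tr n (x y : 'rV[R]_n) : x *m y^T = (dotv x y)%:M.
Proof. exact: mx11_scalar. Qed.

Lemma dotvC n (x y : 'rV[R]_n) : dotv x y = dotv y x.
Proof. by rewrite !dotvE; apply: eq_bigr => i _; rewrite mulrC. Qed.

Lemma dotvDl n (x y z : 'rV[R]_n) : dotv (x + y) z = dotv x z + dotv y z.
Proof. by rewrite /dotv mulmxDl mxE. Qed.

Lemma dotvZl n a (x y : 'rV[R]_n) : dotv (a *: x) y = a * dotv x y.
Proof. by rewrite /dotv -scalemxAl mxE. Qed.

Lemma dotvDr n (x y z : 'rV[R]_n) : dotv x (y + z) = dotv x y + dotv x z.
Proof. by rewrite dotvC dotvDl !(dotvC _ x). Qed.

Lemma dotvZr n a (x y : 'rV[R]_n) : dotv x (a *: y) = a * dotv x y.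
Proof. by rewrite dotvC dotvZl dotvC. Qed.

Lemma dotv_ge0 n (x : 'rV[R]_n) : 0 <= dotv x x.
Proof. by rewrite dotvE sumr_ge0 // => i _; rewrite -expr2 sqr_ge0. Qed.

Lemma dotv_eq0 n (x : 'rV[R]_n) : dotv x x = 0 -> x = 0.
Proof.
rewrite dotvE => /eqP; rewrite psumr_eq0; last first.
  by move=> i _; rewrite -expr2 sqr_ge0.
move=> /allP x0; apply/rowP => i; have := x0 i (mem_index_enum _).
by rewrite mxE -expr2 sqrf_eq0 => /eqP.
Qed.

Lemma dotv_mulmx n m (x : 'rV[R]_n) (M : 'M[R]_(n, m)) y :
  dotv (x *m M) y = dotv x (y *m M^T).
Proof. by rewrite /dotv trmx_mul trmxK mulmxA. Qed.

Lemma dotv_sqrB n (x y : 'rV[R]_n) a :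
  0 <= dotv x x - a *+ 2 * dotv x y + a ^+ 2 * dotv y y.
Proof.
have := dotv_ge0 (x + (- a) *: y).
by rewrite dotvDl !dotvDr !dotvZl !dotvZr (dotvC y x) => h; apply: le_trans h _; lra.
Qed.

Definition psd n (K : 'M[R]_n) := K^T = K /\ forall x, 0 <= dotv (x *m K) x.

Lemma psd_gram m n (A : 'M[R]_(m, n)) : psd (A^T *m A).
Proof.
split; first by rewrite trmx_mul trmxK.
by move=> x; rewrite mulmxA dotv_mulmx dotv_ge0.
Qed.

Lemma psd_rank1 n (v : 'rV[R]_n) : psd (v^T *m v).
Proof. exact: psd_gram. Qed.

Lemma psdD n (K L : 'M[R]_n) : psd K -> psd L -> psd (K + L).
Proof.
move=> [KT K0] [LT L0]; split; first by rewrite linearD /= KT LT.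
by move=> x; rewrite mulmxDr dotvDl addr_ge0.
Qed.

(** The resolvent [(K - z)^-1] at the point [z = -t]. *)
Definition resolv t n (K : 'M[R]_n) := invmx (K + t%:M).

Section one.
Context (t : R) (t_gt0 : 0 < t) (n : nat) (K : 'M[R]_n) (Kpsd : psd K).
Local Notation G := (resolv t K).

Lemma shift_unit : K + t%:M \in unitmx.
Proof.
rewrite -row_free_unit -kermx_eq0; apply/rowV0P => v /sub_kermxP vK.
apply: dotv_eq0; apply/eqP; rewrite eq_le dotv_ge0 andbT.
have := Kpsd.2 v; have : dotv (v *m (K + t%:M)) v = 0 by rewrite vK /dotv mul0mx mxE.
rewrite mulmxDr dotvDl mul_mx_scalar dotvZl => e k.
by rewrite -(pmulr_rle0 _ t_gt0); lra.
Qed.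

Lemma resolvV : G *m (K + t%:M) = 1%:M.
Proof. by rewrite mulVmx // shift_unit. Qed.

Lemma resolvK : (K + t%:M) *m G = 1%:M.
Proof. by rewrite mulmxV // shift_unit. Qed.

Lemma resolv_sym : G^T = G.
Proof. by rewrite /resolv trmx_inv linearD /= Kpsd.1 tr_scalar_mx. Qed.

(** With [z = x G] one has [x = z (K + t)], hence [x G x^T = z K z^T + t |z|^2]. *)
Lemma resolv_sqr x : t * dotv (x *m G) (x *m G) <= dotv (x *m G) x.
Proof.
rewrite -[X in _ <= dotv _ X]mulmx1 -resolvV mulmxA mulmxDr dotvDr mul_mx_scalar.
by rewrite dotvZr lerDr dotvC; exact: Kpsd.2.
Qed.

Lemma resolv_ge0 x : 0 <= dotv (x *m G) x.
Proof.
by apply: le_trans (resolv_sqr x); rewrite mulr_ge0 ?dotv_ge0 // ltW.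
Qed.

Lemma resolv_le x : dotv (x *m G) x <= t^-1 * dotv x x.
Proof.
rewrite -(ler_pM2l t_gt0) mulrA divff ?gt_eqF // mul1r.
have := dotv_sqrB x (x *m G) t; have := resolv_sqr x.
rewrite (dotvC x) => h1 h2.
have := ler_wpM2l (ltW t_gt0) h1; lra.
Qed.

Lemma resolv_norm x : dotv (x *m G) (x *m G) <= t^-2 * dotv x x.
Proof.
rewrite -(ler_pM2l t_gt0) (le_trans (resolv_sqr x)) // (le_trans (resolv_le x)) //.
by rewrite mulrA expr2 invfM mulrA divff ?gt_eqF // mul1r.
Qed.

End one.

Section trace.
Context (t : R) (t_gt0 : 0 < t).

(* Sherman-Morrison. *)
Lemma resolv_rank1 n (K : 'M[R]_n) (v : 'rV[R]_n) : psd K ->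
  resolv t (K + v^T *m v) = resolv t K -
    (1 + dotv (v *m resolv t K) v)^-1 *: ((v *m resolv t K)^T *m (v *m resolv t K)).
Proof.
move=> Kpsd; set G := resolv t K; set b := dotv (v *m G) v.
have b0 : 0 <= b by exact: resolv_ge0.
set N := K + v^T *m v + t%:M.
have Nu : N \in unitmx by apply: shift_unit => //; apply: psdD => //; exact: psd_rank1.
suff : (G - (1 + b)^-1 *: ((v *m G)^T *m (v *m G))) *m N = 1%:M.
  by move=> e; rewrite -[RHS]mulmx1 -(mulmxV Nu) [RHS]mulmxA e mul1mx.
have -> : N = (K + t%:M) + v^T *m v by rewrite /N addrAC.
rewrite mulmxDr mulmxBl resolvV //.
rewrite -scalemxAl -mulmxA -(mulmxA v) resolvV // mulmx1.
rewrite trmx_mul resolv_sym //.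
have vGv : v *m G *m v^T = b%:M by rewrite mulmxv_tr.
rewrite mulmxBl -scalemxAl.
have -> : G *m v^T *m (v *m G) *m (v^T *m v) = b *: (G *m v^T *m v).
  by rewrite !mulmxA -2!(mulmxA (G *m v^T)) vGv mul_mx_scalar -scalemxAl.
rewrite -/G mulmxA -addrA [- _ + _]addrC -addrA -opprD scalerA -scalerDl.
have -> : (1 + b)^-1 * b + (1 + b)^-1 = 1.
  by field; rewrite gt_eqF // ltr_wpDr.
by rewrite scale1r subrr addr0.
Qed.

Lemma trace_dotv n (v : 'rV[R]_n) : \tr (v^T *m v) = dotv v v.
Proof. by rewrite mxtrace_mulC /mxtrace big_ord1 /dotv. Qed.

(** By Sherman-Morrison the drop of the trace is [|v G|^2 / (1 + v G v^T)], and
    [t |v G|^2 <= v G v^T]. *)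
Lemma tr_resolv_rank1 n (K : 'M[R]_n) (v : 'rV[R]_n) : psd K ->
  0 <= \tr (resolv t K) - \tr (resolv t (K + v^T *m v)) <= t^-1.
Proof.
move=> Kpsd; rewrite resolv_rank1 // linearB /= linearZ /= trace_dotv.
rewrite opprB addrC subrK.
have b0 := resolv_ge0 t_gt0 Kpsd v; set b := dotv (v *m resolv t K) v in b0 *.
have b1 : 0 < 1 + b by rewrite ltr_wpDr.
rewrite mulr_ge0 ?dotv_ge0 ?invr_ge0 ?(ltW b1) //=.
have := resolv_sqr t_gt0 Kpsd v; rewrite -/b => h.
rewrite [leLHS]mulrC ler_pdivrMr // -(ler_pM2l t_gt0) mulrA divff ?gt_eqF // mul1r.
by apply: (le_trans h); rewrite lerDr.
Qed.

(* The row identity behind the self-consistent equation. *)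
Lemma dotv_resolv_rank1 n (K : 'M[R]_n) (v : 'rV[R]_n) : psd K ->
  dotv (v *m resolv t (K + v^T *m v)) v =
  dotv (v *m resolv t K) v / (1 + dotv (v *m resolv t K) v).
Proof.
move=> Kpsd; rewrite resolv_rank1 //.
set G := resolv t K; set b := dotv (v *m G) v.
have b1 : 1 + b != 0 by rewrite gt_eqF // ltr_wpDr // resolv_ge0.
have vGv : v *m (v *m G)^T = b%:M by rewrite mulmxv_tr dotvC.
rewrite mulmxBr -scalemxAr (mulmxA v (v *m G)^T) vGv mul_scalar_mx scalerA.
rewrite -[X in X - _]scale1r -scalerBl dotvZl -/b.
by field.
Qed.

Definition strace m n (A : 'M[R]_(m, n)) := \tr (resolv t (A^T *m A)).

Lemma tr_mul_resolv n (K : 'M[R]_n) : psd K ->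
  \tr (K *m resolv t K) = n%:R - t * \tr (resolv t K).
Proof.
move=> Kp; have := congr1 mxtrace (resolvK t_gt0 Kp).
by rewrite mulmxDl mxtraceD mul_scalar_mx mxtraceZ mxtrace1 => h; lra.
Qed.

(** The push-through identity [A^T (A A^T + t)^-1 = (A^T A + t)^-1 A^T] equates the traces of
    [H G_H] for the two Gram matrices, each of which is [n - t tr G_H] because [A] is square. *)
Lemma strace_tr n (A : 'M[R]_n) : strace A^T = strace A.
Proof.
rewrite /strace trmxK; set H := A *m A^T; set H' := A^T *m A.
have Hp : psd H by rewrite /H -{1}(trmxK A); exact: psd_gram.
have Hp' : psd H' by exact: psd_gram.
apply: (mulfI (lt0r_neq0 t_gt0)).
suff : \tr (H *m resolv t H) = \tr (H' *m resolv t H').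
  by rewrite !tr_mul_resolv // => /addrI/oppr_inj.
have push : A^T *m resolv t H = resolv t H' *m A^T.
  rewrite -[RHS]mulmx1 -(resolvK t_gt0 Hp) mulmxA -(mulmxA (resolv t H')).
  rewrite mulmxDr mulmxA -/H' mul_mx_scalar -mul_scalar_mx -mulmxDl.
  by rewrite [in RHS]mulmxA resolvV // mul1mx.
by rewrite /H -mulmxA push mulmxA mxtrace_mulC mulmxA.
Qed.

(** A rank-one change of [A] changes the Gram matrix by an indefinite matrix of rank two. For a unit
    [v], however, [A A^T] and its perturbation are both positive rank-one updates of the same
    [K = A (1 - v^T v) A^T], which is positive semidefinite. Both traces lie in one interval of
    length [1 / t] below the trace for [K]. *)
Lemma strace_rank1_unit n (A : 'M[R]_n) (u v : 'rV[R]_n) : dotv v v = 1 ->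
  `|strace (A + u^T *m v) - strace A| <= t^-1.
Proof.
move=> v1; rewrite -(strace_tr A) -[X in `|X - _|]strace_tr /strace !trmxK.
set a := v *m A^T; pose K := A *m A^T - a^T *m a.
have Kpsd : psd K.
  split; first by rewrite /K linearB /= !trmx_mul !trmxK.
  move=> x; rewrite mulmxBr /dotv mulmxBl mxE [X in _ + X]mxE.
  rewrite -!/(dotv _ _) mulmxA dotv_mulmx /a trmx_mul trmxK.
  have := dotv_sqrB (x *m A) v (dotv (x *m A) v); rewrite v1.
  set d := dotv (x *m A) v.
  have -> : x *m (A *m v^T *m (v *m A^T)) = d *: (v *m A^T).
    by rewrite !mulmxA mulmxv_tr -/d mul_scalar_mx -scalemxAl.
  rewrite dotvZl [dotv (v *m _) _]dotv_mulmx trmxK (dotvC v) -/d.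
  by rewrite mulr2n mulr1; nra.
have -> : A *m A^T = K + a^T *m a by rewrite subrK.
have -> : (A + u^T *m v) *m (A + u^T *m v)^T = K + (a + u)^T *m (a + u).
  have -> : (A + u^T *m v)^T = A^T + v^T *m u by rewrite linearD /= trmx_mul trmxK.
  have -> : (a + u)^T = a^T + u^T by rewrite linearD.
  rewrite !mulmxDl !mulmxDr.
  have -> : u^T *m v *m (v^T *m u) = u^T *m u.
    by rewrite mulmxA -(mulmxA _ v) mulmxv_tr v1 mulmx1.
  have -> : A *m (v^T *m u) = a^T *m u by rewrite /a trmx_mul trmxK mulmxA.
  have -> : u^T *m v *m A^T = u^T *m a by rewrite mulmxA.
  by rewrite /K [RHS]addrA [X in _ = X + _]addrA subrK.
have := tr_resolv_rank1 a Kpsd; have := tr_resolv_rank1 (a + u) Kpsd.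
by rewrite ler_norml => /andP[? ?] /andP[? ?]; apply/andP; split; lra.
Qed.

Lemma strace_rank1 n (A : 'M[R]_n) (u v : 'rV[R]_n) :
  `|strace (A + u^T *m v) - strace A| <= t^-1.
Proof.
have [v0|v0] := eqVneq (dotv v v) 0.
  by rewrite (dotv_eq0 v0) mulmx0 addr0 subrr normr0 invr_ge0 ltW.
set s := Num.sqrt (dotv v v).
have s2 : s ^+ 2 = dotv v v by rewrite sqr_sqrtr // dotv_ge0.
have s0 : s != 0 by rewrite -sqrf_eq0 s2.
have -> : u^T *m v = (s *: u)^T *m (s^-1 *: v).
  have -> : (s *: u)^T = s *: u^T by exact: linearZ.
  by rewrite -scalemxAl -scalemxAr scalerA divff // scale1r.
apply: strace_rank1_unit; rewrite dotvZl dotvZr -s2; by field.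
Qed.

Lemma strace_row n (A B : 'M[R]_n) i0 : (forall i j, i != i0 -> A i j = B i j) ->
  `|strace A - strace B| <= t^-1.
Proof.
move=> AB; have -> : A = B + (delta_mx 0 i0 : 'rV_n)^T *m (row i0 A - row i0 B).
  rewrite trmx_delta; apply/matrixP => i j; rewrite !mxE big_ord1 !mxE eqxx andbT.
  by case: eqP => [->|/eqP/AB ->]; rewrite ?mul1r ?subrKC ?mul0r ?addr0 // addrC subrK.
exact: strace_rank1.
Qed.

Lemma strace_rows n (A B : 'M[R]_n) (b : pred 'I_n) :
  (forall i j, ~~ b i -> A i j = B i j) ->
  `|strace A - strace B| <= #|b|%:R * t^-1.
Proof.
pose C (s : seq 'I_n) := \matrix_(i, j) (if i \in s then A i j else B i j).
have CB s : `|strace (C s) - strace B| <= (size s)%:R * t^-1.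
  elim: s => [|i s IH].
    rewrite (_ : C [::] = B) ?subrr ?normr0 ?mul0r //.
    by apply/matrixP => i j; rewrite mxE.
  rewrite -(subrK (strace (C s)) (strace _)) -addrA (le_trans (ler_normD _ _)) //.
  rewrite /= -natr1 mulrDl mul1r [leRHS]addrC lerD //.
  by apply: (@strace_row _ _ _ i) => k j ki; rewrite !mxE inE (negbTE ki).
move=> AB; have := CB (enum b); rewrite -cardE; congr (`|_ - _| <= _).
congr strace; apply/matrixP => i j; rewrite mxE mem_enum.
by case: ifPn => // /AB.
Qed.

Definition frob2 m n (A : 'M[R]_(m, n)) : R := \sum_i \sum_j A i j ^+ 2.

Lemma frob2E m n (A : 'M[R]_(m, n)) : frob2 A = \tr (A *m A^T).
Proof.
apply: eq_bigr => i _; rewrite !mxE; apply: eq_bigr => j _.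
by rewrite !mxE expr2.
Qed.

Lemma frob2_row m n (A : 'M[R]_(m, n)) : frob2 A = \sum_i dotv (row i A) (row i A).
Proof.
apply: eq_bigr => i _; rewrite dotvE; apply: eq_bigr => j _.
by rewrite !mxE expr2.
Qed.

Lemma frob2_mul_resolv m n (A : 'M[R]_(m, n)) (K : 'M[R]_n) : psd K ->
  frob2 (A *m resolv t K) <= t^-2 * frob2 A.
Proof.
move=> Kp; rewrite !frob2_row mulr_sumr; apply: ler_sum => i _.
by rewrite row_mul; exact: resolv_norm.
Qed.

Lemma frob2_tr m n (A : 'M[R]_(m, n)) : frob2 A^T = frob2 A.
Proof.
rewrite /frob2 exchange_big; apply: eq_bigr => i _; apply: eq_bigr => j _.
by rewrite mxE.
Qed.

Lemma frob2_1 n : frob2 (1%:M : 'M[R]_n) = n%:R.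
Proof. by rewrite frob2E mul1mx trmx1 mxtrace1. Qed.

Lemma frob2_resolv n (K : 'M[R]_n) : psd K -> frob2 (resolv t K) <= t^-2 * n%:R.
Proof. by move=> Kp; rewrite -[X in frob2 X]mul1mx -(frob2_1 n) frob2_mul_resolv. Qed.

(** Here [G B^T B G = G - t G^2 <= G <= 1 / t]: the operator norm of [B G] is at most [t^(-1/2)],
    whatever the size of [B]. *)
Lemma frob2_mul_half m n (B : 'M[R]_(m, n)) (L : 'M[R]_n) :
  frob2 (B *m resolv t (B^T *m B) *m L) <= t^-1 * frob2 L.
Proof.
have Bp := psd_gram B; set G := resolv t _.
rewrite -[leLHS]frob2_tr -(frob2_tr L) frob2_row !frob2_row mulr_sumr.
apply: ler_sum => i _; rewrite 2!trmx_mul resolv_sym // row_mul mulmxA.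
set x := row i _; apply: le_trans (resolv_le t_gt0 Bp x); rewrite -/G.
rewrite -[X in _ <= dotv _ X]mulmx1 -(resolvV t_gt0 Bp) -/G mulmxA mulmxDr.
rewrite dotvDr mul_mx_scalar dotvZr [X in _ <= dotv _ X + _]mulmxA.
rewrite [X in _ <= X + _]dotvC [X in _ <= X + _]dotv_mulmx lerDl.
by rewrite mulr_ge0 ?dotv_ge0 // ltW.
Qed.

Lemma trmul_bound m n (D W : 'M[R]_(m, n)) al : 0 < al ->
  `|\tr (D^T *m W)| <= 2^-1 * (al^-1 * frob2 D + al * frob2 W).
Proof.
move=> al0; have -> : \tr (D^T *m W) = \sum_i \sum_j D i j * W i j.
  rewrite exchange_big; apply: eq_bigr => i _; rewrite mxE.
  by apply: eq_bigr => j _; rewrite mxE.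
rewrite /frob2 !mulr_sumr -big_split mulr_sumr (le_trans (ler_norm_sum _ _ _))//.
apply: ler_sum => i _; rewrite /= !mulr_sumr -big_split mulr_sumr.
rewrite (le_trans (ler_norm_sum _ _ _))//; apply: ler_sum => j _ /=.
rewrite -(ler_pM2l al0); set d := D i j; set w := W i j.
have -> : al * (2^-1 * (al^-1 * d ^+ 2 + al * w ^+ 2)) = 2^-1 * (d ^+ 2 + (al * w) ^+ 2).
  by field; rewrite gt_eqF.
rewrite -[al in leLHS]gtr0_norm // -normrM ler_norml; apply/andP; split.
  by have := sqr_ge0 (d + al * w); lra.
by have := sqr_ge0 (d - al * w); lra.
Qed.

(** The resolvent identity gives [GA - GB = - (GA A^T D GB + GA D^T B GB)] with [D = A - B]. In each
    trace [D] is paired with [A GA GB] or [B GB GA], bounded by [frob2_mul_half], so the norms of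
    [A] and [B] do not enter. AM-GM with weight [al] replaces Cauchy-Schwarz. *)
Lemma strace_frob m n (A B : 'M[R]_(m, n)) al : 0 < al ->
  `|strace A - strace B| <= al^-1 * frob2 (A - B) + al * (t^-3 * n%:R).
Proof.
move=> al0; set D := A - B.
have Ap := psd_gram A; have Bp := psd_gram B.
set GA := resolv t (A^T *m A); set GB := resolv t (B^T *m B).
have DE : B^T *m B + t%:M - (A^T *m A + t%:M) = - (A^T *m D + D^T *m B).
  rewrite opprD addrACA subrr addr0 /D mulmxBr linearB /= mulmxBl addrA subrK.
  by rewrite opprB.
have e : GA - GB = - (GA *m A^T *m D *m GB + GA *m D^T *m B *m GB).
  have -> : GA - GB = GA *m ((B^T *m B + t%:M) - (A^T *m A + t%:M)) *m GB.
    by rewrite mulmxBr mulmxBl -mulmxA resolvK // mulmx1 resolvV // mul1mx.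
  by rewrite DE mulmxN mulNmx mulmxDr mulmxDl !mulmxA.
have GAs : GA^T = GA by exact: resolv_sym.
have GBs : GB^T = GB by exact: resolv_sym.
have bound M (L : 'M[R]_n) : frob2 M <= t^-1 * frob2 L -> frob2 L <= t^-2 * n%:R ->
    `|\tr (D^T *m M)| <= 2^-1 * (al^-1 * frob2 D + al * (t^-3 * n%:R)).
  move=> h1 h2; apply: (le_trans (trmul_bound D M al0)).
  have h3 : frob2 M <= t ^- 3 * n%:R.
    by apply: (le_trans h1); rewrite exprS invfM -mulrA ler_pM2l // invr_gt0.
  by have := ler_wpM2l (ltW al0) h3; lra.
rewrite /strace -linearB /= -/GA -/GB e linearN /= normrN mxtraceD.
apply: (le_trans (ler_normD _ _)).
have -> : \tr (GA *m A^T *m D *m GB) = \tr (D^T *m (A *m GA *m GB)).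
  rewrite -mxtrace_tr !trmx_mul GAs GBs trmxK mxtrace_mulC.
  by rewrite -!mulmxA.
have -> : \tr (GA *m D^T *m B *m GB) = \tr (D^T *m (B *m GB *m GA)).
  by rewrite -!mulmxA mxtrace_mulC !mulmxA.
have h1 := bound _ _ (frob2_mul_half A GB) (frob2_resolv Bp).
have h2 := bound _ _ (frob2_mul_half B GA) (frob2_resolv Ap).
by move: (lerD h1 h2); rewrite -/GA -/GB; lra.
Qed.

Lemma tr_resolv_ge0 n (K : 'M[R]_n) : psd K -> 0 <= \tr (resolv t K).
Proof.
move=> Kp; apply: sumr_ge0 => i _.
have -> : resolv t K i i = dotv ((delta_mx 0 i : 'rV_n) *m resolv t K) (delta_mx 0 i).
  by rewrite -rowE /dotv trmx_delta -colE !mxE.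
exact: resolv_ge0.
Qed.

Lemma strace_bound m n (A : 'M[R]_(m, n)) : 0 <= strace A <= t^-1 * n%:R.
Proof.
have Ap := psd_gram A.
have e i : resolv t (A^T *m A) i i =
    dotv ((delta_mx 0 i : 'rV_n) *m resolv t (A^T *m A)) (delta_mx 0 i).
  by rewrite -rowE /dotv trmx_delta -colE !mxE.
rewrite /strace /mxtrace sumr_ge0 => [|i _]; last by rewrite e resolv_ge0.
rewrite -[n in leRHS]card_ord -sumr_const mulr_sumr; apply: ler_sum => i _.
rewrite e (le_trans (resolv_le t_gt0 Ap _)) // ler_pM2l ?invr_gt0 //.
by rewrite /dotv trmx_delta mul_delta_mx mxE !eqxx.
Qed.

Lemma gram_row m n (A : 'M[R]_(m, n)) : A^T *m A = \sum_i (row i A)^T *m row i A.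
Proof.
apply/matrixP => i j; rewrite summxE mxE; apply: eq_bigr => k _.
by rewrite !mxE big_ord1 !mxE.
Qed.

Definition gram_minus m n (A : 'M[R]_(m, n)) i0 : 'M[R]_n :=
  \sum_(i | i != i0) (row i A)^T *m row i A.

Lemma psd_gram_minus m n (A : 'M[R]_(m, n)) i0 : psd (gram_minus A i0).
Proof.
apply: (big_ind (@psd n)) => //; last first.
- by move=> i _; exact: psd_rank1.
- exact: psdD.
- by split => [|x]; rewrite ?trmx0 // mulmx0 /dotv mul0mx mxE.
Qed.

Lemma gram_minusK m n (A : 'M[R]_(m, n)) i0 :
  gram_minus A i0 + (row i0 A)^T *m row i0 A = A^T *m A.
Proof. by rewrite [RHS]gram_row [RHS](bigD1 i0) //= addrC. Qed.

Lemma strace_self m n (A : 'M[R]_(m, n)) :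
  \sum_i (let b := dotv (row i A *m resolv t (gram_minus A i)) (row i A) in
    b / (1 + b)) = n%:R - t * strace A.
Proof.
rewrite /strace -tr_mul_resolv; last exact: psd_gram.
rewrite {1}gram_row mulmx_suml linear_sum /=; apply: eq_bigr => i _.
rewrite -dotv_resolv_rank1; last exact: psd_gram_minus.
rewrite -mulmxA mxtrace_mulC /mxtrace big_ord1.
by congr ((_ *m resolv t _ *m _) _ _); exact: gram_minusK.
Qed.

Lemma tr_gram_minus m n (A : 'M[R]_(m, n)) i0 :
  `|\tr (resolv t (gram_minus A i0)) - strace A| <= t^-1.
Proof.
have := tr_resolv_rank1 (row i0 A) (psd_gram_minus A i0).
by rewrite gram_minusK; move=> /andP[? ?]; rewrite ger0_norm.
Qed.

End trace.
End resolvent.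

(** * The self-consistent equation *)

Section quadratic_form.
Context {R : rcfType} (V : finType) (p : V -> R) (pd : isdist p).
Context (y : V -> R) (L s2 : R) (y_mean : Ew p y = 0)
  (y_var : Ew p (fun v => y v ^+ 2) = s2) (y_bnd : forall v, `|y v| <= L).
Context (n : nat).
Local Notation row_sp := {ffun 'I_n -> V}.

Definition rowv (r : row_sp) : 'rV[R]_n := \row_j y (r j).

Let y2 v : y v ^+ 2 <= L ^+ 2.
Proof.
have L0 : 0 <= L by exact: le_trans (normr_ge0 _) (y_bnd v).
by rewrite -[leLHS]real_normK ?num_real // ler_pXn2r // nnegrE.
Qed.

Let s2_ge0 : 0 <= s2.
Proof. by rewrite -y_var; apply: Ew_ge0 => // v; exact: sqr_ge0. Qed.

Let s2_le : s2 <= L ^+ 2.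
Proof. by rewrite -y_var; exact: Ew_le. Qed.

Let L2_ge0 : 0 <= L ^+ 2. Proof. exact: le_trans s2_le. Qed.

Lemma Ew_quad (B : 'M[R]_n) :
  Ew (fprod p) (fun r => dotv (rowv r *m B) (rowv r)) = s2 * \tr B.
Proof.
have -> : s2 * \tr B = \sum_j \sum_i B i j * (if i == j then s2 else 0).
  rewrite mulr_sumr; apply: eq_bigr => j _; rewrite (bigD1 j) //= eqxx big1 ?addr0.
    by rewrite mulrC.
  by move=> i /negbTE ->; rewrite mulr0.
transitivity (Ew (fprod p) (fun r : row_sp => \sum_j \sum_i B i j * (y (r i) * y (r j)))).
  apply: eq_Ew => r; rewrite dotvE; apply: eq_bigr => j _.
  rewrite !mxE mulr_suml; apply: eq_bigr => i _; rewrite !mxE; ring.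
rewrite Ew_sum; apply: eq_bigr => j _; rewrite Ew_sum; apply: eq_bigr => i _.
rewrite EwZ; congr (_ * _); case: eqP => [->|/eqP ij].
  by under eq_Ew do rewrite -expr2; rewrite (Ew_coord _ (fun v => y v ^+ 2)).
by rewrite Ew_coord2 // y_mean mul0r.
Qed.

Lemma rowv_upd r i x :
  rowv (upd r i x) = rowv r + (y x - y (r i)) *: delta_mx 0 i.
Proof.
apply/rowP => j; rewrite !mxE updE eqxx /= [j == i]eq_sym.
by case: eqP => [->|]; rewrite ?mulr1 ?mulr0 ?addr0 // subrKC.
Qed.

Lemma quad_upd (B : 'M[R]_n) r i x : B^T = B ->
  dotv (rowv (upd r i x) *m B) (rowv (upd r i x)) =
  dotv (rowv r *m B) (rowv r) + 2%:R * (y x - y (r i)) * (rowv r *m B) 0 i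
  + (y x - y (r i)) ^+ 2 * B i i.
Proof.
move=> Bs; rewrite rowv_upd mulmxDl -scalemxAl dotvDl !dotvDr !dotvZl !dotvZr.
have e1 (z : 'rV_n) : dotv z (delta_mx 0 i) = z 0 i.
  by rewrite /dotv trmx_delta -colE mxE.
have -> : dotv (delta_mx 0 i *m B) (rowv r) = (rowv r *m B) 0 i.
  by rewrite dotv_mulmx Bs dotvC e1.
by rewrite !e1 -rowE [row _ _ _ _]mxE; ring.
Qed.

(** Efron-Stein, where resampling the coordinate [i] changes the form by [2 z l - (s2 + z^2) b] with
    [l] linear in the entries. The bound [L] on [y] stands in for a fourth moment:
    [(x - y)^2 <= 2 x^2 + 2 y^2] and [s2 + z^2 <= 2 L^2] produce the two coefficients 8, and these
    add up to 16. *)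
Lemma quad_var (B : 'M[R]_n) : B^T = B ->
  Ew (fprod p) (fun r => (dotv (rowv r *m B) (rowv r) - s2 * \tr B) ^+ 2) <=
  16%:R * L ^+ 4 * frob2 B.
Proof.
move=> Bs; rewrite -Ew_quad; apply: (le_trans (Efron_Stein _ pd)).
rewrite /frob2 mulr_sumr; apply: ler_sum => i _.
have fpd : isdist (fprod p : row_sp -> R) by exact: isdist_fprod.
have Bii : B i i ^+ 2 <= \sum_j B i j ^+ 2.
  by rewrite (bigD1 i) //= lerDl sumr_ge0 // => j _; exact: sqr_ge0.
apply: (@le_trans _ _ (Ew (fprod p) (fun r =>
   8%:R * L ^+ 2 * (\sum_j B j i * y (r j)) ^+ 2 + 8%:R * L ^+ 4 * B i i ^+ 2))).
  apply: ler_Ew => // r.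
  have -> : avg p i (fun r => dotv (rowv r *m B) (rowv r)) r =
    dotv (rowv r *m B) (rowv r) - 2%:R * y (r i) * (rowv r *m B) 0 i
    + (s2 + y (r i) ^+ 2) * B i i.
    rewrite /avg; under eq_Ew do rewrite quad_upd //.
    rewrite !EwD Ew_cst // !EwZr EwZ EwB y_mean Ew_cst // Ew_var // y_mean y_var.
    by ring.
  have -> : (rowv r *m B) 0 i = \sum_j B j i * y (r j).
    by rewrite mxE; apply: eq_bigr => j _; rewrite !mxE mulrC.
  set Q := dotv _ _; set l := \sum_j _; set b := B i i; set z := y (r i).
  have -> : Q - (Q - 2%:R * z * l + (s2 + z ^+ 2) * b) =
    2%:R * z * l - (s2 + z ^+ 2) * b by ring.
  have h1 : z ^+ 2 * l ^+ 2 <= L ^+ 2 * l ^+ 2 by rewrite ler_wpM2r ?sqr_ge0 ?y2.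
  have h2 : ((s2 + z ^+ 2) * b) ^+ 2 <= 4%:R * L ^+ 4 * b ^+ 2.
    rewrite exprMn ler_wpM2r ?sqr_ge0 //.
    have -> : 4%:R * L ^+ 4 = (2%:R * L ^+ 2) ^+ 2 by ring.
    have z2 : z ^+ 2 <= L ^+ 2 by exact: y2.
    have z0 := sqr_ge0 z; have := s2_le; have := s2_ge0 => ? ?.
    by rewrite ler_pXn2r // ?nnegrE; lra.
  have h3 := sqr_ge0 (2%:R * z * l + (s2 + z ^+ 2) * b).
  by move: h1 h2 h3; set X := (s2 + _) * b; lra.
rewrite EwD Ew_cst // EwZ Ew_lin_sqr // y_var.
have -> : \sum_j B j i ^+ 2 = \sum_j B i j ^+ 2.
  by apply: eq_bigr => j _; rewrite -{1}Bs mxE.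
set f := \sum_j _ in Bii *.
have f0 : 0 <= f by apply: le_trans Bii; exact: sqr_ge0.
have h1 : L ^+ 2 * (f * s2) <= L ^+ 4 * f.
  have -> : L ^+ 4 * f = L ^+ 2 * (f * L ^+ 2) by ring.
  by rewrite ler_wpM2l // ler_wpM2l.
have h2 : L ^+ 4 * B i i ^+ 2 <= L ^+ 4 * f.
  by rewrite ler_wpM2l // -[4%N]/(2 * 2)%N exprM sqr_ge0.
lra.
Qed.

End quadratic_form.

Section fixed_point.
Context {R : rcfType} (t : R).

Definition phi (x : R) := x / (1 + x).

Lemma phi_lip (x z : R) : 0 <= x -> 0 <= z -> `|phi x - phi z| <= `|x - z|.
Proof.
move=> x0 z0; have x1 : 0 < 1 + x by lra.
have z1 : 0 < 1 + z by lra.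
have -> : phi x - phi z = (x - z) / ((1 + x) * (1 + z)).
  by rewrite /phi; field; rewrite !gt_eqF.
have xz1 : 0 < (1 + x) * (1 + z) by exact: mulr_gt0.
by rewrite normrM ler_piMr // normfV gtr0_norm // invf_le1 //; nra.
Qed.

Lemma phi_mono (x z : R) : 0 <= x -> x <= z -> phi x <= phi z.
Proof.
move=> x0 xz; rewrite -subr_ge0.
have -> : phi z - phi x = (z - x) / ((1 + x) * (1 + z)).
  by rewrite /phi; field; rewrite !gt_eqF //; lra.
by rewrite divr_ge0 ?subr_ge0 // mulr_ge0; lra.
Qed.

(* [m] is the value at [-t] of the Stieltjes transform of the law of the square
   of a quartercircular variable of parameter [sqrt v]. *)
Definition is_limit_strace (v m : R) := 0 <= m /\ t * m + phi (v * m) = 1.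

Lemma fixed_point_stable (v m m' : R) : 0 <= v -> is_limit_strace v m -> 0 <= m' ->
  t * `|m' - m| <= `|1 - t * m' - phi (v * m')|.
Proof.
move=> v0 [m0 <-] m'0.
have [le|/ltW le] := lerP m m'.
  have := phi_mono (mulr_ge0 v0 m0) (ler_wpM2l v0 le).
  by move=> h; rewrite ler_normr; apply/orP; right; lra.
have := phi_mono (mulr_ge0 v0 m'0) (ler_wpM2l v0 le).
by move=> h; apply: le_trans (ler_norm _); lra.
Qed.

End fixed_point.

Section iid_gram.
Context {R : rcfType} (t : R) (t_gt0 : 0 < t) (V : finType) (p : V -> R)
  (pd : isdist p).
Context (n : nat) (n_gt0 : (0 < n)%N).
Local Notation row_sp := {ffun 'I_n -> V}.
Local Notation mat_sp := {ffun 'I_n -> row_sp}.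
Local Notation pn := (fprod (fprod p) : mat_sp -> R).

Definition matval (y : V -> R) (w : mat_sp) : 'M[R]_n := \matrix_(i, j) y (w i j).

Let npos : 0 < n%:R :> R. Proof. by rewrite ltr0n. Qed.

Let fpd : isdist (fprod p : row_sp -> R).
Proof. exact: isdist_fprod. Qed.

Let ffpd : isdist pn.
Proof. exact: isdist_fprod. Qed.

Definition scale_mx : R := (Num.sqrt n%:R)^-1.

Lemma scale_mx2 : scale_mx ^+ 2 = n%:R^-1.
Proof. by rewrite /scale_mx exprVn sqr_sqrtr. Qed.

Lemma row_matval (y : V -> R) w i : row i (matval y w) = rowv y (w i).
Proof. by apply/rowP => j; rewrite !mxE. Qed.

(** The independence of the resolvent without row [i] from that row. *)
Lemma gram_minus_upd (y : V -> R) w i r c :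
  gram_minus (c *: matval y (upd w i r)) i = gram_minus (c *: matval y w) i.
Proof.
apply: eq_bigr => k ki; congr (_^T *m _); apply/rowP => j;
  by rewrite !mxE updE (negbTE ki).
Qed.

(** Origin of the errors: the first two come from [|z| <= be + z^2 / be] applied to the deviations
    of the quadratic forms, whose variance is bounded by [quad_var]; [s2 / (n t)] from replacing the
    trace of [G_i] by the full one; the last from entries of variance [s2] in place of [v]. *)
Lemma self_consistent (y : V -> R) (L s2 v m be : R) :
  Ew p y = 0 -> Ew p (fun x => y x ^+ 2) = s2 -> (forall x, `|y x| <= L) ->
  0 <= v -> is_limit_strace t v m -> 0 < be ->
  t * Ew pn (fun w => `|strace t (scale_mx *: matval y w) / n%:R - m|) <=
  be + 16%:R * L ^+ 4 / (n%:R * t ^+ 2 * be) + s2 / (n%:R * t) + `|s2 - v| / t.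
Proof.
move=> y0 y2 yL v0 lim_m be0.
have s20 : 0 <= s2 by rewrite -y2; apply: Ew_ge0 => // x; exact: sqr_ge0.
pose A w := scale_mx *: matval y w.
pose S w := strace t (A w).
pose G w i := resolv t (gram_minus (A w) i).
pose b w i := dotv (row i (A w) *m G w i) (row i (A w)).
pose Z w i := b w i - s2 * \tr (G w i) / n%:R.
have S0 w : 0 <= S w by case/andP: (strace_bound t_gt0 (A w)).
have trG0 w i : 0 <= \tr (G w i).
  rewrite /G; have : psd (gram_minus (A w) i) by exact: psd_gram_minus.
  exact: tr_resolv_ge0.
have pw w : t * `|S w / n%:R - m| <=
    n%:R^-1 * (\sum_i `|Z w i|) + s2 / (n%:R * t) + `|s2 - v| / t.
  have Sn0 : 0 <= S w / n%:R by rewrite divr_ge0.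
  apply: (le_trans (fixed_point_stable v0 lim_m Sn0)).
  have -> : 1 - t * (S w / n%:R) - phi (v * (S w / n%:R)) =
     n%:R^-1 * (\sum_i (phi (b w i) - phi (s2 * (S w / n%:R)))) +
     (phi (s2 * (S w / n%:R)) - phi (v * (S w / n%:R))).
    rewrite sumrB sumr_const card_ord (strace_self t_gt0 (A w)).
    by rewrite -/(S w) -mulr_natl; field; rewrite gt_eqF.
  apply: (le_trans (ler_normD _ _)); apply: lerD; last first.
    apply: (le_trans (phi_lip (mulr_ge0 s20 Sn0) (mulr_ge0 v0 Sn0))).
    rewrite -mulrBl normrM (ger0_norm Sn0) ler_wpM2l //.
    by rewrite ler_pdivrMr //; case/andP: (strace_bound t_gt0 (A w)).
  rewrite normrM ger0_norm ?invr_ge0 ?ler0n //.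
  have -> : s2 / (n%:R * t) = n%:R^-1 * \sum_(i < n) s2 / (n%:R * t).
    by rewrite sumr_const card_ord -mulr_natl; field; rewrite !gt_eqF.
  rewrite -mulrDr ler_wpM2l ?invr_ge0 ?ler0n // -big_split /=.
  apply: (le_trans (ler_norm_sum _ _ _)); apply: ler_sum => i _.
  have b0 : 0 <= b w i by apply: resolv_ge0 => //; exact: psd_gram_minus.
  apply: (le_trans (phi_lip b0 _)); first by rewrite mulr_ge0.
  have -> : b w i - s2 * (S w / n%:R) =
    Z w i + s2 / n%:R * (\tr (G w i) - S w) by rewrite /Z; ring.
  apply: (le_trans (ler_normD _ _)); rewrite lerD2l normrM.
  rewrite ger0_norm ?divr_ge0 // invfM mulrA ler_wpM2l ?divr_ge0 //.
  exact: tr_gram_minus.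
have EZ i : Ew pn (fun w => `|Z w i|) <= be + 16%:R * L ^+ 4 / (n%:R * t ^+ 2 * be).
  apply: (@le_trans _ _ (Ew pn (fun w => be + be^-1 * Z w i ^+ 2))).
    apply: ler_Ew => // w; set z := Z w i.
    have z2 : z ^+ 2 = `|z| ^+ 2 by rewrite real_normK ?num_real.
    rewrite z2 -(ler_pM2l be0) mulrDr mulrA divff ?gt_eqF // mul1r.
    by have := normr_ge0 z; set q := `|z|; have := sqr_ge0 (be - q); nra.
  rewrite EwD Ew_cst // lerD2l EwZ.
  have -> : 16%:R * L ^+ 4 / (n%:R * t ^+ 2 * be) =
     be^-1 * (16%:R * L ^+ 4 / (n%:R * t ^+ 2)) by field; rewrite !gt_eqF.
  (* Row [i] is averaged first with the other rows frozen, which makes [G w i] a constant matrix. *)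
  rewrite ler_pM2l ?invr_gt0 // -(Ew_avg i _ fpd).
  apply: Ew_le => // w; rewrite /avg.
  have ZE r : Z (upd w i r) i =
      n%:R^-1 * (dotv (rowv y r *m G w i) (rowv y r) - s2 * \tr (G w i)).
    rewrite /Z /b /G /A gram_minus_upd.
    have -> : row i (scale_mx *: matval y (upd w i r)) = scale_mx *: rowv y r.
      by rewrite linearZ /= row_matval upd_eq.
    by rewrite -scalemxAl dotvZl dotvZr mulrA -expr2 scale_mx2; ring.
  under eq_Ew do rewrite ZE exprMn.
  rewrite EwZ.
  have Gs : (G w i)^T = G w i by apply: resolv_sym; exact: psd_gram_minus.
  have := quad_var pd y0 y2 yL Gs.
  have := frob2_resolv t_gt0 (psd_gram_minus (A w) i); rewrite -/(G w i).
  set E := Ew _ _; set f := frob2 _ => h1 h2.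
  have L4 : 0 <= 16%:R * L ^+ 4 by rewrite mulr_ge0 // -[4%N]/(2 * 2)%N exprM sqr_ge0.
  have h3 := le_trans h2 (ler_wpM2l L4 h1).
  have : n%:R^-1 ^+ 2 * E <= n%:R^-1 ^+ 2 * (16%:R * L ^+ 4 * (t ^- 2 * n%:R)).
    by rewrite ler_wpM2l ?sqr_ge0.
  by congr (_ <= _); field; rewrite !gt_eqF.
apply: (@le_trans _ _ (Ew pn (fun w =>
   n%:R^-1 * (\sum_i `|Z w i|) + (s2 / (n%:R * t) + `|s2 - v| / t)))).
  by rewrite -EwZ; apply: ler_Ew => // w; rewrite addrA; exact: pw.
rewrite EwD Ew_cst // addrA !lerD2r EwZ Ew_sum.
rewrite -(ler_pM2l npos) mulrA divff ?gt_eqF // mul1r.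
apply: (le_trans (ler_sum _ (fun i _ => EZ i))).
by rewrite sumr_const card_ord [leRHS]mulr_natl.
Qed.

End iid_gram.

(** * Row-normalised matrices with finitely supported entries *)

Section row_normalisation.
Context {R : rcfType}.

Definition rownorm n (X : 'M[R]_n) : 'M[R]_n :=
  \matrix_(i, j) let S := \sum_k X i k in
    if S == 0 then (i == j)%:R else X i j / S.

Definition stieltjes t n (A : 'M[R]_n) : R := strace t A / n%:R.

Definition markov_stieltjes t n (X : 'M[R]_n) : R :=
  stieltjes t (Num.sqrt n%:R *: rownorm X).

(* The concentration estimates below depend on the law only through these
   bounds, so they apply to a discretisation that is refined as [n] grows. *)
Definition approx_law (V : finType) (p a : V -> R) (v L eta : R) :=
  [/\ isdist p, forall x, 0 <= a x, `|Ew p a - 1| <= eta,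
      `|Ew p (fun x => a x ^+ 2) - (1 + v)| <= eta &
      Ew p (fun x => if L < a x then a x ^+ 2 else 0) <= eta].

Section expectation.
Context (t : R) (t_gt0 : 0 < t) (V : finType) (p a : V -> R) (v L eta m : R).
Context (law : approx_law p a v L eta) (v_ge0 : 0 <= v) (L_ge1 : 1 <= L)
  (eta_le1 : eta <= 1) (lim_m : is_limit_strace t v m).
Context (n : nat) (n_gt0 : (0 < n)%N).
Local Notation row_sp := {ffun 'I_n -> V}.
Local Notation mat_sp := {ffun 'I_n -> row_sp}.
Local Notation pn := (fprod (fprod p) : mat_sp -> R).

Let pd : isdist p. Proof. by case: law. Qed.
Let fpd : isdist (fprod p : row_sp -> R). Proof. exact: isdist_fprod. Qed.
Let ffpd : isdist pn. Proof. exact: isdist_fprod. Qed.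
Let npos : 0 < n%:R :> R. Proof. by rewrite ltr0n. Qed.

Let a0 x : 0 <= a x. Proof. by case: law. Qed.

(** Entries above [L] become [0], not [L]: then [(a - ac)^2 = tl] and [ac^2 = a^2 - tl] hold
    exactly. *)
Let ac x := if L < a x then 0 else a x.
Let tl x := if L < a x then a x ^+ 2 else 0.
Let e1 := Ew p ac.
Let y x := ac x - e1.

Let L0 : 0 <= L. Proof. exact: le_trans ler01 _. Qed.

Let ac_bnd x : 0 <= ac x <= L.
Proof. by rewrite /ac; case: ltP => h; rewrite ?lexx ?a0 ?L0 //= ?h. Qed.

Let e1_bnd : 0 <= e1 <= L.
Proof.
by rewrite Ew_ge0 ?Ew_le // => x; case/andP: (ac_bnd x).
Qed.

Let y_mean : Ew p y = 0.
Proof. by rewrite EwB Ew_cst // subrr. Qed.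

Let y_bnd x : `|y x| <= L.
Proof.
case/andP: (ac_bnd x) => ? ?; case/andP: e1_bnd => ? ?.
by rewrite ler_norml; apply/andP; split; rewrite /y; lra.
Qed.

Let s2 := Ew p (fun x => y x ^+ 2).

Let m2 := Ew p (fun x => a x ^+ 2).

Let tlE : Ew p tl <= eta. Proof. by case: law. Qed.

Let m2_le : m2 <= 2%:R + v.
Proof.
by case: law => _ _ _; rewrite -/m2 ler_norml => /andP[? ?] _; have := eta_le1; lra.
Qed.

Let s2E : s2 = m2 - Ew p tl - e1 ^+ 2.
Proof.
rewrite /s2 /y Ew_var // -/e1 /m2 -EwB.
have -> : Ew p (fun x => ac x ^+ 2) = Ew p (fun x => a x ^+ 2 - tl x).
  by apply: eq_Ew => x; rewrite /ac /tl; case: ifP; rewrite ?subrr ?subr0 ?expr0n.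
ring.
Qed.

Let tlx0 x : 0 <= tl x.
Proof. by rewrite /tl; case: ifP => // _; exact: sqr_ge0. Qed.

Let tl0 : 0 <= Ew p tl.
Proof. exact: Ew_ge0. Qed.

Let s2_le : s2 <= 2%:R + v.
Proof. by have := m2_le; have := tl0; have := sqr_ge0 e1; rewrite s2E; lra. Qed.

Let e1_near : `|e1 - 1| <= 2%:R * eta.
Proof.
have h : e1 = Ew p a - Ew p (fun x => a x - ac x) by rewrite EwB opprB addrC subrK.
have h1 : 0 <= Ew p (fun x => a x - ac x).
  by apply: Ew_ge0 => // x; rewrite /ac; case: ifP => _; rewrite ?subr0 ?subrr ?a0.
(* Where [L < a] one has [a <= a^2], because [L >= 1]. *)
have h2 : Ew p (fun x => a x - ac x) <= Ew p tl.
  apply: ler_Ew => // x; rewrite /ac /tl; case: ifP => [Lx|_]; last by rewrite subrr.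
  rewrite subr0 expr2 ler_peMl ?a0 //; apply: ltW; exact: le_lt_trans Lx.
case: law => _ _; rewrite ler_norml => /andP[g1 g2] _ _.
by have := tlE; rewrite ler_norml => ?; apply/andP; split; lra.
Qed.

(** One [eta] each for the second moment and the tail, and
    [|e1^2 - 1| <= 2 eta (2 + 2 eta) <= 8 eta] for the mean, as [eta <= 1]. *)
Let s2_near : `|s2 - v| <= 10%:R * eta.
Proof.
case: law => _ _ _; rewrite -/m2 => g _; have := e1_near.
move: g; rewrite !ler_norml => /andP[g1 g2] /andP[g3 g4].
have := tlE; have := tl0; have := eta_le1; case/andP: e1_bnd => e0 _ le1 h1 h2.
rewrite s2E; apply/andP; split; nra.
Qed.

Let eta_ge0 : 0 <= eta. Proof. exact: le_trans tlE. Qed.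

Let rho (r : row_sp) := \sum_j a (r j).

Let bad eps (r : row_sp) := eps < `|rho r / n%:R - 1|.

Let bad_expect : Ew (fprod p : row_sp -> R) (fun r => (rho r / n%:R - 1) ^+ 2) <=
  2%:R * (2%:R + v) / n%:R + 2%:R * eta ^+ 2.
Proof.
pose z x := a x - Ew p a.
have z0 : Ew p z = 0 by rewrite EwB Ew_cst // subrr.
have g : (Ew p a - 1) ^+ 2 <= eta ^+ 2.
  case: law => _ _ h _ _.
  by rewrite -[leLHS]real_normK ?num_real // ler_pXn2r // nnegrE.
apply: (@le_trans _ _ (Ew (fprod p : row_sp -> R) (fun r =>
   2%:R * (\sum_j n%:R^-1 * z (r j)) ^+ 2 + 2%:R * (Ew p a - 1) ^+ 2))).
  apply: ler_Ew => // r.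
  have -> : rho r / n%:R - 1 = (\sum_j n%:R^-1 * z (r j)) + (Ew p a - 1).
    rewrite /rho -mulr_sumr sumrB sumr_const card_ord -[Ew p a *+ n]mulr_natl; field.
    by rewrite gt_eqF.
  set A := \sum_j _; set B := Ew p a - 1.
  by have := sqr_ge0 (A - B); lra.
rewrite EwD Ew_cst // EwZ Ew_lin_sqr // sumr_const card_ord.
apply: lerD; last by rewrite ler_pM2l.
rewrite -mulrA ler_pM2l //.
have -> : n%:R^-1 ^+ 2 *+ n = n%:R^-1 :> R.
  by rewrite -[LHS]mulr_natl expr2 mulrA divff ?mul1r // gt_eqF.
rewrite mulrC ler_pM2r ?invr_gt0 // Ew_var // -/m2.
by have := m2_le; have := sqr_ge0 (Ew p a); lra.
Qed.

(** For a good row [q = rho / n] is at least [1/2], so [|1/q - 1| <= 2 eps]. The rescaling error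
    [a (1/q - 1)] and the truncation error [a - ac] are separated by
    [(x + y)^2 <= 2 x^2 + 2 y^2]. *)
Let row_close eps (r : row_sp) i : 0 < eps -> eps <= 2^-1 -> ~~ bad eps r ->
  (Num.sqrt n%:R * (a (r i) / rho r) - scale_mx n * ac (r i)) ^+ 2 <=
  n%:R^-1 * (8%:R * eps ^+ 2 * a (r i) ^+ 2 + 2%:R * tl (r i)).
Proof.
move=> eps0 eps2; rewrite /bad -leNgt => close.
have rn : 2^-1 <= rho r / n%:R.
  by move: close; rewrite ler_norml => /andP[? ?]; lra.
set q := rho r / n%:R in rn close.
have q0 : 0 < q by lra.
have sn : Num.sqrt n%:R = n%:R * scale_mx n :> R.
  rewrite /scale_mx; have s0 : 0 < Num.sqrt n%:R :> R by rewrite sqrtr_gt0.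
  by apply: (mulIf (lt0r_neq0 s0)); rewrite -expr2 sqr_sqrtr ?ler0n // mulfVK ?gt_eqF.
have -> : Num.sqrt n%:R * (a (r i) / rho r) - scale_mx n * ac (r i) =
  scale_mx n * (a (r i) * (q^-1 - 1) + (a (r i) - ac (r i))).
  rewrite sn /q invf_div; ring.
rewrite exprMn scale_mx2 // ler_wpM2l ?invr_ge0 ?ler0n //.
have q1 : (q^-1 - 1) ^+ 2 <= 4%:R * eps ^+ 2.
  have -> : q^-1 - 1 = - (q - 1) * q^-1 by field; rewrite gt_eqF.
  rewrite exprMn sqrrN mulrC; apply: ler_pM; rewrite ?sqr_ge0 //.
    have -> : 4%:R = 2%:R ^+ 2 :> R by ring.
    have qi0 : 0 <= q^-1 by rewrite invr_ge0 ltW.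
    rewrite ler_pXn2r ?nnegrE // -[leRHS]invrK lef_pV2 // posrE invr_gt0 //.
  by rewrite -[leLHS]real_normK ?num_real // ler_pXn2r // ?nnegrE ?(ltW eps0).
have -> : tl (r i) = (a (r i) - ac (r i)) ^+ 2.
  by rewrite /tl /ac; case: ifP; rewrite ?subr0 ?subrr ?expr0n.
set d := a (r i) - _; set u := a (r i).
have := ler_wpM2l (sqr_ge0 u) q1; have := sqr_ge0 (u * (q^-1 - 1) - d).
lra.
Qed.

(* In the order of the summands: rows whose sum is not close to [n] (rank);
   rescaling of the other rows and truncation at [L] (Frobenius norm, with
   AM-GM parameter [al]); centering of the entries (rank one); and
   [self_consistent] for the truncated centred entries. *)
Lemma markov_expectation al eps be : 0 < al -> 0 < eps -> eps <= 2^-1 -> 0 < be ->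
  Ew pn (fun w => `|markov_stieltjes t (matval a w) - m|) <=
  (2%:R * (2%:R + v) / n%:R + 2%:R * eta ^+ 2) / (eps ^+ 2 * t)
  + al^-1 * (8%:R * eps ^+ 2 * (2%:R + v) + 2%:R * eta) + al / t ^+ 3
  + (n%:R * t)^-1
  + (be + 16%:R * L ^+ 4 / (n%:R * t ^+ 2 * be) + (2%:R + v) / (n%:R * t)
     + 10%:R * eta / t) / t.
Proof.
move=> al0 eps0 eps2 be0.
pose A1 w : 'M[R]_n := Num.sqrt n%:R *: rownorm (matval a w).
pose A2 w : 'M[R]_n := scale_mx n *: matval ac w.
pose A4 w : 'M[R]_n := scale_mx n *: matval y w.
(* A hybrid whose bad rows come from [A2]: it differs from [A1] in few rows, and from [A2] only in
   good rows, where [row_close] applies. *)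
pose A12 (w : mat_sp) : 'M[R]_n :=
  \matrix_(i, j) if bad eps (w i) then A2 w i j else A1 w i j.
pose D (w : mat_sp) := \sum_i (rho (w i) / n%:R - 1) ^+ 2.
pose Q (w : mat_sp) := \sum_i \sum_j
  (8%:R * eps ^+ 2 * a (w i j) ^+ 2 + 2%:R * tl (w i j)).
have h1 (w : mat_sp) : `|strace t (A1 w) - strace t (A12 w)| <= eps ^- 2 * D w / t.
  apply: (le_trans (strace_rows t_gt0 (b := fun i : 'I_n => bad eps (w i)) _)).
    by move=> i j nb; rewrite [RHS]mxE (negbTE nb).
  rewrite ler_pM2r ?invr_gt0 // -sum1_card natr_sum mulr_sumr big_mkcond.
  apply: ler_sum => i _; rewrite -topredE /= /bad; case: ifPn => [h|_]; last first.
    by rewrite mulr_ge0 ?sqr_ge0 // invr_ge0 sqr_ge0.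
  rewrite -(ler_pM2l (exprn_gt0 2 eps0)) mulrA divff ?gt_eqF ?exprn_gt0 //.
  by rewrite mul1r mulr1 -[leRHS]real_normK ?num_real // ler_pXn2r ?nnegrE // ltW.
have h2 (w : mat_sp) : `|strace t (A12 w) - strace t (A2 w)| <=
    al^-1 * (n%:R^-1 * Q w) + al * (t ^- 3 * n%:R).
  apply: (le_trans (strace_frob t_gt0 _ _ al0)); rewrite lerD2r.
  rewrite ler_pM2l ?invr_gt0 // /frob2 /Q mulr_sumr; apply: ler_sum => i _.
  rewrite mulr_sumr; apply: ler_sum => j _.
  have nn : 0 <= n%:R^-1 * (8%:R * eps ^+ 2 * a (w i j) ^+ 2 + 2%:R * tl (w i j)).
    rewrite mulr_ge0 ?invr_ge0 ?ler0n //; apply: addr_ge0; apply: mulr_ge0 => //.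
      by rewrite mulr_ge0 ?sqr_ge0.
    exact: sqr_ge0.
  have -> : (A12 w - A2 w) i j = A12 w i j - A2 w i j by rewrite mxE [X in _ + X]mxE.
  rewrite [A12 w i j]mxE; case: ifPn => nb; first by rewrite subrr expr0n.
  apply: le_trans (row_close j eps0 eps2 nb); rewrite !mxE.
  have -> : \sum_k matval a w i k = rho (w i).
    by apply: eq_bigr => k _; rewrite mxE.
  (* A row of sum [0] is bad, since then [|rho / n - 1| = 1 > eps]; the identity rows of [rownorm]
     are thus never compared entrywise. *)
  have [rho0|rho0] := eqVneq (rho (w i)) 0; last by rewrite /= (negbTE rho0).
  move: nb; rewrite /bad rho0 mul0r sub0r normrN normr1 -leNgt => h.
  by exfalso; lra.
have h3 w : `|strace t (A2 w) - strace t (A4 w)| <= t^-1.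
  have -> : A2 w = A4 w + (const_mx (scale_mx n * e1) : 'rV_n)^T *m (const_mx 1 : 'rV_n).
    apply/matrixP => i j; rewrite !mxE big_ord1 !mxE mulr1 /y; ring.
  exact: strace_rank1.
have pw w : `|markov_stieltjes t (matval a w) - m| <=
    (n%:R^-1 * eps ^- 2 / t) * D w + al^-1 * n%:R^-2 * Q w
    + `|strace t (A4 w) / n%:R - m| + (al / t ^+ 3 + (n%:R * t)^-1).
  have -> : markov_stieltjes t (matval a w) - m =
     n%:R^-1 * ((strace t (A1 w) - strace t (A12 w)) +
       (strace t (A12 w) - strace t (A2 w)) + (strace t (A2 w) - strace t (A4 w)))
     + (strace t (A4 w) / n%:R - m).
    by rewrite /markov_stieltjes /stieltjes -/(A1 w); ring.
  apply: (le_trans (ler_normD _ _)).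
  rewrite [leRHS]addrAC lerD2r.
  rewrite normrM ger0_norm ?invr_ge0 ?ler0n //.
  apply: (@le_trans _ _ (n%:R^-1 * (eps ^- 2 * D w / t +
    (al^-1 * (n%:R^-1 * Q w) + al * (t ^- 3 * n%:R)) + t^-1))).
    rewrite ler_wpM2l ?invr_ge0 ?ler0n //.
    apply: (le_trans (ler_normD _ _)); apply: lerD => //.
    by apply: (le_trans (ler_normD _ _)); apply: lerD.
  by rewrite le_eqVlt; apply/orP; left; apply/eqP; field; rewrite !gt_eqF.
apply: (le_trans (ler_Ew ffpd pw)).
rewrite !EwD !Ew_cst // !EwZ.
have hD : Ew pn D <= n%:R * (2%:R * (2%:R + v) / n%:R + 2%:R * eta ^+ 2).
  rewrite Ew_sum.
  under eq_bigr do rewrite (Ew_coord _ (fun r => (rho r / n%:R - 1) ^+ 2)) //.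
  by rewrite sumr_const card_ord -[leLHS]mulr_natl ler_pM2l.
have hQ : Ew pn Q <= n%:R ^+ 2 * (8%:R * eps ^+ 2 * (2%:R + v) + 2%:R * eta).
  pose f x := 8%:R * eps ^+ 2 * a x ^+ 2 + 2%:R * tl x.
  have -> : Ew pn Q = n%:R ^+ 2 * Ew p f.
    rewrite Ew_sum.
    under eq_bigr do rewrite (Ew_coord _ (fun r : row_sp => \sum_j f (r j))) // Ew_sum.
    under eq_bigr do under eq_bigr do rewrite (Ew_coord _ f) //.
    by rewrite !sumr_const card_ord -mulrnA -[LHS]mulr_natl natrM -expr2.
  rewrite ler_pM2l ?exprn_gt0 // /f EwD !EwZ lerD ?ler_pM2l ?mulr_gt0 ?exprn_gt0 //.
have hS := self_consistent t_gt0 pd n_gt0 y_mean (erefl s2) y_bnd v_ge0 lim_m be0.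
rewrite -/s2 in hS.
set ED := Ew pn D in hD *; set EQ := Ew pn Q in hQ *; set ES := Ew pn _ in hS *.
have c1 : n%:R^-1 * eps ^- 2 / t * ED <=
   (2%:R * (2%:R + v) / n%:R + 2%:R * eta ^+ 2) / (eps ^+ 2 * t).
  apply: (@le_trans _ _ (n%:R^-1 * eps ^- 2 / t *
    (n%:R * (2%:R * (2%:R + v) / n%:R + 2%:R * eta ^+ 2)))).
    by rewrite ler_wpM2l // !mulr_ge0 ?invr_ge0 ?sqr_ge0 ?ler0n // ltW.
  by rewrite le_eqVlt; apply/orP; left; apply/eqP; field; rewrite !gt_eqF.
have c2 : al^-1 * n%:R^-2 * EQ <= al^-1 * (8%:R * eps ^+ 2 * (2%:R + v) + 2%:R * eta).
  rewrite -mulrA ler_pM2l ?invr_gt0 //.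
  by rewrite mulrC ler_pdivrMr ?exprn_gt0 // mulrC.
have c3 : ES <= (be + 16%:R * L ^+ 4 / (n%:R * t ^+ 2 * be) + (2%:R + v) / (n%:R * t)
     + 10%:R * eta / t) / t.
  rewrite ler_pdivlMr // mulrC; apply: (le_trans hS).
  apply: lerD; last by rewrite ler_pM2r ?invr_gt0.
  by rewrite lerD2l ler_pM2r // invr_gt0 mulr_gt0.
have sum_le (x1 x2 x3 x1' x2' x3' z1 z2 : R) : x1 <= x1' -> x2 <= x2' -> x3 <= x3' ->
  x1 + x2 + x3 + (z1 + z2) <= x1' + x2' + z1 + z2 + x3' by lra.
exact: sum_le.
Qed.

End expectation.
End row_normalisation.

(** * Tail bounds uniform over finite laws *)

Section finite_tail.
Context {R : realType}.

Lemma div_nat_small (K x : R) : 0 < x ->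
  exists N, forall n, (N <= n)%N -> K / n%:R <= x.
Proof.
move=> x0; exists (Num.bound (`|K| / x)).+1 => n Nn.
have n0 : 0 < n%:R :> R by rewrite ltr0n; case: n Nn.
rewrite ler_pdivrMr // mulrC -ler_pdivrMr //.
apply: (@le_trans _ _ (`|K| / x)); first by rewrite ler_pM2r ?invr_gt0 // ler_norm.
have := archi_boundP (divr_ge0 (normr_ge0 K) (ltW x0)).
by move=> /ltW /le_trans; apply; rewrite ler_nat ltnW.
Qed.

(** One [e] covers the distance from the mean of [F] to [m]; the other is a deviation of [F] from
    its mean, to which Markov's inequality for fourth powers applies. *)
Lemma Ew_markov4 (W : finType) (q : W -> R) (F : W -> R) (e m K : R) : isdist q -> 0 < e ->
  Ew q (fun w => `|F w - m|) <= e ->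
  Ew q (fun w => (F w - Ew q F) ^+ 4) <= K ->
  Ew q (fun w => (e + e < `|F w - m|)%R%:R) <= K / e ^+ 4.
Proof.
move=> ffpd e0 h1 h2.
have h3 : `|Ew q F - m| <= e.
  rewrite -[m](Ew_cst ffpd) -EwB; exact: le_trans (Ew_norm ffpd _) h1.
rewrite ler_pdivlMr ?exprn_gt0 // -EwZr (le_trans _ h2)//.
apply: ler_Ew => // w; case: ltP => /= h; last first.
  by rewrite mul0r -[4%N]/(2 * 2)%N exprM sqr_ge0.
rewrite mul1r -[leRHS](@ger0_norm _); last by rewrite -[4%N]/(2 * 2)%N exprM sqr_ge0.
rewrite normrX ler_pXn2r ?nnegrE ?(ltW e0) //.
have := ler_normD (F w - Ew q F) (Ew q F - m).
by rewrite addrA subrK; lra.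
Qed.

Section concentration.
Context (t : R) (t_gt0 : 0 < t) (V : finType) (p a : V -> R) (pd : isdist p).
Context (n : nat) (n_gt0 : (0 < n)%N).
Local Notation mat_sp := {ffun 'I_n -> {ffun 'I_n -> V}}.
Local Notation pn := (fprod (fprod p) : mat_sp -> R).

Let F (w : mat_sp) := markov_stieltjes t (matval a w).

(** Normalisation acts within a row, so resampling a row of [X] changes just one row of the matrix,
    a rank-one perturbation. There are [n] coordinates with differences at most [1 / (n t)]. *)
Lemma markov_stieltjes_moment4 :
  Ew pn (fun w => (F w - Ew pn F) ^+ 4) <= 11%:R / t ^+ 4 / n%:R ^+ 2.
Proof.
have n0 : 0 < n%:R :> R by rewrite ltr0n.
have -> : 11%:R / t ^+ 4 / n%:R ^+ 2 = 11%:R * #|'I_n|%:R ^+ 2 * (n%:R * t)^-1 ^+ 4.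
  by rewrite card_ord; field; rewrite !gt_eqF.
apply: bounded_diff_moment4; first exact: isdist_fprod.
move=> w i r; rewrite /F /markov_stieltjes /stieltjes -mulrBl normrM.
rewrite [Num.norm n%:R^-1]ger0_norm ?invr_ge0 ?ler0n // invfM mulrC ler_pM2l ?invr_gt0 //.
apply: (strace_row t_gt0 (i0 := i)) => k j ki; rewrite !mxE.
have e l : matval a (upd w i r) k l = matval a w k l.
  by rewrite !mxE updE (negbTE ki).
by rewrite (eq_bigr _ (fun l _ => e l)) updE (negbTE ki).
Qed.

End concentration.

(** The order of quantifiers is the point: [L] will be read off the tail of the true law once [eta]
    is known, and [N] may depend on [L] but not on the finite law, which changes with [n]. *)
Theorem finite_law_tail (t v m e : R) : 0 < t -> 0 <= v ->
  is_limit_strace t v m -> 0 < e ->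
  exists2 eta, 0 < eta & forall L, 1 <= L -> exists N, forall n, (N <= n)%N ->
  forall (V : finType) (p a : V -> R), approx_law p a v L eta ->
  Ew (fprod (fprod p) : {ffun 'I_n -> {ffun 'I_n -> V}} -> R)
    (fun w => (e + e < `|markov_stieltjes t (matval a w) - m|)%R%:R) <=
  (11%:R / t ^+ 4 / e ^+ 4) / n%:R ^+ 2.
Proof.
move=> t0 v0 lim_m e0.
(* The parameters are tuned in turn to the terms of [markov_expectation]: [al] and [be] from [e],
   then [eps] from [al], then [eta] from both, and finally [n]. The bounds [c1] to [c5] add up to
   [14 e / 16]. *)
pose al := e * t ^+ 3 / 8%:R; pose be := t * e / 16%:R.
have al0 : 0 < al by rewrite divr_gt0 ?mulr_gt0.
have be0 : 0 < be by rewrite divr_gt0 ?mulr_gt0.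
have v2 : 0 < 2%:R + v by rewrite ltr_wpDr.
pose eps := Num.min 2^-1 (e * al / (64%:R * (2%:R + v))).
have k0 : 0 < e * al / (64%:R * (2%:R + v)).
  by apply: divr_gt0; apply: mulr_gt0.
have eps0 : 0 < eps by rewrite lt_min k0 andbT; lra.
have eps2 : eps <= 2^-1 by rewrite ge_min lexx.
have epse : eps <= e * al / (64%:R * (2%:R + v)) by rewrite ge_min lexx orbT.
have e2 : 0 < eps ^+ 2 by exact: exprn_gt0.
pose eta := Num.min 1 (Num.min (eps ^+ 2 * t * e / 16%:R)
  (Num.min (al * e / 16%:R) (e * t ^+ 2 / 160%:R))).
have eta0 : 0 < eta.
  rewrite !lt_min ltr01 /=; apply/and3P; split; apply: divr_gt0 => //.
  - exact: mulr_gt0 (mulr_gt0 e2 t0) e0.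
  - exact: mulr_gt0.
  - exact: mulr_gt0 e0 (exprn_gt0 2 t0).
have eta1 : eta <= 1 by rewrite ge_min lexx.
have eta2 : eta <= eps ^+ 2 * t * e / 16%:R by rewrite !ge_min lexx ?orbT.
have eta3 : eta <= al * e / 16%:R by rewrite !ge_min lexx ?orbT.
have eta4 : eta <= e * t ^+ 2 / 160%:R by rewrite !ge_min lexx ?orbT.
exists eta => // L L1.
have e16 : 0 < e / 16%:R by rewrite divr_gt0.
have [N1 hN1] := div_nat_small (2%:R * (2%:R + v) / (eps ^+ 2 * t)) e16.
have [N2 hN2] := div_nat_small (t^-1) e16.
have [N3 hN3] := div_nat_small (16%:R * L ^+ 4 / (t ^+ 3 * be)) e16.
have [N4 hN4] := div_nat_small ((2%:R + v) / t ^+ 2) e16.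
exists (N1 + N2 + N3 + N4).+1 => n Nn V p a law.
have [n1 n2 n3 n4] : [/\ N1 <= n, N2 <= n, N3 <= n & N4 <= n]%N by clear -Nn; split; lia.
have n0 : (0 < n)%N by exact: leq_ltn_trans Nn.
have npos : 0 < n%:R :> R by rewrite ltr0n.
have pd : isdist p by case: law.
have -> : 11%:R / t ^+ 4 / e ^+ 4 / n%:R ^+ 2 = 11%:R / t ^+ 4 / n%:R ^+ 2 / e ^+ 4.
  by rewrite mulrAC.
apply: Ew_markov4 => //; [by do 2 apply: isdist_fprod| |]; last exact: markov_stieltjes_moment4.
apply: (le_trans (markov_expectation t0 law v0 L1 eta1 lim_m n0 al0 eps0 eps2 be0)).
have c1 : (2%:R * (2%:R + v) / n%:R + 2%:R * eta ^+ 2) / (eps ^+ 2 * t) <= e / 16%:R + e / 8%:R.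
  rewrite mulrDl; apply: lerD.
    by apply: le_trans (hN1 _ n1); rewrite mulrAC.
  rewrite ler_pdivrMr ?mulr_gt0 //.
  have h : eta ^+ 2 <= eta by rewrite expr2 ler_piMl // ltW.
  lra.
have c2 : al^-1 * (8%:R * eps ^+ 2 * (2%:R + v) + 2%:R * eta) <= e / 8%:R + e / 8%:R.
  rewrite mulrC ler_pdivrMr //.
  have e1 : eps ^+ 2 <= eps by rewrite expr2 ler_piMl ?(ltW eps0) //; lra.
  move: epse; rewrite ler_pdivlMr ?mulr_gt0 // => epse.
  have := ler_wpM2r (ltW v2) e1; lra.
have c3 : al / t ^+ 3 = e / 8%:R by rewrite /al; field; rewrite gt_eqF.
have c4 : (n%:R * t)^-1 <= e / 16%:R.
  by apply: le_trans (hN2 _ n2); rewrite invfM mulrC.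
have c5 : (be + 16%:R * L ^+ 4 / (n%:R * t ^+ 2 * be) + (2%:R + v) / (n%:R * t)
     + 10%:R * eta / t) / t <= e / 16%:R + e / 16%:R + e / 16%:R + e / 16%:R.
  rewrite mulrDl [X in X + _ <= _]mulrDl [X in X + _ + _ <= _]mulrDl.
  apply: lerD; [apply: lerD; [apply: lerD|]|].
  - by rewrite /be le_eqVlt; apply/orP; left; apply/eqP; field; rewrite gt_eqF.
  - apply: le_trans (hN3 _ n3); rewrite le_eqVlt; apply/orP; left; apply/eqP; field.
    by rewrite !gt_eqF.
  - apply: le_trans (hN4 _ n4); rewrite le_eqVlt; apply/orP; left; apply/eqP; field.
    by rewrite !gt_eqF.
  - have -> : 10%:R * eta / t / t = 10%:R * eta / t ^+ 2 by field; rewrite gt_eqF.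
    rewrite ler_pdivrMr ?exprn_gt0 //; move: eta4; lra.
lra.
Qed.

End finite_tail.

(** * Weak convergence from Stieltjes transforms *)

Section weierstrass.
Context {R : realType}.

Lemma heine_cantor (h : R -> R) (e : R) : continuous h -> 0 < e ->
  exists2 d, 0 < d & forall x y, 0 <= x <= 1 -> `|x - y| <= d -> `|h x - h y| <= e.
Proof.
move=> hc e0.
have /compact_near_coveringP cov := @segment_compact R 0 1.
have : \forall d \near 0^'+, forall x, `[0, 1]%classic x ->
    forall y, `|x - y| <= d -> `|h x - h y| <= e.
  apply: (cov _ (0^'+) (fun d x => forall y, `|x - y| <= d -> `|h x - h y| <= e)).
  move=> x _.
  have e2 : 0 < e / 2 by rewrite divr_gt0.
  have /cvgrPdist_le/(_ _ e2) := hc x.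
  move=> /nbhs_ballP[r /= r0 hr].
  have r2 : 0 < r / 2 by rewrite divr_gt0.
  exists (ball x (r / 2), [set d | d < r / 2]) => /=.
    split; first exact: nbhsx_ballx.
    exact: nbhs_right_lt.
  move=> [x' d] /= [xx' dr] y x'y.
  rewrite /ball /= in xx'.
  have hx' : `|h x - h x'| <= e / 2.
    by apply: hr; rewrite /ball /=; lra.
  have hy : `|h x - h y| <= e / 2.
    apply: hr; rewrite /ball /= -(subrKA x') (le_lt_trans (ler_normD _ _)) //.
    lra.
  rewrite -(subrKA (h x)) (le_trans (ler_normD _ _)) // distrC; lra.
move=> hd; have [d [/= hd1 d0]] := filter_ex (filterI hd (nbhs_right_gt (0 : R))).
by exists d => // x y x01; apply: hd1; rewrite /= in_itv.
Qed.

(** Bernstein's proof: the polynomial is the expectation of [h] at the mean [S] of [n] tosses of a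
    coin of bias [x]. Summing over all outcomes, rather than over binomial coefficients, makes the
    product-space lemmas available. Chebyshev handles [|x - S| > d]. *)
Lemma weierstrass (h : R -> R) (K e : R) : continuous h ->
  (forall x, `|h x| <= K) -> 0 < e ->
  exists q : {poly R}, forall x, 0 <= x <= 1 -> `|h x - q.[x]| <= e.
Proof.
move=> hc hK e0.
have e2 : 0 < e / 2%:R by rewrite divr_gt0.
have [d d0 hd] := heine_cantor hc e2.
have K0 : 0 <= K by exact: le_trans (hK 0).
have [N hN] := div_nat_small (2%:R * K / d ^+ 2) e2.
pose n := N.+1.
pose p x (b : bool) : R := if b then x else 1 - x.
pose S (w : {ffun 'I_n -> bool}) : R := \sum_(i < n) n%:R^-1 * (w i)%:R.
exists (\sum_(w : {ffun 'I_n -> bool})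
   (\prod_i (if w i then 'X else 1 - 'X)) * (h (S w))%:P) => x x01.
have -> : (\sum_(w : {ffun 'I_n -> bool})
   (\prod_i (if w i then 'X else 1 - 'X)) * (h (S w))%:P).[x] =
   Ew (fprod (p x)) (fun w => h (S w)).
  rewrite horner_sum; apply: eq_bigr => w _.
  rewrite hornerM hornerC horner_prod; congr (_ * _); apply: eq_bigr => i _.
  by rewrite /p; case: (w i); rewrite !hornerE.
have pd : isdist (p x).
  case/andP: x01 => ? ?; split; last by rewrite big_bool /p /=; lra.
  by case; rewrite /p; lra.
have fpd : isdist (fprod (p x) : {ffun 'I_n -> bool} -> R) by exact: isdist_fprod.
rewrite -[X in `|X - _|](Ew_cst fpd) -EwB (le_trans (Ew_norm fpd _)) //.
pose z (b : bool) : R := b%:R - x.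
have z0 : Ew (p x) z = 0 by rewrite /Ew big_bool /p /z /=; ring.
have Sz w : S w - x = \sum_(i < n) n%:R^-1 * z (w i).
  rewrite /z; under [RHS]eq_bigr do rewrite mulrBr.
  rewrite sumrB sumr_const card_ord -[(_ * x) *+ n]mulr_natl mulrA divff ?mul1r //.
  by rewrite gt_eqF.
have d2 : 0 < d ^+ 2 by exact: exprn_gt0.
apply: (@le_trans _ _ (Ew (fprod (p x)) (fun w : {ffun 'I_n -> bool} =>
   e / 2%:R + 2%:R * K / d ^+ 2 * (\sum_(i < n) n%:R^-1 * z (w i)) ^+ 2))).
  apply: ler_Ew => // w; rewrite -Sz.
  have [le|lt] := lerP `|x - S w| d.
    apply: (le_trans (hd _ _ x01 le)); rewrite lerDl mulr_ge0 ?sqr_ge0 //.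
    by rewrite divr_ge0 ?mulr_ge0 // ltW.
  apply: (@le_trans _ _ (2%:R * K)).
    by have := ler_normB (h x) (h (S w)); have := hK x; have := hK (S w); lra.
  rewrite -[leLHS]add0r lerD ?(ltW e2) //.
  rewrite -mulrA ler_peMr ?mulr_ge0 // mulrC ler_pdivlMr // mul1r.
  rewrite -[leRHS]real_normK ?num_real // distrC ler_pXn2r ?nnegrE //; exact: ltW.
rewrite EwD Ew_cst // EwZ Ew_lin_sqr // sumr_const card_ord.
have v1 : Ew (p x) (fun b => z b ^+ 2) <= 1.
  rewrite /Ew big_bool /p /z /=; case/andP: x01 => ? ?; nra.
have -> : n%:R^-1 ^+ 2 *+ n = n%:R^-1 :> R.
  by rewrite -[LHS]mulr_natl expr2 mulrA divff ?mul1r // gt_eqF.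
have h1 : 2%:R * K / d ^+ 2 / n%:R <= e / 2%:R by apply: hN.
have h2 : 2%:R * K / d ^+ 2 * (n%:R^-1 * Ew (p x) (fun b => z b ^+ 2)) <=
   2%:R * K / d ^+ 2 / n%:R.
  rewrite mulrA ler_piMr // !mulr_ge0 ?invr_ge0 ?ler0n ?(ltW d2) //.
lra.
Qed.

End weierstrass.

Section stieltjes_criterion.
Context {R : realType}.
Implicit Types (f g : R -> R) (L : (R -> R) -> R) (t : R).

Definition bcont f := continuous f /\ exists K, forall x, `|f x| <= K.

Lemma bcont_cst c : bcont (fun=> c).
Proof. by split; [move=> x; exact: cvg_cst | exists `|c|]. Qed.

Lemma bcontD f g : bcont f -> bcont g -> bcont (fun x => f x + g x).
Proof.
move=> [fc [K fK]] [gc [M gM]]; split; first by move=> x; apply: cvgD; [exact: fc|exact: gc].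
by exists (K + M) => x; rewrite (le_trans (ler_normD _ _)) // lerD.
Qed.

Lemma bcontM f g : bcont f -> bcont g -> bcont (fun x => f x * g x).
Proof.
move=> [fc [K fK]] [gc [M gM]]; split; first by move=> x; apply: cvgM; [exact: fc|exact: gc].
by exists (K * M) => x; rewrite normrM ler_pM.
Qed.

Lemma bcontX f n : bcont f -> bcont (fun x => f x ^+ n).
Proof.
move=> fb; elim: n => [|n IH]; first exact: bcont_cst.
by under eq_fun do rewrite exprS; exact: bcontM.
Qed.

Lemma bcontZ c f : bcont f -> bcont (fun x => c * f x).
Proof. by move=> fb; apply: bcontM => //; exact: bcont_cst. Qed.

Lemma bcontB f g : bcont f -> bcont g -> bcont (fun x => f x - g x).
Proof.
move=> fb gb; under eq_fun do rewrite -mulN1r.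
by apply: bcontD => //; exact: bcontZ.
Qed.

(* A mean over the half-line: values of functions at negative points are
   irrelevant. *)
Record is_mean L : Prop := IsMean {
  mean_lin : forall a f g, bcont f -> bcont g ->
    L (fun x => a * f x + g x) = a * L f + L g;
  mean_le : forall f g, bcont f -> bcont g ->
    (forall x, 0 <= x -> f x <= g x) -> L f <= L g;
  mean_1 : L (fun=> 1) = 1 }.

Section one_mean.
Context L (mL : is_mean L).

Lemma mean0 : L (fun=> 0) = 0.
Proof.
have := mean_lin mL (-1) (bcont_cst 1) (bcont_cst 1).
rewrite mean_1 // => h; transitivity (-1 * 1 + 1 : R); last by ring.
by rewrite -h; congr L; apply/funext => x; ring.
Qed.

Lemma meanZ a f : bcont f -> L (fun x => a * f x) = a * L f.
Proof.
move=> fb; have := mean_lin mL a fb (bcont_cst 0); rewrite mean0 addr0.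
by move=> <-; congr L; apply/funext => x; rewrite addr0.
Qed.

Lemma meanD f g : bcont f -> bcont g -> L (fun x => f x + g x) = L f + L g.
Proof.
move=> fb gb; have := mean_lin mL 1 fb gb; rewrite mul1r.
by move=> <-; congr L; apply/funext => x; rewrite mul1r.
Qed.

Lemma meanB f g : bcont f -> bcont g -> L (fun x => f x - g x) = L f - L g.
Proof.
move=> fb gb; have := mean_lin mL (-1) gb fb; rewrite mulN1r addrC => <-.
by congr L; apply/funext => x; rewrite mulN1r addrC.
Qed.

Lemma mean_cst c : L (fun=> c) = c.
Proof.
transitivity (L (fun=> c * 1)); first by rewrite mulr1.
by rewrite (meanZ c (bcont_cst 1)) mean_1 // mulr1.
Qed.

Lemma mean_norm_le f g : bcont f -> bcont g ->
  (forall x, 0 <= x -> `|f x| <= g x) -> `|L f| <= L g.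
Proof.
move=> fb gb fg; rewrite ler_norml; apply/andP; split; last first.
  by apply: mean_le => // x x0; rewrite (le_trans (ler_norm _)) // fg.
rewrite -mulN1r -meanZ //; apply: mean_le => //; first exact: bcontZ.
by move=> x x0; rewrite mulN1r; have := fg x x0; rewrite ler_norml => /andP[]; lra.
Qed.

Lemma mean_close f g e : bcont f -> bcont g ->
  (forall x, 0 <= x -> `|f x - g x| <= e) -> `|L f - L g| <= e.
Proof.
move=> fb gb fg; rewrite -meanB // -[leRHS]mean_cst.
by apply: mean_norm_le => //; [exact: bcontB | exact: bcont_cst].
Qed.

End one_mean.

Definition res t (x : R) : R := (x ^+ 2 + t)^-1.

Lemma res_den t (x : R) : 0 < t -> 0 < x ^+ 2 + t.
Proof. by move=> t0; rewrite ltr_wpDl ?sqr_ge0. Qed.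

Lemma res_gt0 t x : 0 < t -> 0 < res t x.
Proof. by move=> t0; rewrite invr_gt0 res_den. Qed.

Lemma res_le t x : 0 < t -> res t x <= t^-1.
Proof. by move=> t0; rewrite lef_pV2 ?posrE ?res_den // lerDr sqr_ge0. Qed.

Lemma bcont_res t : 0 < t -> bcont (res t).
Proof.
move=> t0; split; last first.
  by exists t^-1 => x; rewrite ger0_norm ?res_le // ltW // res_gt0.
move=> x; apply: cvgV; first by rewrite gt_eqF // res_den.
by apply: cvgD; [exact: exprn_continuous | exact: cvg_cst].
Qed.

Lemma resB t s x : 0 < t -> 0 < s -> res t x - res s x = (s - t) * (res t x * res s x).
Proof.
move=> t0 s0; rewrite /res; field.
by rewrite !gt_eqF ?res_den.
Qed.

Section limit.
Context (Ln : nat -> (R -> R) -> R) (L : (R -> R) -> R).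
Context (mLn : forall n, is_mean (Ln n)) (mL : is_mean L).

Definition meanlim f := forall e, 0 < e ->
  exists N, forall n, (N <= n)%N -> `|Ln n f - L f| <= e.

Lemma meanlim_cst c : meanlim (fun=> c).
Proof. by move=> e e0; exists 0%N => n _; rewrite !mean_cst // subrr normr0 ltW. Qed.

Lemma meanlimD f g : bcont f -> bcont g -> meanlim f -> meanlim g ->
  meanlim (fun x => f x + g x).
Proof.
move=> fb gb fl gl e e0; have e2 : 0 < e / 2%:R by rewrite divr_gt0.
have [N hN] := fl _ e2; have [M hM] := gl _ e2; exists (N + M)%N => n nNM.
have := hN n (leq_trans (leq_addr _ _) nNM); have := hM n (leq_trans (leq_addl _ _) nNM).
rewrite !meanD // !ler_norml => /andP[? ?] /andP[? ?]; apply/andP; split; lra.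
Qed.

Lemma meanlimZ c f : bcont f -> meanlim f -> meanlim (fun x => c * f x).
Proof.
move=> fb fl e e0; have c0 : 0 < `|c| + 1 by rewrite ltr_wpDl.
have [N hN] := fl _ (divr_gt0 e0 c0); exists N => n nN.
rewrite !meanZ // -mulrBr normrM (@le_trans _ _ ((`|c| + 1) * `|Ln n f - L f|)) //.
  by rewrite ler_wpM2r // lerDl.
by have := hN n nN; rewrite ler_pdivlMr // mulrC.
Qed.

Lemma meanlimB f g : bcont f -> bcont g -> meanlim f -> meanlim g ->
  meanlim (fun x => f x - g x).
Proof.
move=> fb gb fl gl; under eq_fun do rewrite -mulN1r.
by apply: meanlimD => //; [exact: bcontZ | exact: meanlimZ].
Qed.

Lemma meanlim_approx f : bcont f ->
  (forall e, 0 < e -> exists g, [/\ bcont g, meanlim g &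
     forall x, 0 <= x -> `|f x - g x| <= e]) -> meanlim f.
Proof.
move=> fb app e e0; have e3 : 0 < e / 3%:R by rewrite divr_gt0.
have [g [gb gl fg]] := app _ e3; have [N hN] := gl _ e3; exists N => n nN.
have := hN n nN; have := mean_close mL fb gb fg; have := mean_close (mLn n) fb gb fg.
rewrite !ler_norml => /andP[? ?] /andP[? ?] /andP[? ?]; apply/andP; split; lra.
Qed.

Context (lim_rat : forall q : rat, 0 < q -> meanlim (res (ratr q))).

Lemma meanlim_res t : 0 < t -> meanlim (res t).
Proof.
move=> t0; apply: meanlim_approx; first exact: bcont_res.
move=> e e0; have t2 : 0 < t ^+ 2 by exact: exprn_gt0.
(* Since [t < q], the two functions differ by at most [(q - t) / t^2]. *)
have : t < t + e * t ^+ 2 by rewrite ltrDl mulr_gt0.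
move=> /rat_in_itvoo [q]; rewrite in_itv /= => /andP[tq qt].
have q0 : 0 < ratr q :> R by exact: lt_trans tq.
exists (res (ratr q)); split; first exact: bcont_res.
  by apply: lim_rat; rewrite -(ltr0q R).
move=> x _; rewrite resB // normrM ger0_norm ?subr_ge0 ?(ltW tq) //.
rewrite ger0_norm ?mulr_ge0 ?(ltW (res_gt0 _ _)) //.
apply: (@le_trans _ _ (e * t ^+ 2 * (t^-1 * t^-1))).
  apply: ler_pM; rewrite ?subr_ge0 ?mulr_ge0 ?(ltW (res_gt0 _ _)) ?(ltW tq) //.
    by rewrite lerBlDl ltW.
  apply: ler_pM; rewrite ?(ltW (res_gt0 _ _)) ?res_le //.
  by rewrite (le_trans (res_le _ q0)) // lef_pV2 ?posrE // ltW.
by rewrite le_eqVlt; apply/orP; left; apply/eqP; field; rewrite gt_eqF.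
Qed.

Lemma exprB_bounds (a b : R) m : 0 <= b -> b <= a ->
  m.+1%:R * (a - b) * b ^+ m <= a ^+ m.+1 - b ^+ m.+1 <= m.+1%:R * (a - b) * a ^+ m.
Proof.
move=> b0 ba; have a0 := le_trans b0 ba; have ab : 0 <= a - b by rewrite subr_ge0.
rewrite subrXX [m.+1%:R * _]mulrC -!mulrA !ler_wpM2l //=; last first.
- rewrite -[m.+1 in leLHS]card_ord mulr_natl -sumr_const; apply: ler_sum => i _ /=.
  rewrite -[in leLHS](subnK (ltn_ord i : (i <= m)%N)) exprD.
  by apply: ler_pM; rewrite ?exprn_ge0 // lerXn2r // nnegrE.
- rewrite -[m.+1 in leRHS]card_ord mulr_natl -sumr_const; apply: ler_sum => i _ /=.
  rewrite -[in leRHS](subnK (ltn_ord i : (i <= m)%N)) exprD.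
  by apply: ler_pM; rewrite ?exprn_ge0 // lerXn2r // nnegrE.
Qed.

(* [res t ^+ m.+2] is, up to a factor, the uniform limit of the difference
   quotients in [t] of [res t ^+ m.+1]. *)
Lemma meanlim_resX m t : 0 < t -> meanlim (fun x => res t x ^+ m.+1).
Proof.
elim: m t => [|m IH] t t0.
  by under eq_fun do rewrite expr1; exact: meanlim_res.
apply: meanlim_approx; first by apply: bcontX; exact: bcont_res.
move=> e e0; have t2 : 0 < t ^+ m.+3 by exact: exprn_gt0.
(* With [a - b = h a b] and [a, b <= 1 / t], the error is at most [a^(m+2) - b^(m+2) <= (m+2) (a -
   b) a^(m+1) <= (m+2) h / t^(m+3)], which this [h] makes equal to [e]. *)
pose h := e * t ^+ m.+3 / m.+2%:R.
have h0 : 0 < h by apply: divr_gt0; [exact: mulr_gt0 | rewrite ltr0n].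
have th0 : 0 < t + h by rewrite addr_gt0.
have bX s k : 0 < s -> bcont (fun x => res s x ^+ k) by move=> ?; apply/bcontX/bcont_res.
exists (fun x => (m.+1%:R * h)^-1 * (res t x ^+ m.+1 - res (t + h) x ^+ m.+1)).
have bB := bcontB (bX _ m.+1 t0) (bX _ m.+1 th0).
split; first exact: bcontZ.
  apply: meanlimZ => //; apply: meanlimB; [exact: bX|exact: bX|exact: IH|exact: IH].
move=> x _; set a := res t x; set b := res (t + h) x.
have a0 : 0 < a by exact: res_gt0.
have b0 : 0 < b by exact: res_gt0.
have abE : a - b = h * (a * b) by rewrite /a /b resB // addrC addKr.
have ab : b <= a by rewrite -subr_ge0 abE ltW // mulr_gt0 // mulr_gt0.
have /andP[l1 l2] := exprB_bounds m (ltW b0) ab.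
have m1 : 0 < m.+1%:R * h by rewrite mulr_gt0 // ltr0n.
have g1 : b ^+ m.+2 <= (m.+1%:R * h)^-1 * (a ^+ m.+1 - b ^+ m.+1).
  rewrite mulrC ler_pdivlMr //; apply: le_trans l1.
  rewrite abE; have -> : m.+1%:R * (h * (a * b)) * b ^+ m = a * b * b ^+ m * (m.+1%:R * h) by ring.
  rewrite ler_pM2r // exprS exprS mulrA ler_pM2r ?exprn_gt0 // ler_pM2r //.
have g2 : (m.+1%:R * h)^-1 * (a ^+ m.+1 - b ^+ m.+1) <= a ^+ m.+2.
  rewrite mulrC ler_pdivrMr //; apply: (le_trans l2).
  rewrite abE; have -> : m.+1%:R * (h * (a * b)) * a ^+ m = a * b * a ^+ m * (m.+1%:R * h) by ring.
  rewrite ler_pM2r // exprS exprS mulrA ler_pM2r ?exprn_gt0 // ler_pM2l //.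
have /andP[_ l3] := exprB_bounds m.+1 (ltW b0) ab.
rewrite ger0_norm ?subr_ge0 //.
apply: (@le_trans _ _ (m.+2%:R * (a - b) * a ^+ m.+1)).
  by apply: le_trans l3; rewrite lerD2l lerN2.
have -> : m.+2%:R * (a - b) * a ^+ m.+1 = m.+2%:R * h * (a ^+ m.+2 * b).
  by rewrite abE [a ^+ m.+2]exprS; ring.
have -> : e = m.+2%:R * h * (t^-1 ^+ m.+2 * t^-1).
  rewrite /h -exprSr exprVn; have : m.+2%:R != 0 :> R by rewrite pnatr_eq0.
  move: (lt0r_neq0 t2); move: (t ^+ _) (m.+2%:R) => T N T0 N0.
  by field; rewrite N0 T0.
have m2h : 0 < m.+2%:R * h by apply: mulr_gt0 h0; rewrite ltr0n.
rewrite ler_pM2l //; apply: ler_pM; rewrite ?exprn_ge0 ?(ltW a0) ?(ltW b0) //.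
  by apply: lerXn2r; [rewrite nnegrE ltW | rewrite nnegrE invr_ge0 ltW | exact: res_le].
by rewrite (le_trans (res_le _ th0)) // lef_pV2 ?posrE // lerDl ltW.
Qed.

Lemma bcont_poly (q : {poly R}) : bcont (fun x => q.[res 1 x]).
Proof.
elim/poly_ind: q => [|q c IH].
  by under eq_fun do rewrite horner0; exact: bcont_cst.
under eq_fun do rewrite hornerMXaddC.
apply: bcontD; last exact: bcont_cst.
by apply: bcontM => //; exact: bcont_res.
Qed.

Lemma meanlim_poly (q : {poly R}) : meanlim (fun x => q.[res 1 x]).
Proof.
rewrite (_ : (fun x => _) = fun x => \sum_(i < size q) q`_i * res 1 x ^+ i); last first.
  by apply/funext => x; rewrite horner_coef.
have b i : bcont (fun x => q`_i * res 1 x ^+ i) by apply/bcontZ/bcontX/bcont_res.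
suff [] : meanlim (fun x => \sum_(i < size q) q`_i * res 1 x ^+ i) /\
  bcont (fun x => \sum_(i < size q) q`_i * res 1 x ^+ i) by [].
elim: (size q) => [|n [IH1 IH2]].
  by under eq_fun do rewrite big_ord0; split; [exact: meanlim_cst | exact: bcont_cst].
under eq_fun do rewrite big_ord_recr /=.
split; last exact: bcontD.
apply: meanlimD => //; apply: meanlimZ; first exact/bcontX/bcont_res.
by case: n {IH1 IH2} => [|n]; [exact: meanlim_cst | exact: meanlim_resX].
Qed.

Context (b : R) (b_ge0 : 0 <= b).
Context (L_supp : forall f, bcont f -> (forall x, 0 <= x <= b -> f x = 0) -> L f = 0).

Let M := 1 + b ^+ 2.
Let M_gt0 : 0 < M. Proof. by rewrite ltr_wpDr ?sqr_ge0. Qed.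

(** [M] is [1 / res 1 b], so that [cutoff (res 1 x)] equals [1] on [[0, b]] and is of order [x^-2]
    at infinity. *)
Definition cutoff (u : R) := Num.min 1 (M * u).

Lemma cutoff_cont : continuous cutoff.
Proof.
move=> u; apply: continuous_min; first exact: cvg_cst.
by apply: cvgM; [exact: cvg_cst | exact: cvg_id].
Qed.

Lemma res1_bnd x : 0 < res 1 x <= 1.
Proof. by rewrite res_gt0 // -[leRHS]invr1 res_le. Qed.

Lemma bcont_cutoff : bcont (fun x => cutoff (res 1 x)).
Proof.
split.
  move=> x; apply: continuous_comp; first by case: (bcont_res ltr01) => c _; exact: c.
  exact: cutoff_cont.
exists 1 => x; rewrite ger0_norm /cutoff ?ge_min ?lexx // le_min ler01 /=.
by rewrite mulr_ge0 ?(ltW M_gt0) // ltW // res_gt0.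
Qed.

Lemma cutoff_supp x : 0 <= x <= b -> cutoff (res 1 x) = 1.
Proof.
case/andP=> x0 xb; apply/min_idPl; rewrite /res ler_pdivlMr ?res_den // mul1r /M addrC.
by rewrite lerD2l ler_pXn2r ?nnegrE.
Qed.

(** In the variable [u = res 1 x], a bounded continuous [f] need not extend continuously to [u = 0],
    that is, to [x] infinite. The cutoff, of order [u] there, forces the limit [0], and Weierstrass
    applies on [[0, 1]]. *)
Lemma meanlim_cutoff f : bcont f -> meanlim (fun x => f x * cutoff (res 1 x)).
Proof.
move=> fb; have [fc [K fK]] := fb.
have K0 : 0 <= K by exact: le_trans (fK 0).
(* On [x >= 0] the map [sqrt (1 / u - 1)] inverts [u = res 1 x]. The maximum makes [h] vanish for
   [u <= 0], so it is continuous on the whole line. *)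
pose h u := f (Num.sqrt (u^-1 - 1)) * cutoff (Num.max 0 u).
have cut0 u : 0 <= cutoff (Num.max 0 u) <= 1.
  rewrite /cutoff ge_min lexx le_min ler01 /= andbT mulr_ge0 ?(ltW M_gt0) //.
  by rewrite le_max lexx.
have hK u : `|h u| <= K.
  have /andP[c0 c1] := cut0 u; rewrite /h normrM (ger0_norm c0) -[leRHS]mulr1.
  by apply: ler_pM.
have hlin u : `|h u| <= K * M * `|u|.
  have /andP[c0 _] := cut0 u; rewrite /h normrM (ger0_norm c0) -mulrA.
  apply: ler_pM => //; rewrite (@le_trans _ _ (M * Num.max 0 u)) //.
    by rewrite ge_min lexx orbT.
  by rewrite ler_pM2l // ge_max normr_ge0 ler_norm.
have hc : continuous h.
  move=> u; have [->|u0] := eqVneq u 0.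
    have h0 : h 0 = 0 by apply/eqP; rewrite -normr_le0 (le_trans (hlin 0)) // normr0 mulr0.
    apply/cvgrPdist_le => e e0; rewrite h0.
    have KM : 0 < K * M + 1 by rewrite ltr_wpDl // mulr_ge0 // ltW.
    have d0 : 0 < e / (K * M + 1) by exact: divr_gt0.
    exists (e / (K * M + 1)) => //= y; rewrite /ball /= !sub0r !normrN => yd.
    rewrite (le_trans (hlin y)) // (@le_trans _ _ ((K * M + 1) * `|y|)) //.
      by rewrite ler_wpM2r // lerDl.
    by rewrite mulrC -ler_pdivlMr // ltW.
  apply: cvgM.
    apply: (@cvg_comp _ _ _ (fun u => Num.sqrt (u^-1 - 1)) f); last exact: fc.
    apply: (@cvg_comp _ _ _ (fun u => u^-1 - 1) (@Num.sqrt R)); last exact: sqrt_continuous.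
    by apply: cvgB; [exact: cvgV | exact: cvg_cst].
  apply: (@cvg_comp _ _ _ (Num.max 0) cutoff); last exact: cutoff_cont.
  have mc : {for u, continuous (fun z : R => Num.max 0 z)}.
    by apply: continuous_max; [exact: cvg_cst | exact: cvg_id].
  exact: mc.
have fcb : bcont (fun x => f x * cutoff (res 1 x)) by apply: bcontM => //; exact: bcont_cutoff.
apply: meanlim_approx => // e e0.
have [q hq] := weierstrass hc hK e0.
exists (fun x => q.[res 1 x]); split; [exact: bcont_poly | exact: meanlim_poly |].
move=> x x0; have /andP[r0 r1] := res1_bnd x.
have -> : f x * cutoff (res 1 x) = h (res 1 x); last by apply: hq; rewrite ltW.
rewrite /h (max_idPr (ltW r0)); congr (f _ * _).
by rewrite /res invrK addrK sqrtr_sqr ger0_norm.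
Qed.

(** Tightness is derived, not assumed: [1 - c] is itself a test function for which convergence is
    known, and its limit mean is [0] because [c = 1] on the support. The part [f (1 - c)] is
    dominated by [K (1 - c)]. *)
Theorem mean_weak_limit f : bcont f -> meanlim f.
Proof.
move=> fb e e0; have [_ [K fK]] := fb.
have K0 : 0 <= K by exact: le_trans (fK 0).
pose c x := cutoff (res 1 x).
have cb : bcont c by exact: bcont_cutoff.
have c01 x : 0 <= c x <= 1.
  rewrite /c /cutoff ge_min lexx le_min ler01 /= andbT mulr_ge0 ?(ltW M_gt0) //.
  by rewrite ltW // res_gt0.
have ocb : bcont (fun x => 1 - c x) by apply: bcontB => //; exact: bcont_cst.
have fcb : bcont (fun x => f x * c x) by exact: bcontM.
have focb : bcont (fun x => f x * (1 - c x)) by exact: bcontM.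
have fE : f = (fun x => f x * c x + f x * (1 - c x)).
  by apply/funext => x; ring.
have Lfo : L (fun x => f x * (1 - c x)) = 0.
  by apply: L_supp => // x xb; rewrite /c cutoff_supp // subrr mulr0.
have Lo : L (fun x => 1 - c x) = 0.
  by apply: L_supp => // x xb; rewrite /c cutoff_supp // subrr.
have ol : meanlim (fun x => 1 - c x).
  apply: meanlimB => //; [exact: bcont_cst | exact: meanlim_cst |].
  have := meanlim_cutoff (bcont_cst 1).
  by under eq_fun do rewrite mul1r.
have K1 : 0 < 2%:R * (K + 1) by rewrite mulr_gt0 // ltr_wpDl.
have [N1 hN1] := ol _ (divr_gt0 e0 K1).
have [N2 hN2] := meanlim_cutoff fb (divr_gt0 e0 (ltr0n R 2)).
exists (N1 + N2)%N => n nN.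
have n1 : (N1 <= n)%N by exact: leq_trans (leq_addr _ _) nN.
have n2 : (N2 <= n)%N by exact: leq_trans (leq_addl _ _) nN.
rewrite fE !meanD // Lfo addr0 addrAC (le_trans (ler_normD _ _)) //.
have := hN2 n n2; rewrite -/c => h2.
have h3 : `|Ln n (fun x => f x * (1 - c x))| <= K * Ln n (fun x => 1 - c x).
  rewrite -meanZ //; apply: mean_norm_le => //; first exact: bcontZ.
  move=> x _; have /andP[? ?] := c01 x.
  by rewrite normrM [X in _ * X]ger0_norm ?subr_ge0 // ler_wpM2r ?subr_ge0.
have := hN1 n n1; rewrite Lo subr0 => h4.
have h5 : K * Ln n (fun x => 1 - c x) <= e / 2%:R.
  apply: (@le_trans _ _ ((K + 1) * (e / (2%:R * (K + 1))))).
    apply: ler_pM => //; rewrite ?lerDl //.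
      by rewrite -(mean0 (mLn n)); apply: mean_le => //;
        [exact: bcont_cst | move=> x _; rewrite subr_ge0; case/andP: (c01 x)].
    by rewrite (le_trans (ler_norm _)).
  rewrite le_eqVlt; apply/orP; left; apply/eqP; field.
  by rewrite gt_eqF // ltr_wpDl.
lra.
Qed.

End limit.
End stieltjes_criterion.

(** * The Stieltjes transform of the quartercircular law *)

(* [phi] will be the identity of the reals, between the two Borel measurable
   structures of the library; it would be superfluous otherwise. *)
Section density.
Local Open Scope ereal_scope.
Context d1 d2 (T1 : measurableType d1) (T2 : measurableType d2) (R : realType).
Context (phi : T1 -> T2) (mphi : measurable_fun setT phi).
Context (mu : {measure set T1 -> \bar R}) (nu : {measure set T2 -> \bar R}).
Context (g : T1 -> R) (mg : measurable_fun setT g) (g0 : forall x, (0 <= g x)%R).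
Context (nuE : forall V, measurable V ->
  nu V = \int[mu]_(x in phi @^-1` V) (g x)%:E).
Import HBNNSimple.

Let mgE : measurable_fun setT (EFin \o g). Proof. exact/measurable_EFinP. Qed.

Let density_nnsfun (h : {nnsfun T2 >-> R}) :
  \int[nu]_x (h x)%:E = \int[mu]_x ((h (phi x))%:E * (g x)%:E).
Proof.
under [LHS]eq_integral do rewrite fimfunE -fsumEFin//.
rewrite [LHS]ge0_integral_fsum//; last 2 first.
  - by move=> r; exact/measurable_EFinP/measurableT_comp.
  - by move=> n x _; rewrite EFinM nnfun_muleindic_ge0.
under [RHS]eq_integral.
  move=> x xD; rewrite fimfunE -fsumEFin// ge0_mule_fsuml; last first.
    by move=> r; rewrite EFinM nnfun_muleindic_ge0.
  over.
have mh (r : R) : measurable_fun setT (fun x => (r * \1_(h @^-1` [set r]) (phi x))%:E).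
  apply/measurable_EFinP; apply: measurable_funM => //.
  by apply: (measurableT_comp _ mphi); exact: measurable_indic.
rewrite [RHS]ge0_integral_fsum//; last 2 first.
  - by move=> r; exact: emeasurable_funM.
  - by move=> n x _; apply: mule_ge0; rewrite ?EFinM ?nnfun_muleindic_ge0 // lee_fin.
apply: eq_fsbigr => r; rewrite inE => -[x _ xr].
have r0 : (0 <= r)%R by rewrite -xr.
have mpA : measurable (phi @^-1` (h @^-1` [set r])).
  by rewrite -(setTI (phi @^-1` _)); exact: mphi.
rewrite integralZl_indic_nnsfun// integral_indic// setIT nuE//.
rewrite integral_mkcond -ge0_integralZl//.
- apply: eq_integral => y _; rewrite patchE indicE.
  have -> : (phi y \in h @^-1` [set r]) = (y \in phi @^-1` (h @^-1` [set r])).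
    by apply/idP/idP => /set_mem hy; exact/mem_set.
  by case: ifPn => _; rewrite /= ?mulr1 ?mulr0 ?mul0e ?mule0.
- by apply/(measurable_restrictT _ _).1 => //; exact: measurable_funTS.
- by move=> y _; rewrite patchE; case: ifPn => // _; rewrite lee_fin.
Qed.

Lemma ge0_integral_density (f : T2 -> \bar R) : measurable_fun setT f ->
  (forall x, 0 <= f x) -> \int[nu]_x f x = \int[mu]_x (f (phi x) * (g x)%:E).
Proof.
move=> mf f0; pose f_ := nnsfun_approx measurableT mf.
transitivity (limn (fun n => \int[nu]_x (f_ n x)%:E)).
  rewrite -monotone_convergence//=.
  - by apply: eq_integral => x _; apply/esym/cvg_lim => //=; exact: cvg_nnsfun_approx.
  - by move=> n; apply: measurableT_comp => //; exact: measurable_funTS.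
  - by move=> n x _; rewrite lee_fin.
  - by move=> x _ a b ab; rewrite lee_fin//; exact/lefP/nd_nnsfun_approx.
under eq_fun do rewrite density_nnsfun.
rewrite -monotone_convergence//=.
- apply: eq_integral => x _; apply/cvg_lim => //=.
  by apply: cvgeZr => //; exact: cvg_nnsfun_approx.
- move=> n; apply: emeasurable_funM => //.
  by apply/measurable_EFinP; exact: (measurableT_comp _ mphi).
- by move=> n x _; rewrite mule_ge0 ?lee_fin.
- move=> x _ a b ab; rewrite lee_wpmul2r ?lee_fin//; exact/lefP/nd_nnsfun_approx.
Qed.

End density.

Section semicircle_integrals.
Context {R : realType} (s : R) (s_gt0 : 0 < s).
Local Notation mu := (@lebesgue_measure R).

Definition chord (x : R) := Num.sqrt (s ^+ 2 - x ^+ 2).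

Lemma chord_gt0 x : 0 <= x -> x < s -> 0 < chord x.
Proof.
by move=> x0 xs; rewrite sqrtr_gt0 subr_gt0 ltr_pXn2r ?nnegrE ?(ltW s_gt0).
Qed.

Lemma chord2 x : 0 <= x -> x < s -> chord x ^+ 2 = s ^+ 2 - x ^+ 2.
Proof.
by move=> x0 xs; rewrite sqr_sqrtr // subr_ge0 ler_pXn2r ?nnegrE ?(ltW s_gt0) // ltW.
Qed.

Lemma chord_cont : continuous chord.
Proof.
move=> x; apply: (@cvg_comp _ _ _ (fun x => s ^+ 2 - x ^+ 2) (@Num.sqrt R)); last first.
  exact: sqrt_continuous.
by apply: cvgB; [exact: cvg_cst | exact: exprn_continuous].
Qed.

Lemma is_derive_chord x : 0 <= x -> x < s -> is_derive x 1 chord (- x / chord x).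
Proof.
move=> x0 xs; have w0 := chord_gt0 x0 xs.
have p0 : 0 < s ^+ 2 - x ^+ 2 by rewrite -sqrtr_gt0.
have d1 : is_derive x 1 (fun x => s ^+ 2 - x ^+ 2) (- (2 * x)).
  by apply: is_derive_eq; rewrite -[x%:A]/(x * 1); ring.
have d2 := @is_derive1_sqrt R _ p0.
have := @is_derive1_comp R (@Num.sqrt R) (fun x => s ^+ 2 - x ^+ 2) x _ _ d2 d1.
rewrite /comp -/(chord x) => h; apply: is_derive_eq h _.
by field; rewrite gt_eqF.
Qed.

(* [pi / 2] is the left limit at [s]: the antiderivatives below need a function
   continuous on [[0, s]]. *)
Definition angle c (x : R) := if x < s then atan (c * x / chord x) else pi / 2.

Lemma angle_den c x : 0 < c -> 0 <= x -> x < s ->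
  0 < s ^+ 2 + (c ^+ 2 - 1) * x ^+ 2.
Proof.
move=> c0 x0 xs; have := chord2 x0 xs; have := chord_gt0 x0 xs => w0 w2.
have -> : s ^+ 2 + (c ^+ 2 - 1) * x ^+ 2 = chord x ^+ 2 + (c * x) ^+ 2 by rewrite w2; ring.
by rewrite ltr_wpDr ?sqr_ge0 // exprn_gt0.
Qed.

Lemma near_angle c x : x < s ->
  \near x, atan (c * x / chord x) = angle c x.
Proof.
move=> xs; near=> y; rewrite /angle ifT //; near: y; exact: lt_nbhsl.
Unshelve. all: by end_near. Qed.

Lemma is_derive_angle c x : 0 < c -> 0 <= x -> x < s ->
  is_derive x 1 (angle c) (c * s ^+ 2 / (chord x * (s ^+ 2 + (c ^+ 2 - 1) * x ^+ 2))).
Proof.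
move=> c0 x0 xs; apply: near_eq_is_derive (near_angle c xs) _.
have w0 := chord_gt0 x0 xs; have w2 := chord2 x0 xs.
have D0 := angle_den c0 x0 xs.
have wn : chord x != 0 by rewrite gt_eqF.
have dw := is_derive_chord x0 xs.
have dV : is_derive x 1 (fun x => (chord x)^-1) (x / chord x ^+ 3).
  by apply: is_derive_eq; rewrite -[_ *: _]/(_ * _); field.
have dq : is_derive x 1 (fun x => c * x / chord x) (c * s ^+ 2 / chord x ^+ 3).
  have -> : (fun x => c * x / chord x) = (fun x => c * x) * (fun x => (chord x)^-1) by [].
  apply: is_derive_eq; rewrite -!/(_ * _).
  have -> : s ^+ 2 = chord x ^+ 2 + x ^+ 2 by rewrite w2 subrK.
  rewrite -[c * x *: _]/(_ * _) -[(chord x)^-1 *: _]/(_ * _) -[c *: 1]/(c * 1); field.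
  by [].
have := @is_derive1_comp R (@atan R) (fun x => c * x / chord x) x _ _ (is_derive1_atan _) dq.
rewrite /comp => h; apply: is_derive_eq h _.
have e : s ^+ 2 + (c ^+ 2 - 1) * x ^+ 2 = chord x ^+ 2 + (c * x) ^+ 2 by rewrite w2; ring.
rewrite e in D0 *.
by field; rewrite wn gt_eqF //= -[X in X != 0]addrC.
Qed.

Lemma angle0 c : angle c 0 = 0.
Proof. by rewrite /angle s_gt0 mulr0 mul0r atan0. Qed.

Lemma angle_end c : angle c s = pi / 2.
Proof. by rewrite /angle ltxx. Qed.

Lemma angle_at_left c : 0 < c -> angle c @ s^'- --> angle c s.
Proof.
move=> c0; rewrite angle_end.
apply: (@cvg_trans _ ((fun x => atan (c * x / chord x)) @ s^'-)).
  apply: near_eq_cvg; near=> x.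
  have xs : x < s by near: x; exact: nbhs_left_lt.
  by rewrite /angle xs.
apply: (@cvg_comp _ _ _ (fun x => c * x / chord x) (@atan R) _ +oo); last exact: cvgy_atan.
apply/gtr0_cvgV0.
  near=> x; have x0 : 0 < x by near: x; exact: nbhs_left_gt.
  have xs : x < s by near: x; exact: nbhs_left_lt.
  by rewrite divr_gt0 ?mulr_gt0 // chord_gt0 // ltW.
rewrite [X in X @ _ --> _](_ : _ = (fun x => chord x * (c * x)^-1)); last first.
  by apply/funext => x; exact: invf_div.
have -> : 0 = chord s * (c * s)^-1 by rewrite /chord subrr sqrtr0 mul0r.
apply: cvg_at_left_filter; apply: cvgM; first exact: chord_cont.
apply: cvgV; first by rewrite gt_eqF // mulr_gt0.
by apply: cvgM; [exact: cvg_cst | exact: cvg_id].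
Unshelve. all: by end_near. Qed.

Lemma angle_at_right c : 0 < c -> angle c @ 0^'+ --> angle c 0.
Proof.
move=> c0; apply: cvg_at_right_filter.
have [d _] := is_derive_angle c0 (lexx 0) s_gt0.
by apply: differentiable_continuous; exact/derivable1_diffP.
Qed.

(** The integrand is [((s^2 + t) / (x^2 + t) - 1) / chord x]. Its summands are the derivatives of
    [c * angle c] and [- angle 1], the value of [c] being the one for which [s^2 + (c^2 - 1) x^2] is
    proportional to [x^2 + t]. *)
Lemma integral_chord_res t : 0 < t ->
  (\int[mu]_(x in `[0%R, s]) (chord x * res t x)%:E =
   ((Num.sqrt ((s ^+ 2 + t) / t) - 1) * (pi / 2))%:E)%E.
Proof.
move=> t0; set c := Num.sqrt _.
have st0 : 0 < (s ^+ 2 + t) / t by rewrite divr_gt0 // res_den.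
have c0 : 0 < c by rewrite sqrtr_gt0.
have c2 : c ^+ 2 = (s ^+ 2 + t) / t by rewrite sqr_sqrtr // ltW.
rewrite (@continuous_FTC2 _ _ (fun x => c * angle c x - angle 1 x)) //.
- by rewrite !angle0 !angle_end mulr0 subrr sube0; congr EFin; ring.
- apply: continuous_subspaceT => x; apply: cvgM; first exact: chord_cont.
  by case: (bcont_res t0) => rc _; exact: rc.
- have rc := angle_at_right c0; have lc := angle_at_left c0.
  have r1 := angle_at_right ltr01; have l1 := angle_at_left ltr01.
  split.
  + move=> x; rewrite in_itv /= => /andP[/ltW x0 xs].
    have d1 := is_derive_angle c0 x0 xs; have d2 := is_derive_angle ltr01 x0 xs.
    exact: ex_derive.
  + by apply: cvgB => //; apply: cvgM => //; exact: cvg_cst.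
  + by apply: cvgB => //; apply: cvgM => //; exact: cvg_cst.
- move=> x; rewrite in_itv /= => /andP[/ltW x0 xs].
  have d1 := is_derive_angle c0 x0 xs; have d2 := is_derive_angle ltr01 x0 xs.
  have w0 := chord_gt0 x0 xs; have w2 := chord2 x0 xs.
  rewrite derive1E derive_val -[c *: _]/(c * _) /res.
  have rd := res_den x t0.
  have -> : c * (c * s ^+ 2 / (chord x * (s ^+ 2 + (c ^+ 2 - 1) * x ^+ 2))) =
    c ^+ 2 * s ^+ 2 / (chord x * (s ^+ 2 + (c ^+ 2 - 1) * x ^+ 2)) by ring.
  have -> : s ^+ 2 + (c ^+ 2 - 1) * x ^+ 2 = s ^+ 2 * (x ^+ 2 + t) / t.
    by rewrite c2; field; rewrite gt_eqF.
  rewrite c2 expr1n subrr mul0r addr0.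
  have -> : chord x * (x ^+ 2 + t)^-1 = (s ^+ 2 - x ^+ 2) / (chord x * (x ^+ 2 + t)).
    by rewrite -w2; field; rewrite !gt_eqF.
  by field; rewrite !gt_eqF.
Qed.

(** The area of a quarter of the disc of radius [s]. *)
Lemma integral_chord :
  (\int[mu]_(x in `[0%R, s]) (chord x)%:E = (s ^+ 2 / 2 * (pi / 2))%:E)%E.
Proof.
rewrite (@continuous_FTC2 _ _ (fun x => 2^-1 * (x * chord x) + s ^+ 2 / 2 * angle 1 x)) //.
- rewrite !angle0 !angle_end /chord subrr sqrtr0 -EFinB; congr EFin; ring.
- by apply: continuous_subspaceT => x; exact: chord_cont.
- have r1 := angle_at_right ltr01; have l1 := angle_at_left ltr01.
  split.
  + move=> x; rewrite in_itv /= => /andP[/ltW x0 xs].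
    have d1 := is_derive_chord x0 xs; have d2 := is_derive_angle ltr01 x0 xs.
    exact: ex_derive.
  + apply: cvgD; last by apply: cvgM => //; exact: cvg_cst.
    apply: cvgM; first exact: cvg_cst.
    by apply: cvg_at_right_filter; apply: cvgM; [exact: cvg_id | exact: chord_cont].
  + apply: cvgD; last by apply: cvgM => //; exact: cvg_cst.
    apply: cvgM; first exact: cvg_cst.
    by apply: cvg_at_left_filter; apply: cvgM; [exact: cvg_id | exact: chord_cont].
- move=> x; rewrite in_itv /= => /andP[/ltW x0 xs].
  have d1 := is_derive_chord x0 xs; have d2 := is_derive_angle ltr01 x0 xs.
  have w0 := chord_gt0 x0 xs; have w2 := chord2 x0 xs.
  rewrite derive1E derive_val.
  rewrite expr1n subrr mul0r addr0 mul1r.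
  set W := chord x in w0 w2 *.
  have -> : s ^+ 2 = W ^+ 2 + x ^+ 2 by rewrite w2 subrK.
  have Wx : 0 < W ^+ 2 + x ^+ 2 by rewrite ltr_wpDr ?sqr_ge0 // exprn_gt0.
  by rewrite -[W%:A]/(W * 1) /GRing.scale /=; field; rewrite !gt_eqF.
Qed.

End semicircle_integrals.

Section mean_of_measure.
Context {R : realType} (m : {measure set R -> \bar R}) (m1 : m setT = 1%E).

Definition mean_of (f : R -> R) : R := (\int[m]_x f x)%R.

Lemma bcont_integrable f (D : set R) : measurable D -> bcont f ->
  m.-integrable D (EFin \o f).
Proof.
move=> mD [fc [K fK]]; apply: (@integrableS _ _ _ _ setT) => //.
apply: measurable_bounded_integrable => //; first by rewrite m1 ltry.
- exact: continuous_measurable_fun.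
- exists K; split; first exact: num_real.
  by move=> x Kx y _ /=; rewrite (le_trans (fK y)) // ltW.
Qed.

Lemma mean_ofE f : bcont f -> (\int[m]_x (f x)%:E)%E = (mean_of f)%:E.
Proof.
move=> fb; rewrite /mean_of /Rintegral fineK //.
by apply: integrable_fin_num => //; exact: bcont_integrable.
Qed.

Lemma mean_of_supp f (D : set R) : measurable D -> m (~` D) = 0%E -> bcont f ->
  mean_of f = (\int[m]_(x in D) f x)%R.
Proof.
move=> mD D0 fb; rewrite /mean_of /Rintegral (@negligible_integral _ _ _ m setT (~` D)) //.
- by rewrite setTD setCK.
- exact: measurableC.
- exact: bcont_integrable.
Qed.

Lemma is_mean_of : m `]-oo, 0%R[%classic = 0%E -> is_mean mean_of.
Proof.
move=> neg0; split.
- move=> a f g fb gb; rewrite /mean_of RintegralD ?RintegralZl //; try exact: bcont_integrable.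
  by apply: bcont_integrable => //; exact: bcontZ.
- move=> f g fb gb fg.
  have nc : m (~` `[0%R, +oo[%classic) = 0%E by rewrite setCitvr.
  rewrite !(mean_of_supp _ nc) //; apply: le_Rintegral => //; try exact: bcont_integrable.
  by move=> x; rewrite /= in_itv /= andbT; exact: fg.
- by rewrite /mean_of Rintegral_cst // mul1r m1.
Qed.

End mean_of_measure.

Section quartercircular_mean.
Context {R : realType} (sigma : R) (sigma_gt0 : 0 < sigma).
Local Notation mu := (@lebesgue_measure R).
Local Notation Q := (quartercircular sigma).

Let pi_neq0 : pi != 0 :> R. Proof. by rewrite gt_eqF // pi_gt0. Qed.
Let sigma_neq0 : sigma != 0. Proof. by rewrite gt_eqF. Qed.

Let s := 2 * sigma.
Let s_gt0 : 0 < s. Proof. by rewrite mulr_gt0. Qed.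
Let k := (pi * sigma ^+ 2)^-1.
Let k_gt0 : 0 < k. Proof. by rewrite invr_gt0 mulr_gt0 ?pi_gt0 // exprn_gt0. Qed.

Lemma quartercircular_integral (f : R -> R) : measurable_fun setT f ->
  (forall x, 0 <= f x) ->
  (\int[Q]_x (f x)%:E = k%:E * \int[mu]_(x in `[0%R, s]) (chord s x * f x)%:E)%E.
Proof.
move=> mf f0.
have -> : (\int[Q]_x (f x)%:E = \int[mu]_x ((f x)%:E * (quartercircular_pdf sigma x)%:E))%E.
  have mid : measurable_fun setT (fun x : measurableTypeR R => (x : R)) by [].
  have H := @ge0_integral_density _ _ _ _ _ _ mid lebesgue_measure Q
   (quartercircular_pdf sigma) (measurable_quartercircular_pdf sigma)
   (quartercircular_pdf_ge0 sigma) (fun V _ => erefl) (EFin \o f).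
  apply: H; first exact/measurable_EFinP.
  by move=> x; rewrite lee_fin.
- rewrite -ge0_integralZl //.
  + rewrite [RHS]integral_mkcond; apply: eq_integral => x _.
    rewrite patchE /quartercircular_pdf indicE /s -/k; case: ifPn => _.
      rewrite mulr1 -!EFinM; congr EFin; rewrite /chord exprMn.
      have -> : 2 ^+ 2 = 4 :> R by ring.
      by ring.
    by rewrite mulr0 mule0.
  + apply/measurable_EFinP/measurable_funTS/measurable_funM => //.
    by apply: continuous_measurable_fun; exact: chord_cont.
  + by move=> x _; rewrite lee_fin mulr_ge0 ?sqrtr_ge0.
  + by rewrite lee_fin ltW.
Qed.

Lemma quartercircular_mass : Q setT = 1%E.
Proof.
have := @quartercircular_integral (fun=> 1) (measurable_cst _) (fun=> ler01).
rewrite integral_cst // mul1e => ->.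
under eq_integral do rewrite mulr1.
rewrite integral_chord // -EFinM; congr EFin; rewrite /k /s.
by move: (pi : R) pi_neq0 => p p0; field; rewrite p0 sigma_neq0.
Qed.

Lemma quartercircular_supp : Q (~` `[0, s]%classic) = 0%E.
Proof.
apply: integral0_eq => x /= xs.
rewrite /quartercircular_pdf indicE memNset ?mulr0 //.
Qed.

Lemma quartercircular_neg : Q `]-oo, 0[%classic = 0%E.
Proof.
apply: integral0_eq => x /=; rewrite in_itv /= => x0.
rewrite /quartercircular_pdf indicE memNset ?mulr0 //=.
by rewrite in_itv /= => /andP[x0' _]; move: x0; rewrite ltNge x0'.
Qed.

(** With [c = sqrt ((4 sigma^2 + t) / t)] the mean is [m = (c - 1) / (2 sigma^2)] and
    [sigma^2 = (c^2 - 1) t / 4]. Then [t m = 2 / (c + 1)] and [phi (sigma^2 m) = (c - 1) / (c + 1)],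
    of sum [1]. *)
Lemma quartercircular_res t : 0 < t -> is_limit_strace t (sigma ^+ 2) (mean_of Q (res t)).
Proof.
move=> t0; set c := Num.sqrt ((s ^+ 2 + t) / t).
have c2 : c ^+ 2 = (s ^+ 2 + t) / t by rewrite sqr_sqrtr // divr_ge0 ?ltW // res_den.
have c1 : 1 <= c.
  rewrite -(@ler_pXn2r _ 2) ?nnegrE ?sqrtr_ge0 // expr1n c2 ler_pdivlMr // mul1r.
  by rewrite lerDr sqr_ge0.
have mE : mean_of Q (res t) = (c - 1) / (2 * sigma ^+ 2).
  apply: EFin_inj; rewrite -mean_ofE; [|exact: quartercircular_mass|exact: bcont_res].
  rewrite quartercircular_integral.
  - rewrite integral_chord_res // -EFinM; congr EFin; rewrite -/c /k.
    by move: (pi : R) pi_neq0 => p p0; field; rewrite p0 sigma_neq0.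
  - by apply: continuous_measurable_fun; case: (bcont_res t0).
  - by move=> x; rewrite ltW // res_gt0.
rewrite mE; split; first by rewrite divr_ge0 ?subr_ge0 // mulr_ge0 // sqr_ge0.
have -> : sigma ^+ 2 * ((c - 1) / (2 * sigma ^+ 2)) = (c - 1) / 2.
  by field; rewrite gt_eqF.
have s2 : sigma ^+ 2 = (c ^+ 2 - 1) * t / 4.
  by rewrite c2 /s; field; rewrite gt_eqF.
have cc : 0 < c ^+ 2 - 1.
  have -> : c ^+ 2 - 1 = s ^+ 2 / t by rewrite c2; field; rewrite gt_eqF.
  by rewrite divr_gt0 // exprn_gt0.
have c0 : 0 < c + 1 by lra.
have cm : 0 < c - 1 by move: cc; rewrite subr_sqr_1 pmulr_lgt0.
rewrite s2 /phi subr_sqr_1; field.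
by rewrite !gt_eqF //; lra.
Qed.

End quartercircular_mean.

(** * Discretisation *)

Section finite_valued.
Context d (T : measurableType d) (R : realType) (P : probability T R).
Context (V : finType) (Y : T -> V).
Context (mY : forall k, measurable (Y @^-1` [set k])).

Definition flaw (k : V) : R := fine (P (Y @^-1` [set k])).

Lemma flawE k : P (Y @^-1` [set k]) = (flaw k)%:E.
Proof. by rewrite /flaw fineK // fin_num_measure. Qed.

Lemma flaw_integral (F : V -> R) : (forall k, 0 <= F k) ->
  (\int[P]_w (F (Y w))%:E)%E = (Ew flaw F)%:E.
Proof.
move=> F0.
transitivity (\int[P]_w (\sum_k ((F k)%:E * (\1_(Y @^-1` [set k]) w)%:E)))%E.
  apply: eq_integral => w _; rewrite (bigD1 (Y w)) //= big1 ?adde0.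
    by rewrite indicE mem_set // mule1.
  move=> k kY; rewrite indicE memNset ?mule0 //= => e.
  by rewrite e eqxx in kY.
rewrite ge0_integral_sum //=; last 2 first.
- move=> k; apply: emeasurable_funM; first exact: measurable_cst.
  by apply/measurable_EFinP; exact: measurable_indic.
- by move=> k w _; rewrite mule_ge0 ?lee_fin // indicE.
rewrite /Ew -sumEFin; apply: eq_bigr => k _.
rewrite ge0_integralZl //=; last 2 first.
- by apply/measurable_EFinP; exact: measurable_indic.
- by rewrite lee_fin.
rewrite integral_indic // setIT EFinM muleC; congr (_ * _)%E; exact: flawE.
Qed.

Lemma isdist_flaw : isdist flaw.
Proof.
split => [k|]; first by rewrite fine_ge0.
have : P setT = (Ew flaw (fun=> 1))%:E by rewrite -flaw_integral // integral_cst // mul1e.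
rewrite probability_setT => -[e]; rewrite [RHS]e.
by apply: eq_bigr => k _; rewrite mulr1.
Qed.

Lemma measurable_fibers (B : set V) : measurable (Y @^-1` B).
Proof.
have -> : Y @^-1` B = \bigcup_(k in B) (Y @^-1` [set k]).
  by apply/seteqP; split => [w Bw|w [k Bk /= Yk]] /=; [exists (Y w) | rewrite Yk].
by apply: fin_bigcup_measurable => //; exact: finite_finset.
Qed.

Lemma flaw_prob (b : pred V) :
  P (Y @^-1` [set k | b k]) = (Ew flaw (fun k => (b k)%:R))%:E.
Proof.
transitivity (\int[P]_w (\1_(Y @^-1` [set k | b k]) w)%:E)%E.
  by rewrite integral_indic ?setIT //; exact: measurable_fibers.
rewrite -flaw_integral //.
apply: eq_integral => w _; congr EFin; rewrite indicE; congr (nat_of_bool _)%:R.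
by apply/idP/idP => [/set_mem|h] //; apply/mem_set.
Qed.

End finite_valued.

Section grid.
Context {R : realType}.

(** Steps of length [1 / (N + 1)] from [0] to [N + 1], both ends included. *)
Definition grid_size (N : nat) := (N.+1 ^ 2).+1.

(* Values beyond the grid go to [0], so that rounding never increases them. *)
Definition grid_index (N : nat) (x : R) : 'I_(grid_size N) :=
  inord (let c := Num.truncn (x * N.+1%:R) in if (c <= N.+1 ^ 2)%N then c else 0%N).

Definition grid_value (N : nat) (k : 'I_(grid_size N)) : R := k%:R / N.+1%:R.

Lemma grid_value_ge0 N (k : 'I_(grid_size N)) : 0 <= grid_value k.
Proof. by rewrite divr_ge0. Qed.

Lemma grid_le N x : 0 <= x -> grid_value (grid_index N x) <= x.
Proof.
move=> x0; rewrite ler_pdivrMr //; have xn0 : 0 <= x * N.+1%:R by rewrite mulr_ge0 // ltW.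
case/andP: (truncn_itv xn0) => h _.
by rewrite inordK /=; case: ifP => // c; rewrite ltnS.
Qed.

Lemma grid_gt N x : 0 <= x -> x < N.+1%:R -> x - N.+1%:R^-1 < grid_value (grid_index N x).
Proof.
move=> x0 xN; have xn0 : 0 <= x * N.+1%:R by rewrite mulr_ge0 // ltW.
have c : (Num.truncn (x * N.+1%:R)%R <= N.+1 ^ 2)%N.
  rewrite ltnW // truncn_lt_nat // expnS expn1 natrM.
  by rewrite ltr_pM2r.
rewrite /grid_index c /grid_value inordK ?ltnS // ltr_pdivlMr // mulrBl mulVf ?gt_eqF //.
by rewrite ltrBlDr natr1; case/andP: (truncn_itv xn0).
Qed.

Lemma measurable_grid_index N k : measurable ((@grid_index N) @^-1` [set k]).
Proof.
pose c (x : R) := Num.truncn (x * N.+1%:R).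
pose g j : 'I_(grid_size N) := inord (if (j <= N.+1 ^ 2)%N then j else 0%N).
have -> : @grid_index N @^-1` [set k] = \bigcup_(j in [set j | g j = k]) (c @^-1` [set j]).
  by apply/seteqP; split => [x /= <-|x [j /= <- <-]] //; exists (c x).
apply: bigcup_measurable => j _.
have mc n : measurable [set x | (c x <= n)%N].
  have -> : [set x | (c x <= n)%N] = `]-oo, n.+1%:R / N.+1%:R[%classic.
    by apply/seteqP; split => x /=; rewrite in_itv /= ltr_pdivlMr // truncn_le_nat.
  exact: measurable_itv.
case: j => [|j].
  have -> : c @^-1` [set 0%N] = [set x | (c x <= 0)%N].
    by apply/seteqP; split => x /=; rewrite leqn0 => /eqP.
  exact: mc.
have -> : c @^-1` [set j.+1] = [set x | (c x <= j.+1)%N] `\` [set x | (c x <= j)%N].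
  apply/seteqP; split => x /=; first by move=> ->; rewrite leqnn ltnn.
  by move=> [h1 /negP h2]; apply/eqP; rewrite eqn_leq h1 ltnNge.
exact: measurableD.
Qed.

End grid.

Section grid_law.
Context d (T : measurableType d) (R : realType) (P : probability T R).
Context (X : {RV P >-> R}) (X_ge0 : forall w, 0 <= X w) (v : R).
Context (X_1 : (\int[P]_w (X w)%:E = 1)%E)
  (X_2 : (\int[P]_w (X w ^+ 2)%:E = (1 + v)%:E)%E).

Lemma div_SnV_cvg (e : R) : 0 < e -> \forall N \near \oo, N.+1%:R^-1 <= e.
Proof.
move=> e0; have [N hN] := div_nat_small 1 e0.
by exists N => // n /= Nn; rewrite -[leLHS]mul1r; apply: hN; exact: leqW.
Qed.

Lemma near_lt_Sn (x : R) : \forall N \near \oo, x < N.+1%:R.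
Proof.
exists (Num.truncn x) => // n /= h; apply: lt_le_trans (truncnS_gt x) _.
by rewrite ler_nat.
Qed.

Lemma grid_cvg (x : R) : 0 <= x -> grid_value (grid_index N x) @[N --> \oo] --> x.
Proof.
move=> x0; apply/cvgrPdist_le => e e0; near=> N.
have xN : x < N.+1%:R by near: N; exact: near_lt_Sn.
have eN : N.+1%:R^-1 <= e by near: N; exact: div_SnV_cvg.
have := grid_gt x0 xN; have := grid_le N x0 => h1 h2.
rewrite ger0_norm ?subr_ge0 // lerBlDr -lerBlDl.
by rewrite (le_trans _ (ltW h2)) // lerD2l lerN2.
Unshelve. all: by end_near. Qed.

Let Y N w := grid_index N (X w).

Lemma measurable_grid_rv N k : measurable (Y N @^-1` [set k]).
Proof.
by have := measurable_funPTI X (measurable_grid_index k).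
Qed.

Lemma measurable_grid N (F : R -> R) : measurable_fun setT (fun w => F (grid_value (Y N w))).
Proof.
move=> _ B mB; rewrite setTI.
rewrite [X in measurable X](_ : _ = Y N @^-1` [set k | B (F (grid_value k))]) //.
exact/measurable_fibers/measurable_grid_rv.
Qed.

Let dct (u : nat -> T -> R) (l g : T -> R) (c c' : R) :
  (forall n, measurable_fun setT (u n)) -> measurable_fun setT g ->
  (forall w, u n w @[n --> \oo] --> l w) ->
  (\int[P]_w (g w)%:E = c%:E)%E -> (forall n w, `|u n w| <= g w) ->
  (\int[P]_w (l w)%:E = c'%:E)%E ->
  fine (\int[P]_w (u n w)%:E) @[n --> \oo] --> c'.
Proof.
move=> mu mg ul gc ug lc.
have g0 w : 0 <= g w by exact: le_trans (ug 0%N w).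
have ig : P.-integrable setT (EFin \o g).
  apply/integrableP; split; first exact/measurable_EFinP.
  under eq_integral do rewrite /= ger0_norm //.
  by rewrite gc ltry.
have ul' : forall w, setT w -> (u n w)%:E @[n --> \oo] --> (l w)%:E.
  by move=> w _; apply: cvg_EFin; [exact: nearW|exact: ul].
have mu' n : measurable_fun setT (fun w => (u n w)%:E) by exact/measurable_EFinP.
have ug' n w : setT w -> (`|(u n w)%:E| <= (EFin \o g) w)%E by rewrite lee_fin.
have fg w : setT w -> (EFin \o g) w \is a fin_num by [].
have := @dominated_cvg _ _ _ P setT measurableT _ _ _ mu' ul' fg ig ug'.
by rewrite lc => /fine_cvg.
Qed.

Let ev (u : nat -> R) (l e : R) : u n @[n --> \oo] --> l -> 0 < e ->
  \forall n \near \oo, `|u n - l| <= e.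
Proof. by move=> /cvgrPdist_le h /h; apply: filterS => n; rewrite distrC. Qed.

Let mX : measurable_fun setT X. Proof. exact: measurable_funPT. Qed.

Let mX2 : measurable_fun setT (fun w => X w ^+ 2).
Proof. exact: measurable_funX. Qed.

Lemma grid_moment1 e : 0 < e ->
  \forall N \near \oo, `|Ew (flaw P (Y N)) (@grid_value _ N) - 1| <= e.
Proof.
move=> e0; have H : fine (\int[P]_w (grid_value (Y n w))%:E) @[n --> \oo] --> (1 : R).
  apply: (@dct _ X X 1) => //.
  - by move=> n; exact: (measurable_grid n id).
  - by move=> w; exact: grid_cvg.
  - by move=> n w; rewrite ger0_norm ?grid_value_ge0 // grid_le.
apply: filterS (ev H e0) => N.
rewrite (@flaw_integral _ _ _ _ _ _ (@measurable_grid_rv N) (@grid_value _ N)) //.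
exact: grid_value_ge0.
Qed.

Lemma grid_moment2 e : 0 < e ->
  \forall N \near \oo, `|Ew (flaw P (Y N)) (fun k => grid_value k ^+ 2) - (1 + v)| <= e.
Proof.
move=> e0.
have H : fine (\int[P]_w (grid_value (Y n w) ^+ 2)%:E) @[n --> \oo] --> (1 + v : R).
  apply: (@dct _ (fun w => X w ^+ 2) (fun w => X w ^+ 2) (1 + v)) => //.
  - by move=> n; exact: (measurable_grid n (fun x => x ^+ 2)).
  - move=> w; apply: (@cvg_comp _ _ _ _ (fun x : R => x ^+ 2) _ (nbhs (X w))).
      exact: grid_cvg.
    exact: exprn_continuous.
  - move=> n w; rewrite ger0_norm ?sqr_ge0 // ler_pXn2r ?nnegrE ?grid_value_ge0 //.
    exact: grid_le.
apply: filterS (ev H e0) => N.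
rewrite (@flaw_integral _ _ _ _ _ _ (@measurable_grid_rv N) (fun k => grid_value k ^+ 2)) //.
by move=> k; exact: sqr_ge0.
Qed.

(** Rounding never increases a value, so the truncated second moment on any grid is at most that of
    [X]. This is why one [L] serves all grids. *)
Lemma grid_tail e : 0 < e -> exists2 L : R, 1 <= L & forall N,
  Ew (flaw P (Y N)) (fun k => if L < grid_value k then grid_value k ^+ 2 else 0) <= e.
Proof.
move=> e0; pose tl L x : R := if L < x then x ^+ 2 else 0.
have mtl L : measurable_fun setT (tl L).
  apply: measurable_fun_if => //.
  exact: measurable_fun_ltr.
have H : fine (\int[P]_w (tl n.+1%:R (X w))%:E) @[n --> \oo] --> (0 : R).
  apply: (@dct _ (fun=> 0) (fun w => X w ^+ 2) (1 + v)) => //.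
  - by move=> n; exact: measurableT_comp (mtl _) mX.
  - move=> w; apply: cvg_near_cst; apply: filterS (near_lt_Sn (X w)) => n h.
    by rewrite /tl ltNge (ltW h).
  - by move=> n w; rewrite /tl; case: ifP => _; rewrite ?normr0 ?sqr_ge0 // ger0_norm ?sqr_ge0.
  - by rewrite integral0.
have [n hn] := filter_ex (ev H e0).
exists n.+1%:R; first by rewrite ler1n.
move=> N; set L := n.+1%:R in hn *.
have tl0 x : 0 <= tl L x by rewrite /tl; case: ifP => // _; exact: sqr_ge0.
apply: le_trans (_ : fine (\int[P]_w (tl L (X w))%:E) <= _); last first.
  by apply: le_trans (ler_norm _) _; rewrite -[X in `|X|]subr0.
rewrite -lee_fin -(@flaw_integral _ _ _ _ _ _ (@measurable_grid_rv N) (fun k => tl L (grid_value k))) //.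
rewrite fineK; last first.
  rewrite ge0_fin_numE; last by apply: integral_ge0 => w _; rewrite lee_fin.
  apply: (@le_lt_trans _ _ (\int[P]_w (X w ^+ 2)%:E)%E); last by rewrite X_2 ltry.
  apply: ge0_le_integral => //.
  - by move=> w _; rewrite lee_fin.
  - by apply/measurable_EFinP; exact: measurableT_comp (mtl _) mX.
  - exact/measurable_EFinP.
  - by move=> w _; rewrite lee_fin /tl; case: ifP => // _; exact: sqr_ge0.
apply: ge0_le_integral => //.
- by move=> w _; rewrite lee_fin.
- by apply/measurable_EFinP; exact: (measurable_grid N (tl L)).
- by apply/measurable_EFinP; exact: measurableT_comp (mtl _) mX.
- move=> w _; rewrite lee_fin /tl.
  have h := grid_le N (X_ge0 w); have g0 := grid_value_ge0 (grid_index N (X w)).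
  case: ifP => [Lg|_]; last by case: ifP => // _; exact: sqr_ge0.
  by rewrite (lt_le_trans Lg h) ler_pXn2r ?nnegrE ?X_ge0 ?grid_value_ge0.
Qed.

(* Off this set the grid approximation has relative error at most [del]. *)
Definition grid_bad (N : nat) (del : R) : set R :=
  [set x | x != 0 /\ (x < N.+1%:R^-1 / del \/ N.+1%:R <= x)].

Lemma measurable_grid_bad N del : measurable (grid_bad N del).
Proof.
have -> : grid_bad N del = ~` [set 0] `&`
    (`]-oo, N.+1%:R^-1 / del[%classic `|` `[N.+1%:R, +oo[%classic).
  apply/seteqP; split => x /=; rewrite !in_itv /= andbT.
    by move=> [/eqP].
  by move=> [/eqP].
apply: measurableI; first by apply: measurableC; exact: measurable_set1.
by apply: measurableU; exact: measurable_itv.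
Qed.

(** Dominated convergence: a positive value is in [grid_bad N del] for finitely many [N] only, and
    [0] never is. The convergence comes without a rate, which is harmless because the grid is chosen
    after [n]. *)
Lemma grid_bad_small del e : 0 < del -> 0 < e ->
  \forall N \near \oo, (P (X @^-1` grid_bad N del) <= e%:E)%E.
Proof.
move=> del0 e0.
have mb N : measurable (X @^-1` grid_bad N del).
  by have := measurable_funPTI X (measurable_grid_bad N del).
have H : fine (\int[P]_w (\1_(X @^-1` grid_bad n del) w)%:E) @[n --> \oo] --> (0 : R).
  apply: (@dct _ (fun=> 0) (fun=> 1) 1) => //.
  - by move=> n; exact: measurable_indic.
  - move=> w; apply: cvg_near_cst.
    have [Xw0|Xw0] := eqVneq (X w) 0.
      by apply: nearW => n; rewrite indicE memNset //= => -[]; rewrite Xw0 eqxx.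
    have Xw : 0 < X w by rewrite lt_def Xw0 X_ge0.
    near=> n.
    have h1 : X w < n.+1%:R by near: n; exact: near_lt_Sn.
    have h2 : n.+1%:R^-1 <= X w * del by near: n; apply: div_SnV_cvg; exact: mulr_gt0.
    rewrite indicE memNset //= => -[_ []]; last by rewrite leNgt h1.
    by rewrite ltr_pdivlMr // ltNge h2.
  - by rewrite integral_cst // mul1e; exact: probability_setT.
  - by move=> n w; rewrite indicE ger0_norm // lern1 leq_b1.
  - by rewrite integral0.
apply: filterS (ev H e0) => N.
rewrite integral_indic // setIT subr0 ger0_norm ?fine_ge0 // => h.
by rewrite -[leLHS]fineK ?lee_fin // fin_num_measure.
Unshelve. all: by end_near. Qed.

End grid_law.

(** * Relative perturbations of the entries *)

Section comparison.
Context {R : rcfType}.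

(** A relative error [del] of the entries passes to the row sums, so each quotient changes by a
    factor between [1 - del] and [1 / (1 - del) <= 1 + 2 del]. An absolute error would give no such
    control over rows of small sum. *)
Lemma rownorm_compare n (X Z : 'M[R]_n) (del : R) : 0 <= del -> del <= 2^-1 ->
  (forall i j, 0 <= X i j) ->
  (forall i j, (1 - del) * X i j <= Z i j <= X i j) ->
  forall i j, (rownorm X i j - rownorm Z i j) ^+ 2 <=
    4%:R * del ^+ 2 * rownorm X i j ^+ 2.
Proof.
move=> d0 d2 X0 XZ i j.
set S := \sum_k X i k; set S' := \sum_k Z i k.
have SS : (1 - del) * S <= S' <= S.
  rewrite mulr_sumr; apply/andP.
  by split; apply: ler_sum => k _; case/andP: (XZ i k).
(* If [S = 0] then [S' = 0] as well, and both rows are the same row of the identity. *)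
rewrite !mxE -/S -/S'; case: (eqVneq S 0) => [S0|S0].
  have -> : S' = 0 by apply/eqP; rewrite eq_le; move: SS; rewrite S0 mulr0 andbC.
  by rewrite /= S0 eqxx subrr expr0n /= mulr_ge0 ?sqr_ge0 // mulr_ge0 // sqr_ge0.
have Sp : 0 < S by rewrite lt_def S0 sumr_ge0.
have S'p : 0 < S' by case/andP: SS => h _; apply: lt_le_trans h; rewrite mulr_gt0 //; lra.
rewrite /= (negbTE S0) (gt_eqF S'p).
set x := X i j; set z := Z i j.
have x0 : 0 <= x by exact: X0.
have q0 : 0 <= x / S by rewrite divr_ge0 // ltW.
have -> : 4%:R * del ^+ 2 * (x / S) ^+ 2 = (2%:R * del * (x / S)) ^+ 2 by ring.
rewrite -[leLHS]real_normK ?num_real // ler_pXn2r ?nnegrE //; last by rewrite mulr_ge0 // mulr_ge0.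
have /andP[z1 z2] : (1 - del) * x <= z <= x by exact: XZ.
case/andP: SS => s1 s2.
have l1 : (1 - del) * (x / S) <= z / S'.
  rewrite mulrA; apply: ler_pM => //.
  - by rewrite mulr_ge0 //; lra.
  - by rewrite invr_ge0 ltW.
  - by rewrite lef_pV2.
have l2 : z / S' <= (1 + 2%:R * del) * (x / S).
  rewrite ler_pdivrMr // -mulrA; apply: (le_trans z2).
  have : x * ((1 - del) * S) <= x * S' by rewrite ler_wpM2l.
  rewrite -(ler_pM2r (x := S^-1)) ?invr_gt0 //.
  have -> : x * ((1 - del) * S) / S = (1 - del) * x by field; rewrite gt_eqF.
  have -> : x * S' / S = x / S * S' by rewrite mulrAC.
  set y := x / S * S' => h; nra.
by rewrite ler_norml; apply/andP; split; lra.
Qed.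

(** Each row is a probability vector, identity rows included, and its entries are at most [1]. *)
Lemma rownorm_sqr_le n (X : 'M[R]_n) : (forall i j, 0 <= X i j) ->
  \sum_i \sum_j rownorm X i j ^+ 2 <= n%:R.
Proof.
move=> X0; rewrite -[n in leRHS]card_ord -sumr_const; apply: ler_sum => i _.
set S := \sum_k X i k; have S0 : 0 <= S by exact: sumr_ge0.
have [Se|Se] := eqVneq S 0.
  rewrite (bigD1 i) //= big1 => [|j /negbTE ji].
    by rewrite mxE -/S /= Se !eqxx addr0 expr1n.
  by rewrite mxE -/S /= Se eqxx eq_sym ji expr0n.
have Sp : 0 < S by rewrite lt_def Se.
have -> : 1 = \sum_j X i j / S by rewrite -mulr_suml divff.
apply: ler_sum => j _; rewrite mxE -/S /= (negbTE Se) expr2.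
rewrite ler_piMl ?divr_ge0 // ler_pdivrMr // mul1r /S (bigD1 j) //= lerDl.
exact: sumr_ge0.
Qed.

Lemma markov_stieltjes_compare n (X Z : 'M[R]_n) (t del al : R) : (0 < n)%N -> 0 < t ->
  0 < al -> 0 <= del -> del <= 2^-1 -> (forall i j, 0 <= X i j) ->
  (forall i j, (1 - del) * X i j <= Z i j <= X i j) ->
  `|markov_stieltjes t X - markov_stieltjes t Z| <=
    al^-1 * (4%:R * del ^+ 2 * n%:R) + al / t ^+ 3.
Proof.
move=> n0 t0 al0 d0 d2 X0 XZ; have np : 0 < n%:R :> R by rewrite ltr0n.
rewrite /markov_stieltjes /stieltjes -mulrBl normrM [X in _ * X]ger0_norm ?invr_ge0 ?ler0n //.
rewrite ler_pdivrMr //; apply: (le_trans (strace_frob t0 _ _ al0)).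
have : frob2 (Num.sqrt n%:R *: rownorm X - Num.sqrt n%:R *: rownorm Z) <=
    n%:R * (4%:R * del ^+ 2 * n%:R).
  rewrite /frob2; apply: (@le_trans _ _
    (\sum_i \sum_j n%:R * (4%:R * del ^+ 2) * rownorm X i j ^+ 2)).
    apply: ler_sum => i _; apply: ler_sum => j _.
    have -> : (Num.sqrt n%:R *: rownorm X - Num.sqrt n%:R *: rownorm Z) i j =
       Num.sqrt n%:R * (rownorm X i j - rownorm Z i j) by rewrite !mxE mulrBr.
    rewrite exprMn sqr_sqrtr ?ler0n // -mulrA ler_pM2l //.
    exact: rownorm_compare.
  under eq_bigr do rewrite -mulr_sumr.
  rewrite -mulr_sumr -mulrA ler_pM2l // ler_wpM2l ?mulr_ge0 ?sqr_ge0 //.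
  exact: rownorm_sqr_le.
rewrite -(ler_pM2l (x := al^-1)) ?invr_gt0 // => h.
apply: le_trans (_ : al^-1 * (n%:R * (4%:R * del ^+ 2 * n%:R)) + al * (t ^- 3 * n%:R) <= _).
  by rewrite lerD2r.
by rewrite le_eqVlt; apply/orP; left; apply/eqP; field; rewrite !gt_eqF.
Qed.

End comparison.

Section joint_law.
Context d (T : measurableType d) (R : realType) (P : probability T R).
Context (X : nat -> nat -> {RV P >-> R}).
Context (Xiid : iid (fun ij : nat * nat => X ij.1 ij.2)).
Context (V : finType) (idx : R -> V) (midx : forall k, measurable (idx @^-1` [set k])).
Context (n : nat).
Local Notation mat_sp := {ffun 'I_n -> {ffun 'I_n -> V}}.

Lemma iid_preimage i j (B : set R) : measurable B ->
  P (X i j @^-1` B) = P (X 0%N 0%N @^-1` B).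
Proof. by move=> mB; exact: (Xiid.2 (i, j) (0%N, 0%N)). Qed.

Definition coded (w : T) : mat_sp := [ffun i : 'I_n => [ffun j : 'I_n => idx (X i j w)]].

(** Mutual independence takes one set for every pair of naturals; pairs outside the block receive
    [setT]. *)
Let B (v : mat_sp) (ij : nat * nat) : set R :=
  if (insub ij.1 : option 'I_n, insub ij.2 : option 'I_n) is (Some i, Some j)
  then idx @^-1` [set v i j] else setT.

Let BE v (i j : 'I_n) : B v (val i, val j) = idx @^-1` [set v i j].
Proof. by rewrite /B /= !valK. Qed.

Let mB v ij : measurable (B v ij).
Proof. by rewrite /B; case: insub => [i|] //; case: insub. Qed.

Let J : {fset nat * nat} := [fset (val ij.1, val ij.2) | ij in {: 'I_n * 'I_n}]%fset.

Let codedE v : coded @^-1` [set v] =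
  \bigcap_(ij in [set` J]) (X ij.1 ij.2 @^-1` B v ij).
Proof.
apply/seteqP; split => w /=.
  move=> <- ij /= /imfsetP[[i j] _ ->] /=.
  by rewrite BE /= !ffunE.
move=> h; apply/ffunP => i; apply/ffunP => j; rewrite !ffunE.
have := h (val i, val j); rewrite BE /=; apply.
by apply/imfsetP; exists (i, j).
Qed.

Lemma measurable_coded v : measurable (coded @^-1` [set v]).
Proof.
rewrite codedE; apply: fin_bigcap_measurable => [|ij _].
  exact: finite_fset.
exact: measurable_funPTI (mB v ij).
Qed.

Lemma coded_law : flaw P coded =1 fprod (fprod (flaw P (fun w => idx (X 0%N 0%N w)))).
Proof.
move=> v; rewrite /flaw codedE Xiid.1; last by move=> ij; exact: mB.
rewrite big_imfset /=; last first.
  by move=> [i j] [i' j'] _ _ /= [/val_inj -> /val_inj ->].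
transitivity (fine (\prod_(ij : 'I_n * 'I_n) (flaw P (fun w => idx (X 0%N 0%N w))
  (v ij.1 ij.2))%:E)%E).
  congr fine; rewrite big_enum /=; apply: eq_bigr => -[i j] _ /=.
  rewrite (BE v i j) iid_preimage //.
  have -> : (X 0%N 0%N @^-1` (idx @^-1` [set v i j]) =
      (fun w => idx (X 0%N 0%N w)) @^-1` [set v i j])%classic by [].
  by apply: flawE => k; exact: measurable_funPTI (midx k).
rewrite -(big_morph EFin (id1 := 1%E) (op1 := *%E) (@EFinM R) erefl) /=.
by rewrite /fprod pair_big /=.
Qed.

Lemma coded_prob (b : pred mat_sp) :
  P (coded @^-1` [set v | b v]) =
  (Ew (fprod (fprod (flaw P (fun w => idx (X 0%N 0%N w))))) (fun v => (b v)%:R))%:E.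
Proof.
rewrite (flaw_prob _ measurable_coded); congr EFin.
by apply: eq_bigr => v _; rewrite coded_law.
Qed.

End joint_law.

(** * Tail bound for the given array *)

Section tail.
Context d (T : measurableType d) (R : realType) (P : probability T R).
Context (X : nat -> nat -> {RV P >-> R}) (sigma : R).
Context (Xiid : iid (fun ij : nat * nat => X ij.1 ij.2)).
Context (X_ge0 : forall (i j : nat) (w : T), 0 <= X i j w).
Context (X_mean : ('E_P[X 0%N 0%N] = 1)%E).
Context (X_var : ('V_P[X 0%N 0%N] = (sigma ^+ 2)%:E)%E).

Let X_1 : (\int[P]_w (X 0%N 0%N w)%:E = 1)%E.
Proof. by rewrite -X_mean expectation_def. Qed.

Let mX : measurable_fun setT (X 0%N 0%N). Proof. exact: measurable_funPT. Qed.

Let X_2 : (\int[P]_w (X 0%N 0%N w ^+ 2)%:E = (1 + sigma ^+ 2)%:E)%E.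
Proof.
have := X_var; rewrite /variance unlock X_mean /= unlock => V.
have : (\int[P]_w ((X 0%N 0%N w ^+ 2)%:E + 1%:E) =
        \int[P]_w ((((X 0%N 0%N w) - 1) * ((X 0%N 0%N w) - 1))%:E + 2%:E * (X 0%N 0%N w)%:E))%E.
  apply: eq_integral => w _; rewrite -EFinM -!EFinD; congr EFin; ring.
rewrite ge0_integralD //=; last 2 first.
- by move=> w _; rewrite lee_fin sqr_ge0.
- by apply/measurable_EFinP; exact: measurable_funX.
rewrite ge0_integralD //=; last 4 first.
- by move=> w _; rewrite lee_fin -expr2 sqr_ge0.
- apply/measurable_EFinP; apply: measurable_funM; apply: measurable_funB => //.
- by move=> w _; rewrite -EFinM lee_fin mulr_ge0.
- by apply/measurable_EFinP; apply: measurable_funM.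
rewrite [X in _ = X + _ -> _](_ : _ = (sigma ^+ 2)%:E)%E; last by rewrite -V.
rewrite ge0_integralZl //; last 2 first.
- exact/measurable_EFinP.
- by move=> w _; rewrite lee_fin.
have PT : (\int[P]_w 1%:E = 1)%E by rewrite integral_cst // mul1e; exact: probability_setT.
rewrite X_1 PT mule1.
move=> e; have : (\int[P]_w (X 0%N 0%N w ^+ 2)%:E + 1 - 1 = (sigma ^+ 2)%:E + 2%:E - 1)%E by rewrite e.
rewrite addeK // => ->; transitivity ((sigma ^+ 2 + 2 - 1)%:E)%E => //.
by congr EFin; ring.
Qed.

(** Of the [3 e], two come from [finite_law_tail] for the rounded array and one from the rounding.
    The exceptional set is explicit, so measurability is checked on it alone. *)
Theorem markov_stieltjes_tail (t m e : R) : 0 < t ->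
  is_limit_strace t (sigma ^+ 2) m -> 0 < e ->
  exists C N0, forall n, (N0 <= n)%N -> exists2 E, measurable E /\
    (P E <= (C / n%:R ^+ 2)%:E)%E &
    forall w, ~ E w ->
      `|markov_stieltjes t (\matrix_(i < n, j < n) X i j w) - m| <= e *+ 3.
Proof.
move=> t0 lim_m e0.
have [eta eta0 H1] := finite_law_tail t0 (sqr_ge0 sigma) lim_m e0.
have [L L1 hL] := grid_tail (X_ge0 0 0) X_2 eta0.
have [N1 hN1] := H1 L L1.
set C0 := 11%:R / _ / _ in hN1.
exists (C0 + 1), N1.+1 => n nN.
have n0 : (0 < n)%N by exact: leq_trans nN.
have np : 0 < n%:R :> R by rewrite ltr0n.
have np4 : 0 < n%:R ^+ 4 :> R by exact: exprn_gt0.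
pose al := e * t ^+ 3 / 2%:R.
have al0 : 0 < al by apply: divr_gt0 => //; apply: mulr_gt0 => //; exact: exprn_gt0.
(* In [markov_stieltjes_compare], [al] makes the second error [e / 2]; as [del^2 <= del], this [del]
   makes the first one at most [e / 2]. *)
pose del := Num.min 2^-1 (e * al / (8%:R * n%:R)).
have q0 : 0 < e * al / (8%:R * n%:R) by apply: divr_gt0; apply: mulr_gt0.
have del0 : 0 < del by rewrite lt_min q0 andbT; lra.
have del2 : del <= 2^-1 by rewrite ge_min lexx.
have dele : del <= e * al / (8%:R * n%:R) by rewrite ge_min lexx orbT.
have n4 : 0 < (n%:R ^+ 4)^-1 :> R by rewrite invr_gt0.
(* The grid depends on [n]: each of the [n^2] entries is bad with probability at most [n^-4], hence
   some entry is with probability at most [n^-2]. *)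
have [N [/= [h1 h2] h3]] := filter_ex (filterI (filterI
  (grid_moment1 (X_ge0 0 0) X_1 eta0) (grid_moment2 (X_ge0 0 0) X_2 eta0))
  (grid_bad_small (X_ge0 0 0) del0 n4)).
pose V := 'I_(grid_size N); pose idx : R -> V := grid_index N.
pose p := flaw P (fun w => idx (X 0%N 0%N w)).
pose a : V -> R := @grid_value _ N.
have midx k : measurable (idx @^-1` [set k]) by exact: measurable_grid_index.
have law : approx_law p a (sigma ^+ 2) L eta.
  split => //.
  - by apply: isdist_flaw => k; exact: measurable_grid_rv.
  - exact: grid_value_ge0.
pose b (w : {ffun 'I_n -> {ffun 'I_n -> V}}) := (e + e < `|markov_stieltjes t (matval a w) - m|)%R.
pose E1 : set T := coded X idx n @^-1` [set w | b w].
(* The entry [(i, j)] is numbered [k = i n + j], so that Boole's inequality for sequences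
   applies. *)
pose E2 : set T := \big[setU/set0]_(k < n * n)
  (X (k %/ n)%N (k %% n)%N @^-1` grid_bad N del).
have mE1 : measurable E1.
  by apply: measurable_fibers; exact: measurable_coded.
have mbad i j : measurable (X i j @^-1` grid_bad N del).
  exact: measurable_funPTI (measurable_grid_bad N del).
have mE2 : measurable E2 by apply: bigsetU_measurable.
exists (E1 `|` E2).
  split; first exact: measurableU.
  apply: (le_trans (measureU2 _ mE1 mE2)).
  rewrite mulrDl EFinD; apply: leeD.
    have PE1 : (P E1 <= (C0 / n%:R ^+ 2)%:E)%E.
      rewrite /E1 (coded_prob Xiid midx b) lee_fin; apply: hN1 => //.
      exact: ltnW.
    exact: PE1.
  apply: (@le_trans _ _ (\sum_(k < n * n) P (X (k %/ n)%N (k %% n)%N @^-1` grid_bad N del))%E).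
    apply: (Boole_inequality P (A := fun k => X (k %/ n)%N (k %% n)%N @^-1` grid_bad N del)) => *; exact: mbad.
  apply: (@le_trans _ _ (\sum_(k < n * n) ((n%:R ^+ 4)^-1)%:E)%E).
    apply: lee_sum => k _; rewrite (iid_preimage Xiid) //.
    exact: measurable_grid_bad.
  rewrite sumEFin lee_fin sumr_const card_ord -[_ *+ _]mulr_natl natrM.
  by rewrite le_eqVlt; apply/orP; left; apply/eqP; field; rewrite gt_eqF.
move=> w /not_orP[/= nE1 nE2].
have nb : `|markov_stieltjes t (matval a (coded X idx n w)) - m| <= e + e.
  by rewrite leNgt; apply/negP => h; apply: nE1.
have good (i j : 'I_n) : ~ grid_bad N del (X i j w).
  move=> h; apply: nE2.
  have kn : (i * n + j < n * n)%N.
    have := ltn_ord i; have := ltn_ord j; clear; move: (val i) (val j) => i' j'; nia.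
  rewrite /E2 -(bigcup_mkord (n * n) (fun k => X (k %/ n)%N (k %% n)%N @^-1` grid_bad N del)); exists (i * n + j)%N => //=.
  by rewrite divnMDl // divn_small // addn0 modnMDl modn_small.
have cmp : `|markov_stieltjes t (\matrix_(i < n, j < n) X i j w) -
    markov_stieltjes t (matval a (coded X idx n w))| <= e.
  apply: (le_trans (markov_stieltjes_compare n0 t0 al0 (ltW del0) del2 _ _)).
  - by move=> i j; rewrite mxE.
  - move=> i j; rewrite !mxE !ffunE /a /idx.
    have x0 := X_ge0 i j w; have g := grid_le N x0; rewrite g andbT.
    have [->|xn0] := eqVneq (X i j w) 0; first by rewrite mulr0 grid_value_ge0.
    have := good i j => /not_andP[|/not_orP[/negP b1 /negP b2]]; first by rewrite xn0.
    rewrite -ltNge in b2; rewrite -leNgt in b1.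
    move: b1; rewrite ler_pdivrMr // => b1.
    apply: le_trans (ltW (grid_gt x0 b2)).
    by rewrite mulrBl mul1r lerD2l lerN2 mulrC.
  - have -> : al / t ^+ 3 = e / 2%:R by rewrite /al; field; rewrite gt_eqF.
    have d2 : del ^+ 2 <= del by rewrite expr2 ler_piMl ?(ltW del0) //; lra.
    have : al^-1 * (4%:R * del ^+ 2 * n%:R) <= e / 2%:R.
      rewrite mulrC ler_pdivrMr //.
      move: dele; rewrite ler_pdivlMr ?mulr_gt0 // => dele.
      have := ler_wpM2r (ltW np) d2; lra.
    by lra.
have := ler_normD (markov_stieltjes t (\matrix_(i < n, j < n) X i j w) -
    markov_stieltjes t (matval a (coded X idx n w))) (markov_stieltjes t (matval a (coded X idx n w)) - m).
rewrite subrKA => h; apply: (le_trans h).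
have -> : e *+ 3 = e + (e + e) by rewrite mulrS mulr2n.
exact: lerD.
Qed.

End tail.

Local Open Scope sesquilinear_scope.
Local Open Scope complex_scope.

(** * Singular values *)

Section singular_value_sums.
Context {R : realType}.
Local Notation C := R[i].

Lemma char_poly_conj (n : nat) (U : 'M[C]_n) (D : 'rV[C]_n) : U \is unitarymx ->
  char_poly (U ^t* *m diag_mx D *m U) = \prod_(i < n) ('X - (D 0 i)%:P).
Proof.
move=> Uu; have /unitarymxP UU := Uu.
have UU' : U ^t* *m U = 1%:M.
  by have := mulVmx (unitarymx_unit Uu); rewrite invmx_unitary.
rewrite /char_poly /char_poly_mx.
set P := map_mx polyC.
have -> : 'X%:M - P (U ^t* *m diag_mx D *m U) = P (U ^t*) *m ('X%:M - P (diag_mx D)) *m P U.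
  rewrite mulmxBr mulmxBl /P !map_mxM; congr (_ - _).
  by rewrite -[RHS]mulmxA -scalar_mxC mulmxA -map_mxM UU' map_mx1 mul1mx.
rewrite !det_mulmx mulrAC -det_mulmx /P -map_mxM UU' map_mx1 det1 mul1r.
rewrite -[\det _]/(char_poly (diag_mx D)) char_poly_trig ?diag_mx_is_trig //.
by apply: eq_bigr => i _; rewrite mxE eqxx.
Qed.

(** Both lists are the roots of one characteristic polynomial, which fixes them up to order. *)
Lemma singular_values_spectral n (A : 'M[C]_n) :
  perm_eq [seq s%:C | s <- singular_values A]
    [seq sqrtC (spectral_diag (A *m A ^t*) 0 i) | i : 'I_n].
Proof.
apply/prod_XsubC_eq; rewrite big_map -char_poly_singular_values big_image.
rewrite /sqrtmx char_poly_conj ?spectral_unitarymx //=.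
by apply: eq_bigr => i _; rewrite mxE.
Qed.

(** Squaring undoes the square root, so the sum is the trace of the resolvent of [A A^T], computed
    over the complex numbers in the spectral basis; [strace_tr] passes to [A^T A]. *)
Lemma sum_singular_values n (A : 'M[R]_n) (t : R) : 0 < t ->
  \sum_(s <- singular_values (map_mx (real_complex R) A)) (s ^+ 2 + t)^-1 =
  strace t A.
Proof.
move=> t0; set Ac := map_mx _ A; set B := Ac *m Ac ^t*; set d := spectral_diag B.
have Bp : psdmx B by exact: psdmx_mulmx_tr.
apply: (fmorph_inj (real_complex R)).
rewrite rmorph_sum /=.
transitivity (\sum_(z <- [seq s%:C | s <- singular_values Ac]) (z ^+ 2 + t%:C)^-1).
  rewrite big_map; apply: eq_bigr => s _.
  by rewrite fmorphV rmorphD rmorphXn.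
rewrite (perm_big _ (singular_values_spectral Ac)) big_image /= -/B -/d.
have U := spectral_unitarymx B; set UB := spectralmx B in U.
have /unitarymxP UU := U.
have dt i : d 0 i + t%:C != 0.
  by rewrite gt_eqF // ltr_wpDl ?spectral_diag_psd // ltcR.
pose e : 'rV[C]_n := \row_i (d 0 i + t%:C)^-1.
have BE : B = UB ^t* *m diag_mx d *m UB.
  have [/hermitian_normalmx /orthomx_spectralP h _] := Bp.
  by rewrite [LHS]h invmx_unitary.
have UU' : UB ^t* *m UB = 1%:M.
  by have := mulVmx (unitarymx_unit U); rewrite invmx_unitary.
have inv : invmx (B + (t%:C)%:M) = UB ^t* *m diag_mx e *m UB.
  have H : (UB ^t* *m diag_mx e *m UB) *m (B + (t%:C)%:M) = 1%:M.
    have -> : B + (t%:C)%:M = UB ^t* *m diag_mx (d + const_mx t%:C) *m UB.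
      rewrite linearD /= mulmxDr mulmxDl -BE; congr (_ + _).
      by rewrite diag_const_mx scalar_mxC -mulmxA UU' mulmx1.
    rewrite -!mulmxA (mulmxA UB) UU mul1mx (mulmxA (diag_mx e)) mulmx_diag.
    rewrite (_ : diag_mx _ = 1%:M) ?mul1mx //.
    rewrite -diag_const_mx; congr diag_mx; apply/rowP => i.
    by rewrite !mxE mulVf.
  have [_ Bu] := mulmx1_unit H.
  by rewrite -[LHS]mul1mx -H -[LHS]mulmxA mulmxV // mulmx1.
transitivity (\tr (invmx (B + (t%:C)%:M))).
  rewrite inv mxtrace_mulC mulmxA UU mul1mx mxtrace_diag.
  by apply: eq_bigr => i _; rewrite mxE sqrtCK.
rewrite -(strace_tr t0) /strace trmxK /resolv -[RHS]/((real_complex R) _).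
have -> : B + (t%:C)%:M = map_mx (real_complex R) (A *m A^T + t%:M).
  rewrite map_mxD map_mxM map_scalar_mx /B /Ac; congr (_ *m _ + _).
  apply/matrixP => i j; rewrite !mxE; exact: conjc_real.
by rewrite -map_invmx -(trace_map_mx (real_complex R)).
Qed.

End singular_value_sums.

Section singular_value_measure.
Context {R : realType}.

Lemma singular_value_ge0 n (A : 'M[R[i]]_n) k : 0 <= singular_value A k.
Proof.
rewrite /singular_value; have [kn|kn] := ltnP k (size (singular_values A)); last first.
  by rewrite nth_default.
have := mem_nth 0 kn; rewrite mem_sort => /mapP[z zA ->].
have := psd_eigenvalues (sqrtmx_psd (psdmx_mulmx_tr A)) zA.
by case: z {zA} => a b; rewrite lecE /= => /andP[].
Qed.

Lemma sv_measureE n (A : 'M[R[i]]_n) V :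
  sv_measure A V = ((n%:R^-1)%:E * \sum_(k < n) \d_(singular_value A k) V)%E.
Proof. by []. Qed.

Lemma sv_measure_mass n (A : 'M[R[i]]_n) : (0 < n)%N -> sv_measure A setT = 1%E.
Proof.
move=> n0; rewrite sv_measureE; under eq_bigr do rewrite diracT.
rewrite sumEFin sumr_const card_ord -EFinM; congr EFin.
by rewrite mulVf // pnatr_eq0 -lt0n.
Qed.

Lemma sv_measure_neg n (A : 'M[R[i]]_n) : sv_measure A `]-oo, 0%R[%classic = 0%E.
Proof.
rewrite sv_measureE big1 ?mule0 // => k _.
rewrite diracE memNset //= in_itv /= => h.
by have := singular_value_ge0 A k; rewrite leNgt h.
Qed.

Lemma is_mean_sv n (A : 'M[R[i]]_n) : (0 < n)%N -> is_mean (mean_of (sv_measure A)).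
Proof.
by move=> n0; apply: is_mean_of; [exact: sv_measure_mass | exact: sv_measure_neg].
Qed.

Lemma mean_sv_res n (A : 'M[R]_n) t : 0 < t ->
  mean_of (sv_measure (map_mx (real_complex R) A)) (res t) = stieltjes t A.
Proof.
move=> t0; set Ac := map_mx _ A.
have mr : measurable_fun setT (EFin \o res t).
  have [rc _] := bcont_res t0.
  by apply/measurable_EFinP; exact: continuous_measurable_fun.
rewrite /mean_of /Rintegral /sv_measure.
rewrite ge0_integral_mscale //=; last by move=> x _; rewrite lee_fin ltW // res_gt0.
rewrite ge0_integral_measure_sum //=; last by move=> x _; rewrite lee_fin ltW // res_gt0.
under eq_bigr do rewrite integral_dirac // diracT mul1e.
rewrite sumEFin -EFinM /= /stieltjes -(sum_singular_values A t0) -/Ac mulrC.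
congr (_ / _); rewrite (big_nth 0) size_singular_values big_mkord.
by apply: eq_bigr => k _.
Qed.

End singular_value_measure.

Local Close Scope sesquilinear_scope.

(** * Almost sure convergence *)

Section borel_cantelli.
Context d (T : measurableType d) (R : realType) (P : probability T R).

(** Telescoping, from [1 / x^2 <= 2 / (x (x + 1))] for [x >= 1]. *)
Lemma sum_inv_sqr_le (n : nat) :
  \sum_(k < n) (k.+1%:R ^+ 2)^-1 <= 2%:R - 2%:R / n.+1%:R :> R.
Proof.
elim: n => [|n IH]; first by rewrite big_ord0 divr1 subrr.
rewrite big_ord_recr /=; apply: le_trans (lerD IH (lexx _)) _.
have n1 : 0 < n.+1%:R :> R by rewrite ltr0n.
rewrite -[n.+2%:R]natr1; set x := n.+1%:R in n1 *.
have x1 : 0 < x + 1 by rewrite ltr_wpDr.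
have e : 2%:R - 2%:R / (x + 1) - (2%:R - 2%:R / x + (x ^+ 2)^-1) =
   (x - 1) / (x ^+ 2 * (x + 1)) by field; rewrite !gt_eqF.
rewrite -subr_ge0 e divr_ge0 ?mulr_ge0 ?sqr_ge0 ?(ltW x1) //.
by rewrite subr_ge0 ler1n.
Qed.

(** The first Borel-Cantelli lemma, applied to the exceptional sets rather than to [Q], whose
    measurability is not assumed. The indices start at [N0 + 1], which avoids dividing by [0]. *)
Lemma ae_eventually (Q : nat -> T -> Prop) :
  (exists C N0, forall n, (N0 <= n)%N ->
    exists2 E, measurable E /\ (P E <= (C / n%:R ^+ 2)%:E)%E & forall w, ~ E w -> Q n w) ->
  {ae P, forall w, exists N, forall n, (N <= n)%N -> Q n w}.
Proof.
move=> [C [N0 H]].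
have H' k : exists E, [/\ measurable E, (P E <= (`|C| * (k.+1%:R ^+ 2)^-1)%:E)%E &
    forall w, ~ E w -> Q (N0 + k.+1)%N w].
  have [E [mE PE] EQ] := H (N0 + k.+1)%N (leq_addr _ _).
  exists E; split => //; apply: (le_trans PE); rewrite lee_fin.
  apply: (@le_trans _ _ (`|C| / (N0 + k.+1)%:R ^+ 2)).
    by rewrite ler_wpM2r ?invr_ge0 ?sqr_ge0 // ler_norm.
  rewrite ler_wpM2l // lef_pV2 ?posrE ?exprn_gt0 ?ltr0n ?addnS //.
  by rewrite ler_pXn2r ?nnegrE // ler_nat -addnS leq_addl.
have [F hF] := choice H'.
have mF k : measurable (F k) by case: (hF k).
have F0 : P (lim_sup_set F) = 0%E.
  apply: lim_sup_set_cvg0 => //.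
  apply: (@le_lt_trans _ _ (`|C| * 2%:R)%:E); last exact: ltry.
  apply: lime_le; first by apply: is_cvg_nneseries => k _ _; exact: measure_ge0.
  apply: nearW => n; rewrite big_mkord.
  apply: (@le_trans _ _ (\sum_(k < n) (`|C| * (k.+1%:R ^+ 2)^-1)%:E)%E).
    by apply: lee_sum => k _; case: (hF k).
  rewrite sumEFin lee_fin -mulr_sumr ler_wpM2l //.
  by rewrite (le_trans (sum_inv_sqr_le n)) // gerBl.
exists (lim_sup_set F); split => //.
  apply: bigcap_measurable => // k _; exact: bigcup_measurable.
move=> w /= nQ k _; apply: contrapT => nF; apply: nQ.
exists (N0 + k.+1)%N => n Nn.
have -> : n = (N0 + (n - N0.+1).+1)%N by lia.
have [_ _] := hF (n - N0.+1)%N; apply => Fw; apply: nF.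
by exists (n - N0.+1)%N => //=; lia.
Qed.

End borel_cantelli.

Theorem theorem1p1 (d : measure_display) (T : measurableType d) (R : realType)
    (P : probability T R) (X : nat -> nat -> {RV P >-> R}) (sigma : R)
    (Xiid : iid (fun ij : nat * nat => X ij.1 ij.2))
    (X_ge0 : forall (i j : nat) (w : T), 0 <= X i j w)
    (X_mean : ('E_P[X 0%N 0%N] = 1)%E)
    (sigma_gt0 : 0 < sigma)
    (X_var : ('V_P[X 0%N 0%N] = (sigma ^+ 2)%:E)%E) :
  {ae P, forall w : T,
    weakly_converges
      (fun n : nat => sv_measure
         (map_mx (real_complex R)
            (Num.sqrt (n%:R : R) *: markov_mx (fun i j => X i j) n w)))
      (quartercircular sigma)}.
Proof.
pose Xn n w : 'M[R]_n := \matrix_(i < n, j < n) X i j w.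
pose m t := mean_of (quartercircular sigma) (res t).
have ae_qk (q : rat) (k : nat) : 0 < q -> {ae P, forall w, exists N, forall n, (N <= n)%N ->
    `|markov_stieltjes (ratr q) (Xn n w) - m (ratr q)| <= k.+1%:R^-1 *+ 3}.
  move=> q0; apply: ae_eventually; have t0 : 0 < ratr q :> R by rewrite ltr0q.
  apply: (markov_stieltjes_tail Xiid X_ge0 X_mean X_var t0) => //.
  exact: quartercircular_res.
(* The countably many conditions, over positive rationals [q] and tolerances [3 / (k + 1)], are
   numbered by [pickle] so that one null set covers all of them. For [w] outside it the argument is
   deterministic. *)
pose G (i : nat) w := if (choice.unpickle i : option (rat * nat)) is Some (q, k) then
    0 < q -> exists N, forall n, (N <= n)%N ->
    `|markov_stieltjes (ratr q) (Xn n w) - m (ratr q)| <= k.+1%:R^-1 *+ 3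
  else True.
have aeG i : {ae P, forall w, G i w}.
  rewrite /G; case: (choice.unpickle i) => [[q k]|]; last exact: aeW.
  have [q0|/negP q0] := boolP (0 < q); last by apply: aeW.
  by apply: filterS (ae_qk q k q0).
have := ae_foralln aeG; apply: filterS => w Hw.
pose A n : 'M[R]_n := Num.sqrt n%:R *: markov_mx (fun i j => X i j) n w.
(* The index is shifted because the measure for [n = 0] is zero, hence not a mean. *)
pose Ln n := mean_of (sv_measure (map_mx (real_complex R) (A n.+1))).
have mLn n : is_mean (Ln n) by exact: is_mean_sv.
have mL : is_mean (mean_of (quartercircular sigma)).
  by apply: is_mean_of; [exact: quartercircular_mass | exact: quartercircular_neg].
have lim_rat (q : rat) : 0 < q -> meanlim Ln (mean_of (quartercircular sigma)) (res (ratr q)).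
  move=> q0 e e0; have t0 : 0 < ratr q :> R by rewrite ltr0q.
  have [k hk] := div_nat_small 3%:R e0.
  have := Hw (choice.pickle (q, k)); rewrite /G choice.pickleK => /(_ q0)[N hN].
  exists N => n Nn; rewrite /Ln mean_sv_res //.
  have -> : A n.+1 = Num.sqrt n.+1%:R *: rownorm (Xn n.+1 w).
    congr (_ *: _); apply/matrixP => i j; rewrite !mxE.
    have -> : \sum_k Xn n.+1 w i k = \sum_(k < n.+1) X i k w.
      by apply: eq_bigr => l _; rewrite mxE.
    by [].
  apply: le_trans (hN _ (leqW Nn)) _; apply: le_trans (hk k.+1 (leqnSn _)).
  by rewrite mulr_natl.
move=> f fc [K [_ fK]].
have fb : bcont f.
  by split => //; exists (K + 1) => x; apply: fK => //; rewrite ltrDl.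
rewrite -cvg_shiftS /= (mean_ofE (quartercircular_mass sigma_gt0) fb).
under eq_fun do rewrite (mean_ofE (sv_measure_mass _ (ltn0Sn _)) fb).
apply: cvg_EFin; first exact: nearW.
apply/cvgrPdist_le => e e0.
have sigma2_ge0 : 0 <= 2 * sigma by rewrite mulr_ge0 // ltW.
have L_supp (g : R -> R) : bcont g -> (forall x, 0 <= x <= 2 * sigma -> g x = 0) ->
    mean_of (quartercircular sigma) g = 0.
  move=> gb g0.
  rewrite (mean_of_supp (quartercircular_mass sigma_gt0)
    (measurable_itv `[0, 2 * sigma]) (quartercircular_supp sigma) gb).
  rewrite /Rintegral integral0_eq // => x; rewrite /= in_itv /= => x2.
  by rewrite g0.
have [N hN] := mean_weak_limit mLn mL lim_rat sigma2_ge0 L_supp fb e0.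
by exists N => // n /= Nn; rewrite distrC; exact: hN.
Qed.
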